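(* Let $k\geq 2$ be an integer and let $d,D$ be discriminants (integers $\equiv 0,1\pmod 4$) with $dD<0$ and $D$ fundamental. Then for every $n\in\mathbb{N}$ we have $$(-1)^{k+ndD}\,c_{f_{k,d,D}}(n)>0.$$ In particular, none of the coefficients $c_{f_{k,d,D}}(n)$, $n\ge 1$, of $f_{k,d,D}$ vanishes.
   Context: Let $\mathbb{H}$ be the complex upper half-plane and $q=e^{2\pi i z}$. Fundamental discriminants include $1$. For $dD<0$, $\mathcal{Q}_{dD}$ is the set of positive definite integral binary quadratic forms $Q=[a,b,c]$, $Q(x,y)=ax^2+bxy+cy^2$, of discriminant $b^2-4ac=dD$ (not necessarily primitive). The genus character $\chi_D$ on $\mathcal{Q}_{dD}$ is $\chi_D([a,b,c])=\left(\frac{D}{n}\right)$ if $\gcd(a,b,c,D)=1$, where $n$ is any integer represented by $[a,b,c]$ that is coprime to $D$, and $\chi_D([a,b,c])=0$ otherwise. Write $d=\ell^2 d_0$ with a fundamental discriminant $d_0$ and $\ell\in\mathbb{N}$. Define $$f_{k,d,D}(z)=C_{k,d,D}\sum_{Q\in\mathcal{Q}_{dD}}\chi_D(Q)Q(z,1)^{-k},\qquad C_{k,d,D}=\frac{(k-1)!}{(2\pi)^k}\cdot\begin{cases}|d|^{k-\frac12}, & (-1)^kd>0,\\ \ell^{2k-1}|D|^{k-\frac12}, & (-1)^kd<0.\end{cases}$$ This is a meromorphic modular form of weight $2k$ for $\mathrm{SL}_2(\mathbb{Z})$ with poles at the CM points of discriminant $dD$, decaying like a cusp form at $i\infty$.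 Its Fourier coefficients $c_{f_{k,d,D}}(n)$ are those of its expansion $f_{k,d,D}(z)=\sum_{n\geq1}c_{f_{k,d,D}}(n)q^n$, valid for $\mathrm{Im}(z)>\sqrt{|dD|}/2$. *)

(* Defs.v *)
From HB Require Import structures.
From mathcomp Require Import all_boot all_order all_algebra complex.
From mathcomp Require Import all_classical all_reals all_analysis.
From mathcomp Require summability.

Set Implicit Arguments.
Unset Strict Implicit.
Unset Printing Implicit Defensive.

Import Order.TTheory GRing.Theory Num.Theory numFieldNormedType.Exports.

Local Open Scope classical_set_scope.
Local Open Scope ring_scope.
Local Open Scope complex_scope.

(* The usual topology of the complex numbers: the library attaches the norm
   topology to the alias R[i]^o only. *)
HB.instance Definition _ (R : realType) := NormedModule.copy R[i] R[i]^o.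

Definition discriminant (m : int) : Prop :=
  (m = 0 %[mod 4])%Z \/ (m = 1 %[mod 4])%Z.

Definition squarefree (m : int) : Prop :=
  forall p : nat, prime p -> ~~ (p%:Z ^+ 2 %| m)%Z.

(* Includes 1. *)
Definition fundamental_discriminant (m : int) : Prop :=
  ((m = 1 %[mod 4])%Z /\ squarefree m) \/
  (exists r : int, [/\ m = 4 * r, squarefree r &
     (r = 2 %[mod 4])%Z \/ (r = 3 %[mod 4])%Z]).

(* The Kronecker symbol (a / n) for arbitrary integers a and n.
   [kronecker_prime a p] is (a / p) for a prime p: the Legendre symbol if p is
   odd, and the residue of a modulo 8 decides if p = 2. The sign of n
   contributes the factor (a / -1), and (a / 0) is 1 if a = 1 or a = -1, and 0
   otherwise. *)
Definition kronecker_prime (a : int) (p : nat) : int :=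
  if (p%:Z %| a)%Z then 0
  else if p == 2%N then
    (if ((a %% 8)%Z == 1) || ((a %% 8)%Z == 7) then 1 else -1)
  else if [exists x : 'I_p, (p%:Z %| x%:Z ^+ 2 - a)%Z] then 1 else -1.

Definition kronecker (a n : int) : int :=
  if n == 0 then (if `|a| == 1 then 1 else 0)
  else (if (n < 0) && (a < 0) then -1 else 1) *
       \prod_(p <- primes `|n|%N) kronecker_prime a p ^+ logn p `|n|%N.

(* The triple (a, b, c) is the form [a, b, c] = a x^2 + b x y + c y^2. *)
Definition form : Type := (int * int * int)%type.

Definition form_eval (A : comNzRingType) (Q : form) (x y : A) : A :=
  let: (a, b, c) := Q in
  a%:~R * x ^+ 2 + b%:~R * x * y + c%:~R * y ^+ 2.

Definition form_disc (Q : form) : int :=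
  let: (a, b, c) := Q in b ^+ 2 - 4 * a * c.

Definition posdef (Q : form) : Prop :=
  forall x y : int, (x, y) != (0, 0) -> 0 < form_eval Q x y.

Definition posdef_forms (N : int) : set form :=
  [set Q | posdef Q /\ form_disc Q = N].

Definition represents (Q : form) (n : int) : Prop :=
  exists x y : int, n = form_eval Q x y.

(* For fundamental D dividing the discriminant of Q, the value does not depend
   on the integer n selected by [xget]. *)
Definition genus_char (D : int) (Q : form) : int :=
  let: (a, b, c) := Q in
  if gcdz a (gcdz b (gcdz c D)) == 1 then
    kronecker D (xget 0 [set n : int | represents Q n /\ coprimez n D])
  else 0.

(* The l > 0 such that d = l^2 d0 with d0 a fundamental discriminant; it exists
   and is unique for every nonzero discriminant d. *)
Definition conductor (d : int) : nat :=
  xget 0%N [set l : nat | (0 < l)%N /\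
    exists d0 : int, fundamental_discriminant d0 /\ d = l%:Z ^+ 2 * d0].

Section ModularForm.
Variable R : realType.

Definition fkdD_const (k : nat) (d D : int) : R :=
  (k.-1)`!%:R / (2 * pi) ^+ k *
  (if 0 < (-1) ^+ k * d then `|d|%:~R `^ (k%:R - 2^-1)
   else (conductor d)%:R ^+ (2 * k).-1 * `|D|%:~R `^ (k%:R - 2^-1)).

(* [summability.sum] is the limit of the net of finite partial sums, i.e. the
   unordered sum of the (absolutely convergent, if k >= 2) series. *)
Definition fkdD (k : nat) (d D : int) (z : R[i]) : R[i] :=
  (fkdD_const k d D)%:C *
  summability.sum (fun Q : posdef_forms (d * D) =>
    (genus_char D (set_val Q))%:~R * form_eval (set_val Q) z 1 ^- k).

Definition cexp (z : R[i]) : R[i] :=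
  (expR (complex.Re z))%:C * (cos (complex.Im z) +i* sin (complex.Im z)).

Definition qpar (z : R[i]) : R[i] := cexp ((2 * pi)%:C * 'i * z).

(* f(z) = sum_(n >= 1) c n * q^n for Im z > y0. *)
Definition is_qexpansion (y0 : R) (f : R[i] -> R[i]) (c : nat -> R[i]) : Prop :=
  forall z : R[i], y0 < complex.Im z ->
    (fun N : nat => \sum_(1 <= n < N) c n * qpar z ^+ n) @ \oo --> f z.

(* [fun=> 0] is the junk value for an f without such an expansion. The
   coefficients c n with n >= 1 are uniquely determined; c 0 is not used. *)
Definition qcoef (y0 : R) (f : R[i] -> R[i]) : nat -> R[i] :=
  xget (fun=> 0) [set c | is_qexpansion y0 f c].

Definition fkdD_coef (k : nat) (d D : int) : nat -> R[i] :=
  qcoef (Num.sqrt `|d * D|%:~R / 2) (fkdD k d D).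

End ModularForm.

(* Main.v *)
Require Import Defs.
From mathcomp Require Import all_boot all_order all_algebra all_fingroup all_solvable all_field complex finmap.
From mathcomp Require Import all_classical all_reals all_analysis.
From mathcomp Require summability.
From mathcomp Require Import zify ring lra.

Set Implicit Arguments.
Unset Strict Implicit.
Unset Printing Implicit Defensive.

Import Order.TTheory GRing.Theory Num.Theory numFieldNormedType.Exports.

Local Open Scope ring_scope.
Local Open Scope complex_scope.

(* Write N = -dD > 0. The forms of discriminant -N are [a, b + 2am, *] with
   a > 0, 0 <= b < 2a, 4a | b^2 + N and m an integer, and their value at (z, 1)
   is a ((z + b/2a + m)^2 + N/4a^2). Expanding the (-k)-th power in N/4a^2
   (legitimate for Im z > sqrt N / 2) and summing over m by the Lipschitz formula
   gives
     c(n) = C (-1)^k sum_(a, b) chi_D(a, b) a^-k e(n b / 2a) B(a, n),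
   where B(a, n) = sum_j B_j(n) a^(-2j) is a Bessel type series with positive
   terms. The only b for a = 1 is N mod 2; there chi_D = 1 by quadratic
   reciprocity, so that the term a = 1 is C (-1)^(k + nN) B(1, n). It dominates
   all the others: the number r(a) of the b is at most a, which suffices for
   k >= 3, and for k = 2 also r(a) <= 4 sqrt (N a) is needed. Since c(n) is real
   (replace b by -b), its sign is (-1)^(k + nN). *)

(** * Unconditional sums of complex families *)

(** The case k = 2 shapes the estimates: the available bound for the sum of r(a) a^-2 over a >= 2
    exceeds 1 and grows linearly in N, so a = 1 cannot be shown to dominate for j = 0 alone. For j
    >= 1 the sum of r(a) a^(-2-2j) is at most 1/4, and B_1, B_2, B_3 are larger than B_0 by factors
    that are powers of pi^2 n^2 N; the comparison therefore succeeds after summation over j.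
    Rational estimates are enough: pi >= 3, and N >= 3 because N is 0 or 3 modulo 4. All series are
    unconditional sums over products of index types. Each interchange then needs one majorant that
    is a product of functions of the separate indices, and the binomial expansion and the Lipschitz
    formula become two groupings of the same family. The coefficients are defined by choosing some
    q-expansion, so uniqueness of q-expansions is part of the argument. The value of the genus
    character is likewise read off an integer chosen among those represented, so for the principal
    form every represented integer coprime to D must be treated. *)

Section ComplexModulus.
Variable R : realType.
Implicit Types z w : R[i].

(* The library's norm of a complex number is itself complex; this one is real. *)
Definition nc z : R := complex.Re `|z|.

Lemma ncE z : `|z| = (nc z)%:C.
Proof. by rewrite /nc normc_def. Qed.

Lemma nc_sqrt z : nc z = Num.sqrt (complex.Re z ^+ 2 + complex.Im z ^+ 2).
Proof. by rewrite /nc normc_def. Qed.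

Lemma nc_ge0 z : 0 <= nc z.
Proof. by rewrite nc_sqrt sqrtr_ge0. Qed.

Lemma nc_sqr z : nc z ^+ 2 = complex.Re z ^+ 2 + complex.Im z ^+ 2.
Proof. by rewrite nc_sqrt sqr_sqrtr // addr_ge0 ?sqr_ge0. Qed.

Lemma nc0 : nc 0 = 0.
Proof. by rewrite /nc normr0. Qed.

Lemma nc1 : nc 1 = 1.
Proof. by rewrite /nc normr1. Qed.

Lemma nc_eq0 z : (nc z == 0) = (z == 0).
Proof. by rewrite -[RHS]normr_eq0 ncE -[0 in RHS]/((0 : R)%:C) (inj_eq (@complexI _)). Qed.

Lemma ncN z : nc (- z) = nc z.
Proof. by rewrite /nc normrN. Qed.

Lemma ncM z w : nc (z * w) = nc z * nc w.
Proof.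
by apply: (@complexI R); rewrite rmorphM /= -!ncE normrM.
Qed.

Lemma ncX z n : nc (z ^+ n) = nc z ^+ n.
Proof. by apply: (@complexI R); rewrite rmorphXn /= -!ncE normrX. Qed.

Lemma ncV z : nc z^-1 = (nc z)^-1.
Proof. by apply: (@complexI R); rewrite fmorphV /= -!ncE normfV. Qed.

Lemma ncD z w : nc (z + w) <= nc z + nc w.
Proof. by rewrite -lecR rmorphD /= -!ncE ler_normD. Qed.

Lemma ncB z w : nc (z - w) <= nc z + nc w.
Proof. by rewrite -(ncN w) ncD. Qed.

Lemma nc_distC z w : nc (z - w) = nc (w - z).
Proof. by rewrite -ncN opprB. Qed.

Lemma nc_real (x : R) : nc x%:C = `|x|.
Proof. by rewrite nc_sqrt /= expr0n addr0 sqrtr_sqr. Qed.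

Lemma nc_sum (I : Type) (r : seq I) (P : pred I) (f : I -> R[i]) :
  nc (\sum_(i <- r | P i) f i) <= \sum_(i <- r | P i) nc (f i).
Proof.
apply: (big_ind2 (fun x y => nc x <= y)) => [|x y x' y' h h'|//].
  by rewrite nc0.
exact: le_trans (ncD _ _) (lerD h h').
Qed.

Lemma nc_geRe z : `|complex.Re z| <= nc z.
Proof. by rewrite nc_sqrt -sqrtr_sqr ler_wsqrtr // lerDl sqr_ge0. Qed.

Lemma nc_geIm z : `|complex.Im z| <= nc z.
Proof. by rewrite nc_sqrt -sqrtr_sqr ler_wsqrtr // lerDr sqr_ge0. Qed.

Lemma nc_leReIm z : nc z <= `|complex.Re z| + `|complex.Im z|.
Proof.
rewrite -(@ler_pXn2r _ 2) ?nnegrE ?nc_ge0 ?addr_ge0 //.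
rewrite nc_sqr sqrrD !real_normK ?num_real // addrAC lerDl mulrn_wge0 //.
Qed.

Lemma nc_nat n : nc n%:R = n%:R.
Proof. by rewrite -(rmorph_nat (real_complex R)) nc_real normr_nat. Qed.

Lemma nc_small z : (forall e : R, 0 < e -> nc z <= e) -> z = 0.
Proof.
move=> h; apply/eqP; rewrite -nc_eq0 eq_le nc_ge0 andbT.
by apply/ler_addgt0Pr => e e0; rewrite add0r h.
Qed.

End ComplexModulus.

Section Summation.
Variable R : realType.
Local Open Scope fset_scope.
Local Open Scope ring_scope.

(** The convergence behind [summability.sum]: finite sets directed by inclusion, measured by the
    real modulus. *)
Definition has_sum (I : choiceType) (f : I -> R[i]) (S : R[i]) : Prop :=
  forall e : R, 0 < e -> exists A : {fset I}, forall B : {fset I},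
    A `<=` B -> nc (\sum_(i <- B) f i - S) < e.

(** Stands for convergence of a nonnegative series with an explicit bound, without naming its
    sum. *)
Definition sums_le (I : choiceType) (g : I -> R) (C : R) : Prop :=
  forall A : {fset I}, \sum_(i <- A) g i <= C.

Section OneIndex.
Variable I : choiceType.
Implicit Types (f : I -> R[i]) (g : I -> R) (A B : {fset I}).

Lemma big_fset_split (V : nmodType) (F : I -> V) A B : A `<=` B ->
  \sum_(i <- B) F i = \sum_(i <- A) F i + \sum_(i <- B `\` A) F i.
Proof.
move=> AB; rewrite (big_fsetID _ (mem A)); congr (_ + _); apply: eq_fbigl => x.
  by rewrite !inE /= andbC; apply: andb_idr => /(fsubsetP AB).
by rewrite !inE /= andbC.
Qed.

Lemma has_sum_unique f S T : has_sum f S -> has_sum f T -> S = T.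
Proof.
move=> hS hT; apply/eqP; rewrite -subr_eq0; apply/eqP/nc_small => e e0.
have [A hA] := hS _ (divr_gt0 e0 (ltr0n _ 2)).
have [B hB] := hT _ (divr_gt0 e0 (ltr0n _ 2)).
have := hA _ (fsubsetUl A B); have := hB _ (fsubsetUr A B).
set s := \sum_(i <- _) _ => h1 h2.
have -> : S - T = (s - T) - (s - S) by ring.
by apply: le_trans (ncB _ _) _; lra.
Qed.

Lemma has_sum_ext f f' S : f =1 f' -> has_sum f S -> has_sum f' S.
Proof. by move=> ff; rewrite (_ : f' = f) //; apply/funext=> i; rewrite ff. Qed.

Lemma has_sumZ (c : R[i]) f S :
  has_sum f S -> has_sum (fun i => c * f i) (c * S).
Proof.
move=> h e e0; have c0 : 0 < nc c + 1 by rewrite ltr_wpDl // nc_ge0.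
have [A hA] := h _ (divr_gt0 e0 c0).
exists A => B AB; rewrite -mulr_sumr -mulrBr ncM.
apply: le_lt_trans (_ : (nc c + 1) * nc (\sum_(i <- B) f i - S) < e).
  by rewrite ler_wpM2r ?nc_ge0 // lerDl.
by rewrite mulrC -ltr_pdivlMr // hA.
Qed.

Lemma has_sumD f f' S S' :
  has_sum f S -> has_sum f' S' -> has_sum (fun i => f i + f' i) (S + S').
Proof.
move=> h h' e e0; have [A hA] := h _ (divr_gt0 e0 (ltr0n _ 2)).
have [B hB] := h' _ (divr_gt0 e0 (ltr0n _ 2)).
exists (A `|` B) => X; rewrite fsubUset => /andP[/hA h1 /hB h2].
rewrite big_split opprD addrACA.
by apply: le_lt_trans (ncD _ _) _; lra.
Qed.

Lemma has_sum_conj f S : has_sum f S -> has_sum (fun i => (f i)^*%C) (S^*%C).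
Proof.
move=> h e /h[A hA]; exists A => B /hA; congr (_ < _).
rewrite -rmorph_sum -rmorphB /= !nc_sqrt.
by case: (_ - S) => x y /=; rewrite sqrrN.
Qed.

Lemma has_sum_finite f A :
  (forall i, i \notin A -> f i = 0) -> has_sum f (\sum_(i <- A) f i).
Proof.
move=> h e e0; exists A => B AB; rewrite -(big_fset_incl _ AB) ?subrr ?nc0 //.
by move=> i _ /h.
Qed.

Lemma has_sum_norm_le f S C :
  has_sum f S -> sums_le (fun i => nc (f i)) C -> nc S <= C.
Proof.
move=> h hC; apply/ler_addgt0Pr => e /h[A hA].
have := hA _ (fsubset_refl A); set s := \sum_(i <- _) _ => h1.
have -> : S = s - (s - S) by rewrite opprB addrC subrK.
apply: le_trans (ncB _ _) _; rewrite lerD ?(ltW h1) //.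
exact: le_trans (nc_sum _ _ _) (hC A).
Qed.

Lemma sums_le_mono g g' C :
  (forall i, g i <= g' i) -> sums_le g' C -> sums_le g C.
Proof. by move=> h hC A; apply: le_trans (hC A); apply: ler_sum. Qed.

Lemma sums_leZ g C c : 0 <= c -> sums_le g C -> sums_le (fun i => c * g i) (c * C).
Proof. by move=> c0 h A; rewrite -mulr_sumr ler_wpM2l. Qed.

Lemma sums_leD g g' C C' :
  sums_le g C -> sums_le g' C' -> sums_le (fun i => g i + g' i) (C + C').
Proof. by move=> h h' A; rewrite big_split lerD. Qed.

Lemma has_sum_ge0 g C : (forall i, 0 <= g i) -> sums_le g C ->
  exists S : R, has_sum (fun i => (g i)%:C) S%:C.
Proof.
move=> g0 hC; pose E := [set x | exists A, x = \sum_(i <- A) g i]%classic.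
have hE : has_sup E.
  by split; [exists (\sum_(i <- fset0) g i), fset0|exists C => _ [A ->]].
exists (sup E) => e e0; have [_ [A ->] hA] := sup_adherent e0 hE.
exists A => B AB; rewrite -rmorph_sum -rmorphB nc_real.
have hB : \sum_(i <- B) g i <= sup E by apply: sup_upper_bound => //; exists B.
have : \sum_(i <- A) g i <= \sum_(i <- B) g i.
  by rewrite (big_fset_split _ AB) lerDl sumr_ge0.
by rewrite ler0_norm ?subr_le0 //; lra.
Qed.

Lemma has_sum_real_exists g C : sums_le (fun i => `|g i|) C ->
  exists S : R, has_sum (fun i => (g i)%:C) S%:C.
Proof.
(* Both |g| + g and |g| are nonnegative families with bounded sums, and g is their difference. *)
move=> hC; have [||S1 h1] := @has_sum_ge0 (fun i => `|g i| + g i) (C + C).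
- by move=> i; have := ler_norm (- g i); rewrite normrN; lra.
- by apply: sums_leD => //; apply: sums_le_mono hC => i; exact: ler_norm.
have [S2 h2] := has_sum_ge0 (fun i => normr_ge0 (g i)) hC.
exists (S1 - S2); have := has_sumD h1 (has_sumZ (-1) h2).
rewrite mulN1r -rmorphB; apply: has_sum_ext => i.
by rewrite mulN1r -rmorphB addrC addrA addNr add0r.
Qed.

Lemma has_sum_exists f C : sums_le (fun i => nc (f i)) C -> exists S, has_sum f S.
Proof.
move=> hC.
have [S1 h1] := @has_sum_real_exists _ _ (sums_le_mono (fun i => nc_geRe (f i)) hC).
have [S2 h2] := @has_sum_real_exists _ _ (sums_le_mono (fun i => nc_geIm (f i)) hC).
exists (S1%:C + 'i * S2%:C); have := has_sumD h1 (has_sumZ 'i h2).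
by apply: has_sum_ext => i; rewrite /= -complexE.
Qed.

Lemma sums_le_tail g C e : (forall i, 0 <= g i) -> sums_le g C -> 0 < e ->
  exists A, forall B, [disjoint A & B]%fset -> \sum_(i <- B) g i < e.
Proof.
move=> g0 hC e0; have [S hS] := has_sum_ge0 g0 hC.
have [A hA] := hS _ (divr_gt0 e0 (ltr0n _ 2)).
exists A => B dAB; have := hA _ (fsubsetUl A B); have := hA _ (fsubset_refl A).
rewrite -!rmorph_sum -!rmorphB !nc_real (big_fset_split _ (fsubsetUl A B)).
have -> : ((A `|` B) `\` A)%fset = B.
  by rewrite fsetDUl fsetDv fset0U; apply/fsetDidPl; rewrite fdisjoint_sym.
have := ler_norm (\sum_(i <- A) g i + \sum_(i <- B) g i - S).
have := ler_norm (- (\sum_(i <- A) g i - S)); rewrite normrN; lra.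
Qed.

(** Dominated convergence: a finite set A carries all but e/5 of the majorant, and on A termwise
    convergence is uniform. The tails of T n and of S cost 2e/5 each, the sum over A costs e/5. *)
Lemma tannery (F : nat -> I -> R[i]) (T : nat -> R[i]) f S g C :
  (forall n, has_sum (F n) (T n)) -> has_sum f S ->
  (forall n i, nc (F n i) <= g i) -> sums_le g C ->
  (forall i e, 0 < e -> exists n0, forall n, (n0 <= n)%N -> nc (F n i - f i) < e) ->
  forall e, 0 < e -> exists n0, forall n, (n0 <= n)%N -> nc (T n - S) < e.
Proof.
move=> hT hS hg hC hF e e0.
have g0 i : 0 <= g i by apply: le_trans (hg 0%N i); exact: nc_ge0.
have fg i : nc (f i) <= g i.
  apply/ler_addgt0Pr => d /(hF i)[n hn].
  have -> : f i = F n i - (F n i - f i) by rewrite opprB addrC subrK.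
  by apply: le_trans (ncB _ _) (lerD (hg _ _) (ltW (hn _ _))).
have e5 : 0 < e / 5 by rewrite divr_gt0.
have [A hA] := sums_le_tail g0 hC e5.
have tail f' S' : has_sum f' S' -> (forall i, nc (f' i) <= g i) ->
    nc (S' - \sum_(i <- A) f' i) <= e / 5 + e / 5.
  move=> h' fg'; have [B hB] := h' _ e5.
  have := hB _ (fsubsetUr A B); rewrite (big_fset_split _ (fsubsetUl A B)).
  set a := \sum_(i <- A) _; set b := \sum_(i <- _) _ => hab.
  have -> : S' - a = b - (a + b - S') by ring.
  apply: le_trans (ncB _ _) (lerD _ (ltW hab)).
  apply: le_trans (nc_sum _ _ _) _; apply: le_trans (ler_sum _ (fun i _ => fg' i)) _.
  by apply/ltW/hA; rewrite fdisjoint_sym; case/fsubsetDP: (fsubset_refl ((A `|` B) `\` A)).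
have [n0 hn0] : exists n0, forall n, (n0 <= n)%N ->
    nc (\sum_(i <- A) F n i - \sum_(i <- A) f i) < e / 5.
  have : forall r : seq I, forall d, 0 < d -> exists n0, forall n, (n0 <= n)%N ->
      nc (\sum_(i <- r) F n i - \sum_(i <- r) f i) < d.
    elim=> [|i r IH] d d0; first by exists 0%N => n _; rewrite !big_nil subrr nc0.
    have [n1 h1] := hF i _ (divr_gt0 d0 (ltr0n _ 2)).
    have [n2 h2] := IH _ (divr_gt0 d0 (ltr0n _ 2)).
    exists (maxn n1 n2) => n; rewrite geq_max => /andP[/h1 k1 /h2 k2].
    rewrite !big_cons opprD addrACA.
    by apply: le_lt_trans (ncD _ _) _; lra.
  by move=> /(_ A _ e5).
exists n0 => n /hn0 hn.
have := tail _ _ (hT n) (hg n); have := tail _ _ hS fg.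
move: hn; set a := \sum_(i <- A) _; set b := \sum_(i <- A) _ => h1 h2 h3.
have -> : T n - S = (T n - a) + (a - b) - (S - b) by ring.
apply: le_lt_trans (ncB _ _) _; have := ncD (T n - a) (a - b); lra.
Qed.

End OneIndex.

(** Serves both to permute indices and to drop those with a zero term. *)
Lemma has_sum_inj (I J : choiceType) (h : I -> J) (f : J -> R[i]) S :
  injective h -> (forall j, (forall i, h i != j) -> f j = 0) ->
  has_sum f S -> has_sum (f \o h) S.
Proof.
move=> hI f0 hS e /hS[A hA].
have preimage : forall r : seq J, exists B : {fset I}, forall i, h i \in r -> i \in B.
  elim=> [|j r [B hB]]; first by exists fset0.
  have [[i ij]|nij] := pselect (exists i, h i = j).
    exists (i |` B) => i'; rewrite !inE -ij => /orP[/eqP/hI->|/hB->//].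
      by rewrite eqxx.
    by rewrite orbT.
  exists B => i; rewrite inE => /orP[/eqP ij|/hB//].
  by case: nij; exists i.
have [B0 hB0] := preimage A.
exists B0 => B BB; pose X := [fset h i | i in B].
have -> : \sum_(i <- B) (f \o h) i = \sum_(j <- X) f j.
  by rewrite big_imfset //= => x y _ _; exact: hI.
rewrite (big_fset_incl _ (fsubsetUr A X)); first by apply: hA; exact: fsubsetUl.
move=> j; rewrite in_fsetU => /orP[jA|->//] jX; apply: f0 => i.
apply: contra jX => /eqP ij; apply/imfsetP; exists i => //=.
by apply: (fsubsetP BB); apply: hB0; rewrite ij.
Qed.

(* Regrouping an unconditional sum needs no absolute convergence, because the
   existence of the total sum is assumed. *)
Lemma has_sum_fubini (I J : choiceType) (f : I * J -> R[i]) (F : I -> R[i]) S :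
  has_sum f S -> (forall i, has_sum (fun j => f (i, j)) (F i)) -> has_sum F S.
Proof.
move=> hS hF e e0; have e2 := divr_gt0 e0 (ltr0n _ 2).
have [A hA] := hS _ e2.
exists [fset p.1 | p in A] => B AB.
(* Each of the inner sums over the members of B may err by d, so together they err by at most
   e/2. *)
pose d : R := e / 2 / (#|` B|%:R + 1).
have d0 : 0 < d by rewrite divr_gt0 // ltr_wpDl.
have {hF} : forall i, exists C : {fset J}, (forall j, (i, j) \in A -> j \in C) /\
    nc (\sum_(j <- C) f (i, j) - F i) < d.
  move=> i; have [C hC] := hF i _ d0.
  exists (C `|` [fset p.2 | p in A]); split.
    by move=> j ij; rewrite inE; apply/orP; right; apply/imfsetP; exists (i, j).
  exact/hC/fsubsetUl.
move=> /choice[C /all_and2[CA CF]].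
pose X : {fset I * J} := [fset (((i : I), (j : J)) : (I * J)%type) | i in B, j in C i].
have AX : A `<=` X.
  apply/fsubsetP => -[i j] ij; apply/imfset2P; exists i; last first.
    by exists j => //; exact: CA.
  by apply: (fsubsetP AB); apply/imfsetP; exists (i, j).
have := hA _ AX; rewrite big_imfset2 /=; last by move=> [? ?] [? ?] _ _ [-> ->].
move=> hX.
set s := \sum_(i <- B) \sum_(j <- C i) f (i, j) in hX.
have hB : nc (\sum_(i <- B) F i - s) <= e / 2.
  rewrite -sumrB; apply: le_trans (nc_sum _ _ _) _.
  apply: le_trans (_ : \sum_(i <- B) d <= _).
    by apply: ler_sum => i _; rewrite nc_distC ltW.
  rewrite big_const_seq count_predT iter_addr_0 -[d *+ _]mulr_natl.
  rewrite /d mulrCA ger_pMr // ler_pdivrMr ?ltr_wpDl // mul1r.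
  by rewrite lerDl.
have -> : \sum_(i <- B) F i - S = (\sum_(i <- B) F i - s) + (s - S) by ring.
by apply: le_lt_trans (ncD _ _) _; lra.
Qed.

(** Tonelli for nonnegative families: a finite set of pairs is enlarged to full finite fibres over
    its first projection. *)
Lemma sums_le_sigma (I J : choiceType) (g : I * J -> R) (h : I -> R) C :
  (forall p, 0 <= g p) -> (forall i, sums_le (fun j => g (i, j)) (h i)) ->
  sums_le h C -> sums_le g C.
Proof.
move=> g0 hg hC A; rewrite (partition_big_imfset _ fst).
apply: le_trans (hC [fset p.1 | p in A]); apply: ler_sum => i _.
apply: le_trans (hg i [fset p.2 | p in A]).
rewrite [leRHS](_ : _ = \sum_(p <- [fset ((i, (j : J)) : (I * J)%type) | j in [fset p.2 | p in A]]) g p); last first.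
  by rewrite [RHS]big_imfset //= => x y _ _ [].
rewrite big_fset_condE (big_fset_split g (B := [fset ((i, (j : J)) : (I * J)%type) | j in [fset p.2 | p in A]]) (A := [fset p in A | p.1 == i])).
  by rewrite lerDl sumr_ge0.
apply/fsubsetP => -[i' j]; rewrite !inE /= => /andP[ij /eqP ii]; subst i'.
apply/imfsetP; exists j => //=; apply/imfsetP; by exists (i, j).
Qed.

Lemma sums_le_prod (I J : choiceType) (g : I -> R) (h : J -> R) C D :
  (forall i, 0 <= g i) -> (forall j, 0 <= h j) -> sums_le g C -> sums_le h D ->
  sums_le (fun p : I * J => g p.1 * h p.2) (C * D).
Proof.
move=> g0 h0 hC hD; apply: (@sums_le_sigma _ _ _ (fun i => g i * D)).
- by move=> p; rewrite mulr_ge0.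
- by move=> i; exact: (sums_leZ (g0 i) hD).
- move=> A; rewrite -mulr_suml ler_wpM2r ?hC //.
  by have := hD fset0; rewrite big_seq_fset0.
Qed.

Lemma fset_nat_bound (A : {fset nat}) : exists N, forall n, n \in A -> (n < N)%N.
Proof.
exists (\max_(n <- A) n)%N.+1 => n nA; rewrite ltnS.
exact: leq_bigmax_seq.
Qed.

Lemma sum_fset_iota (V : nmodType) (f : nat -> V) N :
  \sum_(i <- [fset i in iota 0 N]%fset) f i = \sum_(i < N) f i.
Proof.
by rewrite -(big_mkord predT f) /index_iota subn0 big_imfset //= undup_id ?iota_uniq.
Qed.

Lemma sums_le_nat (g : nat -> R) C : (forall n, 0 <= g n) ->
  (forall N, \sum_(n < N) g n <= C) -> sums_le g C.
Proof.
move=> g0 hC A; have [N hN] := fset_nat_bound A.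
apply: le_trans (hC N); rewrite -sum_fset_iota.
rewrite (@big_fset_split _ _ g A [fset i in iota 0 N]%fset) ?lerDl ?sumr_ge0 //.
by apply/fsubsetP => n /hN h; rewrite !inE mem_iota.
Qed.

Lemma has_sum_nat (f : nat -> R[i]) S : has_sum f S ->
  forall e, 0 < e -> exists N0, forall N, (N0 <= N)%N -> nc (\sum_(n < N) f n - S) < e.
Proof.
move=> h e /h[A hA]; have [N hN] := fset_nat_bound A.
exists N => M NM; rewrite -sum_fset_iota; apply: hA.
by apply/fsubsetP => n /hN h1; rewrite !inE mem_iota /= (leq_trans h1).
Qed.

End Summation.

(** * The Lipschitz formula *)

Section NegativeBinomial.
Variable R : realType.

(* Coefficients of (1 - u)^(-s), including the case s = 0. *)
Definition negbin (s n : nat) : nat := 'C((n + s).-1, n).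

Lemma negbinS s n : negbin s.+1 n.+1 = (negbin s n.+1 + negbin s.+1 n)%N.
Proof. by rewrite /negbin !addnS !addSn /= binS. Qed.

(** Truncated form of (1 - u) f_(s+1) = f_s for the generating functions f_s = (1 - u)^-s; it is
    Pascal's rule. *)
Lemma negbin_sumS (A : comNzRingType) (u : A) s N :
  \sum_(n < N.+1) (negbin s.+1 n)%:R * u ^+ n =
  \sum_(n < N.+1) (negbin s n)%:R * u ^+ n +
  u * \sum_(n < N) (negbin s.+1 n)%:R * u ^+ n.
Proof.
rewrite !big_ord_recl /= mulr_sumr -addrA -big_split /=; congr (_ + _).
  by rewrite /negbin !bin0.
by apply: eq_bigr => i _; rewrite /bump /= add1n negbinS natrD exprS; ring.
Qed.

Lemma negbin0 n : negbin 0 n = (n == 0)%N.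
Proof. by case: n => // n; rewrite /negbin addn0 /= bin_small. Qed.

Lemma negbin_sums_le (r : R) s : 0 <= r < 1 ->
  sums_le (fun n => (negbin s n)%:R * r ^+ n) ((1 - r) ^- s).
Proof.
move=> /andP[r0 r1].
apply: sums_le_nat => [n|]; first by rewrite mulr_ge0 ?exprn_ge0.
elim: s => [|s IH] N.
  case: N => [|N]; first by rewrite big_ord0 invr_ge0 exprn_ge0 // subr_ge0 ltW.
  rewrite big_ord_recl big1 /= => [|i _]; last by rewrite negbin0 mul0r.
  by rewrite negbin0 !expr0 invr1 mulr1 addr0.
case: N => [|N].
  by rewrite big_ord0 invr_ge0 exprn_ge0 // subr_ge0 ltW.
have h := IH N.+1; have e := negbin_sumS r s N.
have : \sum_(n < N) (negbin s.+1 n)%:R * r ^+ n <=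
       \sum_(n < N.+1) (negbin s.+1 n)%:R * r ^+ n.
  by rewrite big_ord_recr /= lerDl mulr_ge0 ?exprn_ge0.
move: h e; set x := \sum_(n < N.+1) _; set y := \sum_(n < N.+1) _.
set w := \sum_(n < N) _ => h e le.
rewrite exprSr invfM ler_pdivlMr ?subr_gt0 //.
have := ler_wpM2l r0 le; lra.
Qed.

(** Absolute convergence provides some sum S for exponent s + 1; in the limit the recurrence of the
    partial sums forces (1 - u) S = (1 - u)^-s, and induction on s identifies S. *)
Lemma negbin_has_sum (u : R[i]) s : nc u < 1 ->
  has_sum (fun n => (negbin s n)%:R * u ^+ n) ((1 - u) ^- s).
Proof.
move=> u1; have u01 : 0 <= nc u < 1 by rewrite nc_ge0.
have ex t : exists S, has_sum (fun n => (negbin t n)%:R * u ^+ n) S.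
  apply: has_sum_exists; apply: sums_le_mono (negbin_sums_le t u01) => n.
  by rewrite ncM ncX nc_nat.
have u1n : 1 - u != 0.
  by apply: contraTneq u1; rewrite -leNgt => /eqP; rewrite subr_eq0 => /eqP <-; rewrite nc1.
elim: s => [|s IH].
  have := @has_sum_finite _ _ (fun n => (negbin 0 n)%:R * u ^+ n) [fset 0%N]%fset.
  rewrite big_seq_fset1 negbin0 !expr0 invr1 mulr1; apply => i.
  by rewrite inE negbin0 => /negPf ->; rewrite mul0r.
have [S hS] := ex s.+1.
suff -> : (1 - u) ^- s.+1 = S by [].
suff e : S - u * S = (1 - u) ^- s.
  apply: (mulfI u1n); rewrite exprS invfM mulrA mulfV // mul1r -e; ring.
apply/eqP; rewrite -subr_eq0; apply/eqP/nc_small => e e0.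
have e3 : 0 < e / 3 by lra.
have [N1 h1] := has_sum_nat hS e3; have [N2 h2] := has_sum_nat IH e3.
pose N := maxn N1 N2; have := h1 N (leq_maxl _ _).
have := h1 N.+1 (leqW (leq_maxl _ _)); have := h2 N.+1 (leqW (leq_maxr _ _)).
rewrite (negbin_sumS u s N).
set a := \sum_(n < N.+1) _; set b := \sum_(n < N) _ => k1 k2 k3.
have -> : S - u * S - (1 - u) ^- s =
  (a - (1 - u) ^- s) - (a + u * b - S) + u * (b - S) by ring.
apply: le_trans (ncD _ _) _; have := ncB (a - (1 - u) ^- s) (a + u * b - S).
have : nc (u * (b - S)) <= nc (b - S) by rewrite ncM ler_piMl ?nc_ge0 // ltW.
lra.
Qed.

(** Exhibits C(n + t, t) as a polynomial of degree t in n, the form needed for the limit and for a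
    bound when n is replaced by a multiple of it. *)
Lemma negbin_fact n t : ((negbin t.+1 n) * t`! = \prod_(i < t) (n + i.+1))%N.
Proof.
rewrite /negbin addnS /=; apply/eqP; rewrite -(eqn_pmul2l (fact_gt0 n)).
have := bin_fact (leq_addr t n); rewrite addKn mulnCA => ->.
apply/eqP; elim: t => [|t IH]; first by rewrite addn0 big_ord0 muln1.
by rewrite big_ord_recr /= mulnA -IH addnS factS mulnC.
Qed.

End NegativeBinomial.

(** * The function e(z) = exp(2 pi i z) *)

Section ComplexExponential.
Variable R : realType.
Implicit Types z w : R[i].

Lemma nc_cexp z : nc (cexp z) = expR (complex.Re z).
Proof.
rewrite /cexp ncM nc_real ger0_norm ?expR_ge0 //.
by rewrite (nc_sqrt (_ +i* _)) /= cos2Dsin2 sqrtr1 mulr1.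
Qed.

Lemma cexpD z w : cexp (z + w) = cexp z * cexp w.
Proof.
case: z w => a b [c d]; rewrite /cexp /= expRD cosD sinD rmorphM /=.
rewrite mulrACA; congr (_ * _).
by apply/eqP; rewrite eq_complex /=; apply/andP; split; apply/eqP; ring.
Qed.

Lemma cexp0 : cexp (0 : R[i]) = 1.
Proof. by rewrite /cexp /= expR0 cos0 sin0 mul1r. Qed.

Lemma qparD z w : qpar (z + w) = qpar z * qpar w.
Proof. by rewrite /qpar mulrDr cexpD. Qed.

Lemma qpar0 : qpar (0 : R[i]) = 1.
Proof. by rewrite /qpar mulr0 cexp0. Qed.

Lemma qpar_neq0 z : qpar z != 0.
Proof.
apply/negP => /eqP h; have : qpar (z - z) = 1 by rewrite subrr qpar0.
by rewrite qparD h mul0r => /eqP; rewrite eq_sym oner_eq0.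
Qed.

Lemma qparN z : qpar (- z) = (qpar z)^-1.
Proof.
by apply: (mulfI (qpar_neq0 z)); rewrite -qparD subrr qpar0 mulfV // qpar_neq0.
Qed.

Lemma qparX z n : qpar (z * n%:R) = qpar z ^+ n.
Proof.
elim: n => [|n IH]; first by rewrite mulr0 qpar0.
by rewrite -addn1 natrD mulrDr mulr1 qparD IH exprD.
Qed.

Lemma qpar1 : qpar (1 : R[i]) = 1.
Proof.
rewrite /qpar /cexp /= !(mulr0, mul0r, mulr1, addr0, subr0, oppr0, add0r) expR0.
by rewrite mul1r mulr_natl cos2pi sin2pi.
Qed.

Lemma qpar_int (m : int) : qpar (m%:~R : R[i]) = 1.
Proof.
have nat (n : nat) : qpar (n%:R : R[i]) = 1.
  by rewrite -[n%:R]mul1r qparX qpar1 expr1n.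
by case: m => n; rewrite ?NegzE ?rmorphN ?qparN /= -?pmulrn nat // invr1.
Qed.

Lemma nc_qpar z : nc (qpar z) = expR (- (2 * pi * complex.Im z)).
Proof. by rewrite /qpar nc_cexp /=; congr expR; case: z => a b /=; ring. Qed.

Lemma qpar_real (t : R) : qpar t%:C = cos (2 * pi * t) +i* sin (2 * pi * t).
Proof.
rewrite /qpar /cexp /= !(mulr0, mul0r, mulr1, addr0, subr0, oppr0, add0r) expR0.
by rewrite mul1r.
Qed.

Lemma qpar_neq1 (t : R) : 0 < t < 1 -> qpar t%:C != 1.
Proof.
move=> /andP[t0 t1]; rewrite qpar_real eq_complex /= negb_and; apply/orP; left.
have s0 : 0 < sin (pi * t).
  by apply: sin_gt0_pi; rewrite mulr_gt0 ?pi_gt0 //= gtr_pMr // pi_gt0.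
have -> : 2 * pi * t = (pi * t) *+ 2 by rewrite -mulr_natl; ring.
rewrite cos_mulr2n; have := cos2Dsin2 (pi * t).
have : 0 < sin (pi * t) ^+ 2 by rewrite exprn_gt0.
by move=> h1 h2; apply/eqP; lra.
Qed.

End ComplexExponential.

(** * Explicit bounds for sine, cosine and pi *)

Section RealTrigonometry.
Variable R : realType.

Lemma ge0_of_derive (f df : R -> R) : (forall x : R, is_derive x 1 f (df x)) ->
  f 0 = 0 -> (forall x, 0 <= x -> 0 <= df x) -> forall x, 0 <= x -> 0 <= f x.
Proof.
move=> hf f0 hdf x; rewrite le_eqVlt => /orP[/eqP<-|x0]; first by rewrite f0.
have [|c] := MVT x0 (fun y _ => hf y).
  by apply: derivable_within_continuous => y _; case: (hf y).
rewrite in_itv /= f0 !subr0 => /andP[c0 _] ->.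
by apply: mulr_ge0; [apply: hdf|]; exact: ltW.
Qed.

Lemma sin_le (x : R) : 0 <= x -> sin x <= x.
Proof.
move=> x0; rewrite -subr_ge0.
apply: (ge0_of_derive (f := fun x => x - sin x) (df := fun x => 1 - cos x)) => //.
by rewrite sin0 subr0.
Qed.

Lemma cos_ge (x : R) : 0 <= x -> 1 - x ^+ 2 / 2 <= cos x.
Proof.
move=> x0; rewrite -subr_ge0.
apply: (ge0_of_derive (f := fun x => cos x - (1 - x ^+ 2 / 2)) (df := fun x => x - sin x)) => //.
- move=> y; apply: is_derive_eq.
  by rewrite /GRing.scale /=; field.
- by rewrite cos0 expr0n /= mul0r subr0 subrr.
- by move=> y y0; rewrite subr_ge0 sin_le.
Qed.

Lemma sin_ge (x : R) : 0 <= x -> x - x ^+ 3 / 6 <= sin x.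
Proof.
move=> x0; rewrite -subr_ge0.
apply: (ge0_of_derive (f := fun x => sin x - (x - x ^+ 3 / 6)) (df := fun x => cos x - (1 - x ^+ 2 / 2))) => //.
- move=> y; apply: is_derive_eq.
  by rewrite /GRing.scale /=; field.
- by rewrite sin0 expr0n /= mul0r subr0 subrr.
- by move=> y y0; rewrite subr_ge0 cos_ge.
Qed.

(** If pi were below 3, then 3/2 would lie beyond pi/2 and cos(3/2) <= 0; but the duplication
    formula and [cos_ge] at 3/4 give cos(3/2) >= 2 (23/32)^2 - 1 > 0. *)
Lemma pi_ge3 : 3 <= pi :> R.
Proof.
rewrite leNgt; apply/negP => pi3.
have h0 : 0 <= 3 / 4 :> R by lra.
have := cos_ge h0; set c := cos (3 / 4) => hc.
have : cos (3 / 2 : R) = 2 * c ^+ 2 - 1.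
  have -> : 3 / 2 = (3 / 4) *+ 2 :> R by rewrite -mulr_natl; field.
  by rewrite cos_mulr2n -/c -[_ *+ 2]mulr_natl.
have : cos (3 / 2 : R) <= 0.
  have -> : 3 / 2 = (3 / 2 - pi / 2) + pi / 2 :> R by ring.
  rewrite cosDpihalf oppr_le0; apply: sin_ge0_pi.
  by have := pi_ge2 R; move=> ?; apply/andP; split; lra.
move=> h1 h2; nra.
Qed.

(** 1 - cos x = 2 sin(x/2)^2, and sin y >= y - y^3/6 >= y/3 as long as y <= 2. The range up to 4
    covers all angles up to pi. *)
Lemma cos_le_sqr (x : R) : `|x| <= 4 -> cos x <= 1 - x ^+ 2 / 18.
Proof.
move=> x4; rewrite -cos_norm -(real_normK (num_real x)).
have x0 := normr_ge0 x; move: (`|x|) x4 x0 => {}x x4 x0.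
have -> : x = (x / 2) *+ 2 by rewrite -mulr_natl; field.
rewrite cos_mulr2n -mulr_natl; have := cos2Dsin2 (x / 2).
have y0 : 0 <= x / 2 by lra.
have := sin_ge y0; set y := x / 2 in y0 * => h.
have y2 : y <= 2 by rewrite /y; lra.
have : y / 3 <= sin y by apply: le_trans h; nra.
move=> h' e; have : (y / 3) ^+ 2 <= sin y ^+ 2 by rewrite ler_pXn2r ?nnegrE //; lra.
rewrite exprMn; move=> h2.
have -> : (y *+ 2) ^+ 2 = 4 * y ^+ 2 by rewrite -mulr_natl; ring.
lra.
Qed.

Lemma derive_seq (f : R -> R) df : is_derive (0 : R) 1 f df ->
  forall e : R, 0 < e -> exists n0, forall n, (n0 <= n)%N ->
    `|n.+1%:R * (f (n.+1%:R^-1) - f 0) - df| < e.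
Proof.
case=> hd <- e e0.
have /cvgrPdist_lt /(_ e e0) := (hd : cvg _).
case=> d /= d0 hdd.
have [n0 hn0] : exists n0 : nat, d^-1 < n0%:R.
  exists (Num.bound d^-1); have := archi_boundP (x := d^-1); apply.
  by rewrite invr_ge0 ltW.
exists n0 => n nn; have := hdd (n.+1%:R^-1).
rewrite /ball_ /= sub0r normrN distrC [_ *: 1]mulr1 addr0 invrK; apply.
  rewrite ger0_norm ?invr_ge0 //= -[ltRHS]invrK ltf_pV2 ?posrE ?invr_gt0 //.
  by rewrite (lt_le_trans hn0) // ler_nat ltnW // ltnS.
by rewrite invr_eq0 pnatr_eq0.
Qed.

End RealTrigonometry.

(** * Limits of complex sequences *)

Section ComplexSequences.
Variable R : realType.
Implicit Types (u v : nat -> R[i]) (l m : R[i]).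

Definition ctends u l : Prop :=
  forall e : R, 0 < e -> exists n0, forall n, (n0 <= n)%N -> nc (u n - l) < e.

Lemma ctends_unique u l m : ctends u l -> ctends u m -> l = m.
Proof.
move=> h h'; apply/eqP; rewrite -subr_eq0; apply/eqP/nc_small => e e0.
have [n1 h1] := h _ (divr_gt0 e0 (ltr0n _ 2)).
have [n2 h2] := h' _ (divr_gt0 e0 (ltr0n _ 2)).
have := h1 _ (leq_maxl n1 n2); have := h2 _ (leq_maxr n1 n2).
set w := u _ => k1 k2.
have -> : l - m = (w - m) - (w - l) by ring.
apply: le_trans (ncB _ _) _; lra.
Qed.

Lemma ctends_ext u v l : u =1 v -> ctends u l -> ctends v l.
Proof. by move=> e h d /h[n0 hn]; exists n0 => n /hn; rewrite e. Qed.

Lemma ctends_cst l : ctends (fun=> l) l.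
Proof. by move=> e e0; exists 0%N => n _; rewrite subrr nc0. Qed.

Lemma ctendsD u v l m : ctends u l -> ctends v m ->
  ctends (fun n => u n + v n) (l + m).
Proof.
move=> h h' e e0.
have [n1 h1] := h _ (divr_gt0 e0 (ltr0n _ 2)).
have [n2 h2] := h' _ (divr_gt0 e0 (ltr0n _ 2)).
exists (maxn n1 n2) => n; rewrite geq_max => /andP[/h1 k1 /h2 k2].
rewrite opprD addrACA; apply: le_lt_trans (ncD _ _) _; lra.
Qed.

Lemma ctendsM u v l m : ctends u l -> ctends v m ->
  ctends (fun n => u n * v n) (l * m).
Proof.
move=> h h' e e0.
have l0 := nc_ge0 l; have m0 := nc_ge0 m.
pose d := Num.min 1 (e / (nc l + nc m + 1)).
have d0 : 0 < d by rewrite lt_min ltr01 divr_gt0 //; lra.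
have d1 : d <= 1 by rewrite ge_min lexx.
have de : d * (nc l + nc m + 1) <= e.
  by rewrite -ler_pdivlMr; [rewrite ge_min lexx orbT|lra].
have [n1 h1] := h _ d0; have [n2 h2] := h' _ d0.
exists (maxn n1 n2) => n; rewrite geq_max => /andP[/h1 k1 /h2 k2].
have -> : u n * v n - l * m = (u n - l) * (v n - m) + ((u n - l) * m + l * (v n - m)) by ring.
apply: le_lt_trans (ncD _ _) _.
have := ncD ((u n - l) * m) (l * (v n - m)); rewrite !ncM.
have := nc_ge0 (u n - l); have := nc_ge0 (v n - m); nra.
Qed.

Lemma ctendsX u l k : ctends u l -> ctends (fun n => u n ^+ k) (l ^+ k).
Proof.
move=> h; elim: k => [|k IH]; first exact: ctends_cst.
by rewrite exprS; apply: ctends_ext (ctendsM h IH) => n; rewrite exprS.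
Qed.

Lemma ctendsV u l : l != 0 -> ctends u l -> ctends (fun n => (u n)^-1) l^-1.
Proof.
move=> l0 h e e0; have nl : 0 < nc l by rewrite lt_def nc_eq0 l0 nc_ge0.
pose d := Num.min (nc l / 2) (e * nc l ^+ 2 / 2).
have d0 : 0 < d by rewrite lt_min !divr_gt0 // mulr_gt0 // exprn_gt0.
have [n1 h1] := h _ d0; exists n1 => n /h1.
rewrite lt_min => /andP[k1 k2].
have un : nc l / 2 < nc (u n).
  have : nc l <= nc (u n) + nc (u n - l).
    have -> : l = u n - (u n - l) by ring.
    by apply: le_trans (ncB _ _) _; rewrite opprB addrCA subrr addr0.
  lra.
have un0 : u n != 0 by rewrite -nc_eq0; apply: lt0r_neq0; lra.
have -> : (u n)^-1 - l^-1 = (u n - l) * (- ((u n)^-1 * l^-1)).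
  by field; rewrite l0 un0.
rewrite ncM ncN ncM !ncV -invfM.
rewrite ltr_pdivrMr; last by rewrite mulr_gt0 //; lra.
apply: lt_le_trans k2 _.
have -> : e * nc l ^+ 2 / 2 = e * (nc l / 2 * nc l) by ring.
by rewrite ler_pM2l // ler_pM2r // ltW.
Qed.

Lemma ctends_sub u l (h : nat -> nat) : (forall n, (n <= h n)%N) ->
  ctends u l -> ctends (fun n => u (h n)) l.
Proof.
move=> hn hu e /hu[n0 k]; exists n0 => n nn; apply: k.
exact: leq_trans nn (hn n).
Qed.

Lemma ctends_prod (k : nat) (f : nat -> nat -> R[i]) (g : nat -> R[i]) :
  (forall i, ctends (f i) (g i)) ->
  ctends (fun n => \prod_(i < k) f i n) (\prod_(i < k) g i).
Proof.
move=> h; elim: k => [|k IH].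
  by rewrite big_ord0; apply: ctends_ext (ctends_cst 1) => n; rewrite big_ord0.
rewrite big_ord_recr; apply: ctends_ext (ctendsM IH (h k)) => n.
by rewrite big_ord_recr.
Qed.

Lemma ctends_harmonic : ctends (fun n => n.+1%:R^-1) 0.
Proof.
move=> e e0; exists (Num.bound e^-1) => n nn; rewrite subr0 ncV nc_nat.
rewrite -[ltRHS]invrK ltf_pV2 ?posrE ?invr_gt0 //.
have : e^-1 < (Num.bound e^-1)%:R by apply: archi_boundP; rewrite invr_ge0 ltW.
by move/lt_le_trans; apply; rewrite ler_nat leqW.
Qed.

(** The derivative of the exponential at 0 in the direction c, taken for the real and imaginary
    parts separately. *)
Lemma ctends_cexp (c : R[i]) :
  ctends (fun n => n.+1%:R * (1 - cexp (c / n.+1%:R))) (- c).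
Proof.
case: c => a b e e0; have e2 := divr_gt0 e0 (ltr0n _ 2).
have df : is_derive (0 : R) 1 (fun t => expR (a * t) * cos (b * t)) a.
  apply: is_derive_eq; rewrite /GRing.scale /= !mulr0 expR0 cos0 sin0; ring.
have dg : is_derive (0 : R) 1 (fun t => expR (a * t) * sin (b * t)) b.
  apply: is_derive_eq; rewrite /GRing.scale /= !mulr0 expR0 cos0 sin0; ring.
have [n1 h1] := derive_seq df e2; have [n2 h2] := derive_seq dg e2.
exists (maxn n1 n2) => n; rewrite geq_max => /andP[/h1 k1 /h2 k2].
have -> : (a +i* b) / n.+1%:R = (a / n.+1%:R) +i* (b / n.+1%:R).
  have -> : (n.+1%:R : R[i])^-1 = (n.+1%:R^-1)%:C by rewrite fmorphV rmorph_nat.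
  by apply/eqP; rewrite eq_complex /=; apply/andP; split; apply/eqP; ring.
have -> : (n.+1%:R : R[i]) = (n.+1%:R)%:C by rewrite rmorph_nat.
move: k1 k2; rewrite !mulr0 expR0 cos0 sin0 !mulr0 mulr1 subr0.
rewrite /cexp /=; set E := expR _; set C := cos _; set S := sin _ => k1 k2.
apply: le_lt_trans (nc_leReIm _) _; rewrite /=.
rewrite (_ : _ - - a = - (n.+1%:R * (E * C - 1) - a)); last by ring.
rewrite (_ : _ - - b = - (n.+1%:R * (E * S) - b)); last by ring.
rewrite !normrN; lra.
Qed.

End ComplexSequences.

(** * From roots of unity to the Lipschitz formula *)

Section Lipschitz.
Variable R : realType.

Lemma qpar_root_sum (M L n : nat) (z : R[i]) : (0 < M)%N ->
  \sum_(i < M) qpar ((z + i%:R - L%:R) / M%:R) ^+ n =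
  if (M %| n)%N then M%:R * qpar z ^+ (n %/ M) else 0.
Proof.
move=> M0; have Mn0 : M%:R != 0 :> R[i] by rewrite pnatr_eq0 -lt0n.
pose W := qpar ((z - L%:R) / M%:R) ^+ n; pose w := qpar (M%:R^-1 : R[i]) ^+ n.
have -> : \sum_(i < M) qpar ((z + i%:R - L%:R) / M%:R) ^+ n = W * \sum_(i < M) w ^+ i.
  rewrite mulr_sumr; apply: eq_bigr => i _; rewrite /W /w -!qparX -qparD.
  by congr qpar; field.
have wM : w ^+ M = 1 by rewrite /w -exprM mulnC exprM -qparX mulVf // qpar1 expr1n.
case: ifP => [/dvdnP[k nk]|nM].
  subst n.
  have -> : w = 1 by rewrite /w mulnC exprM -qparX mulVf // qpar1 expr1n.
  rewrite mulnK // (eq_bigr (fun=> 1)) => [|i _]; last by rewrite expr1n.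
  rewrite sumr_const card_ord mulrC; congr (_ * _).
  rewrite /W mulnC exprM -qparX divfK // qparD qparN -[L%:R]mul1r qparX qpar1.
  by rewrite expr1n invr1 mulr1.
have w1 : w != 1.
  rewrite /w -qparX; pose t : R := (n %% M)%:R / M%:R.
  have -> : (M%:R : R[i])^-1 * n%:R = (n %/ M)%:R + t%:C.
    rewrite /t rmorphM /= fmorphV !rmorph_nat {1}(divn_eq n M) natrD natrM.
    by field.
  rewrite qparD -[(n %/ M)%:R]mul1r qparX qpar1 expr1n mul1r.
  apply: qpar_neq1; rewrite divr_gt0 ?ltr0n //= ?ltr_pdivrMr ?ltr0n // ?mul1r ?ltr_nat ?ltn_pmod //.
  by rewrite lt0n; apply/negbT.
have : (w - 1) * \sum_(i < M) w ^+ i = 0 by rewrite -subrX1 wM subrr.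
by move/eqP; rewrite mulf_eq0 subr_eq0 (negPf w1) /= => /eqP->; rewrite mulr0.
Qed.

Lemma has_sum_sum (I : choiceType) (n : nat) (f : nat -> I -> R[i]) (S : nat -> R[i]) :
  (forall k, (k < n)%N -> has_sum (f k) (S k)) ->
  has_sum (fun i => \sum_(k < n) f k i) (\sum_(k < n) S k).
Proof.
elim: n => [|n IH] h.
  rewrite big_ord0; have := @has_sum_finite R I (fun=> 0) fset0.
  rewrite big_seq_fset0 => /(_ (fun _ _ => erefl)); apply: has_sum_ext => i.
  by rewrite big_ord0.
rewrite big_ord_recr /=.
apply: has_sum_ext (has_sumD (IH (fun k hk => h k (ltnW hk))) (h n (ltnSn n))) => i.
by rewrite big_ord_recr.
Qed.

(** With E = exp(-a), the squared modulus is (1 - E)^2 + 2 E (1 - cos b); here 1 - E >= a E and 1 -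
    cos b >= b^2/18. The bound is quadratic in (a, b), which makes the terms of the finite Lipschitz
    sums summable uniformly in their length. *)
Lemma nc_sqr_one_sub_cexp (a b : R) : 0 <= a -> `|b| <= 4 ->
  expR (- a) ^+ 2 * (a ^+ 2 + b ^+ 2 / 9) <= nc (1 - cexp ((- a) +i* b)) ^+ 2.
Proof.
move=> a0 b4; rewrite nc_sqr /cexp /=.
have := cos_le_sqr b4; have := cos2Dsin2 b.
set E := expR (- a); set C := cos b; set S := sin b => e h.
have E0 : 0 < E by exact: expR_gt0.
have E1 : E <= 1 by rewrite /E -expR0 ler_expR oppr_le0.
have aE : a * E <= 1 - E.
  have := expR_ge1Dx a; have : E * expR a = 1 by rewrite /E -expRD addNr expR0.
  nra.
have aE2 : (a * E) ^+ 2 <= (1 - E) ^+ 2.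
  by rewrite ler_pXn2r ?nnegrE ?mulr_ge0 ?subr_ge0 // ltW.
have -> : (1 - (E * C - 0 * S)) ^+ 2 + (0 - (E * S + 0 * C)) ^+ 2 = (1 - E) ^+ 2 + 2 * E * (1 - C) + E ^+ 2 * (C ^+ 2 + S ^+ 2 - 1) by ring.
rewrite e subrr mulr0 addr0.
have : b ^+ 2 / 9 <= 2 * (1 - C) by lra.
have : 0 <= b ^+ 2 / 9 by rewrite divr_ge0 ?sqr_ge0.
move: (b ^+ 2 / 9) => B B0 BC.
have : E ^+ 2 * B <= E * (2 * (1 - C)).
  by rewrite expr2 -mulrA ler_pM2l //; apply: le_trans BC; rewrite ler_piMl.
move: aE2; rewrite exprMn; lra.
Qed.

Lemma sums_le_inj (I J : choiceType) (h : I -> J) (g : J -> R) C :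
  injective h -> sums_le g C -> sums_le (g \o h) C.
Proof.
move=> hI hC A; apply: le_trans (hC [fset h i | i in A]%fset).
by rewrite big_imfset //= => x y _ _; exact: hI.
Qed.

Lemma sums_le_inv_sqr : sums_le (fun j : int => (1 + j%:~R ^+ 2 : R)^-1) 6.
Proof.
have h1 : sums_le (fun n : nat => (1 + n%:R ^+ 2 : R)^-1) 3.
  apply: sums_le_nat => [n|N]; first by rewrite invr_ge0 addr_ge0 ?sqr_ge0.
  (* Telescoping of 1 / (1 + n^2) <= 3 / ((n + 1)(n + 2)), which amounts to (n - 1)(2n - 1) >= 0;
     this fails between 1/2 and 1, hence the separate case n = 0. *)
  suff : \sum_(n < N) (1 + n%:R ^+ 2 : R)^-1 <= 3 - 3 / N.+1%:R.
    by move/le_trans; apply; rewrite lerBlDr lerDl divr_ge0.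
  elim: N => [|N IH]; first by rewrite big_ord0 divr1 subrr.
  rewrite big_ord_recr /=; apply: le_trans (lerD IH (_ : _ <= 3 / (N.+1%:R * N.+2%:R))) _.
    rewrite ler_pdivlMr ?mulr_gt0 ?ltr0n // mulrC ler_pdivrMr.
      case: N {IH} => [|m]; first by rewrite ?mulr1n ?mulr0n; lra.
      by rewrite -[m.+3]addn3 -[m.+2]addn2 -[m.+1]addn1 !natrD; have := ler0n R m; nra.
    by rewrite ltr_pwDl ?sqr_ge0.
  have := ler0n R N; rewrite -[N.+2]addn2 -[N.+1]addn1 !natrD.
  set x : R := N%:R => x0; rewrite le_eqVlt; apply/orP; left; apply/eqP.
  by field; rewrite !lt0r_neq0 //; lra.
have h2 : sums_le (fun b : bool => 1 : R) 2.
  move=> A; rewrite big_const_seq count_predT iter_addr_0 ler_nat.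
  apply: leq_trans (fsubset_leq_card (_ : A `<=` [fset true; false])%fset) _.
    by apply/fsubsetP => -[] _; rewrite !inE.
  by rewrite cardfs2.
(* An integer is embedded as its sign and absolute value, so the bound is 2 times 3. *)
have := @sums_le_inj _ _ (fun j : int => (j < 0, `|j|%N)) _ _ _
  (sums_le_prod (fun=> ler01) _ h2 h1).
rewrite -[2]/(2%:R) -natrM => h; apply: sums_le_mono (h _ _) => //.
- by move=> j /=; rewrite mul1r natr_absz intr_norm real_normK ?num_real.
- move=> i j [s e]; move: s e; case: i => m; case: j => n //=; lia.
Qed.

(** From j^2 <= 2 (x + j)^2 + 2 x^2; the constant depends on the shift x only through X, so one
    majorant in j serves all bounded shifts. *)
Lemma shifted_sqr_ge (X y x j : R) : 0 < y -> `|x| <= X ->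
  1 + j ^+ 2 <= (2 + (2 * X ^+ 2 + 1) / y ^+ 2) * (y ^+ 2 + (x + j) ^+ 2).
Proof.
move=> y0 xX; have y2 : 0 < y ^+ 2 by rewrite exprn_gt0.
have x2 : x ^+ 2 <= X ^+ 2.
  by rewrite -(real_normK (num_real x)) ler_pXn2r ?nnegrE ?(le_trans _ xX).
have : 2 * X ^+ 2 + 1 <= (2 * X ^+ 2 + 1) / y ^+ 2 * (y ^+ 2 + (x + j) ^+ 2).
  rewrite -mulrA ler_pMr; last by have := sqr_ge0 X; lra.
  by rewrite mulrC ler_pdivlMr // mul1r lerDl sqr_ge0.
have := sqr_ge0 (2 * x + j); rewrite !mulrDl.
set W := _ / _ * _; nra.
Qed.

(** Two of the factors v^-1 are kept for summability, the other t are bounded by a constant. *)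
Lemma inv_exp_le (v A d : R) (t : nat) : 0 < A -> 0 < d -> A <= v ^+ 2 -> d <= v ->
  v ^- t.+2 <= A^-1 * d ^- t.
Proof.
move=> A0 d0 Av dv; have v0 : 0 < v by apply: lt_le_trans dv.
have vn n : 0 <= v ^- n by rewrite invr_ge0 exprn_ge0 // ltW.
rewrite -[t.+2]addn2 exprD invfM mulrC ler_pM //.
  by rewrite lef_pV2 ?posrE ?exprn_gt0.
by rewrite lef_pV2 ?posrE ?exprn_gt0 //; apply: lerXn2r; rewrite ?nnegrE // ltW.
Qed.

Lemma sum_imfset_iota (J : choiceType) (V : nmodType) (h : nat -> J) (f : J -> V) N :
  injective h -> \sum_(j <- [fset h i | i in iota 0 N]%fset) f j = \sum_(i < N) f (h i).
Proof.
move=> hI; rewrite big_imfset /=; last by move=> x y _ _; exact: hI.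
by rewrite -(big_mkord predT (fun i => f (h i))) /index_iota subn0 undup_id ?iota_uniq.
Qed.

(* With M = 2L, the binomial series and orthogonality of the M-th roots of unity
   give, for s >= 2 and e(w) = exp(2 pi i w),
     sum_(-L <= j < L) (M (1 - e((z + j) / M)))^-s
       = M^(1 - s) sum_n C(M n + s - 1, s - 1) e(z)^n.
   As M tends to infinity both sides converge termwise, and boundedly. *)
Section ReducedRealPart.
Variables (z : R[i]) (t : nat).
Let x := complex.Re z.
Let y := complex.Im z.
Hypotheses (x0 : 0 <= x) (x1 : x < 1) (y0 : 0 < y).
Let M (l : nat) := l.+1.*2.
Let V l (j : int) := (M l)%:R * (1 - qpar ((z + j%:~R) / (M l)%:R)).

Let M0 l : (0 < M l)%N. Proof. by rewrite /M; lia. Qed.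
Let MC0 l : (M l)%:R != 0 :> R[i]. Proof. by rewrite pnatr_eq0 -lt0n. Qed.

Let V_tends j : ctends (fun l => V l j) (- ((2 * pi)%:C * 'i * (z + j%:~R))).
Proof.
have := @ctends_sub _ _ _ (fun l => l.*2.+1) _ (ctends_cexp ((2 * pi)%:C * 'i * (z + j%:~R))).
move=> h; apply: ctends_ext (h _) => [l|l]; last by lia.
by rewrite /V /M doubleS /qpar mulrA.
Qed.

Let K := 2 + (2 * 1 ^+ 2 + 1) / y ^+ 2 : R.
Let c := expR (- (2 * pi * y)) ^+ 2 / K : R.

Let K0 : 0 < K.
Proof. by rewrite ltr_pwDl // divr_ge0 // ?sqr_ge0 //; lra. Qed.

Let c0 : 0 < c.
Proof. by rewrite divr_gt0 // exprn_gt0 // expR_gt0. Qed.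

Let V_ge l (j : int) : - (l.+1%:Z) <= j -> j < l.+1%:Z ->
  c * (1 + j%:~R ^+ 2) <= nc (V l j) ^+ 2.
Proof.
move=> j1 j2; pose m : R := (M l)%:R.
have m0 : 0 < m by rewrite ltr0n.
have m1 : 1 <= m by rewrite /m ler1n.
pose a := 2 * pi * y / m; pose b := 2 * pi * (x + j%:~R) / m.
have pi0 := pi_gt0 R; have pi3 := pi_ge3 R.
have -> : nc (V l j) ^+ 2 = m ^+ 2 * nc (1 - cexp ((- a) +i* b)) ^+ 2.
  rewrite /V ncM nc_nat exprMn -/m; congr (_ * nc (_ - _) ^+ 2).
  rewrite /qpar; congr cexp.
  have -> : ((M l)%:R : R[i])^-1 = (m^-1)%:C by rewrite fmorphV rmorph_nat.
  have -> : (j%:~R : R[i]) = (j%:~R)%:C by rewrite rmorph_int.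
  rewrite /a /b /x /y; case: (z) => u v; apply/eqP.
  by rewrite eq_complex /=; apply/andP; split; apply/eqP; ring.
have a0 : 0 <= a by rewrite divr_ge0 ?mulr_ge0 // ltW.
(* The range of j gives |x + j| <= M/2, so |b| <= pi: the angle stays away from 2 pi, where 1 -
   exp(i b) vanishes again. *)
have hb : `|b| <= 4.
  have jl : `|x + j%:~R| <= m / 2.
    have jj : - (m / 2) <= j%:~R.
      rewrite /m /M -muln2 natrM mulfK // -[l.+1%:R]/((l.+1%:Z)%:~R) -rmorphN.
      by rewrite ler_int.
    have jj2 : j%:~R + 1 <= m / 2.
      rewrite /m /M -muln2 natrM mulfK // -[l.+1%:R]/((l.+1%:Z)%:~R) -[1]/(1%:~R) -rmorphD.
      by rewrite ler_int; lia.
    rewrite ler_norml (le_trans jj) ?lerDr //= (le_trans _ jj2) // addrC lerD2l.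
    exact: ltW.
  have pi20 : 0 <= 2 * pi :> R by lra.
  rewrite /b normrM normfV normrM (ger0_norm (ltW m0)) (ger0_norm pi20).
  rewrite ler_pdivrMr //; have := pihalf_lt2 R => pi4.
  apply: le_trans (_ : 8 * (m / 2) <= _); last by lra.
  by apply: ler_pM => //; lra.
have := nc_sqr_one_sub_cexp a0 hb.
have m20 : 0 < m ^+ 2 by rewrite exprn_gt0.
move/(ler_wpM2l (ltW m20)); apply: le_trans.
have -> : m ^+ 2 * (expR (- a) ^+ 2 * (a ^+ 2 + b ^+ 2 / 9)) =
   expR (- a) ^+ 2 * ((2 * pi) ^+ 2 * (y ^+ 2 + (x + j%:~R) ^+ 2 / 9)).
  by rewrite /a /b; field; exact: lt0r_neq0.
rewrite /c -mulrA; apply: ler_pM; rewrite ?exprn_ge0 ?expR_ge0 //.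
- by rewrite mulr_ge0 ?invr_ge0 ?ltW // ltr_pwDl // sqr_ge0.
- rewrite ler_pXn2r ?nnegrE ?expR_ge0 // ler_expR lerN2 /a ler_pdivrMr //.
  by rewrite ler_peMr // !mulr_ge0 // ltW.
rewrite mulrC ler_pdivrMr //.
have x1' : `|x| <= 1 by rewrite ger0_norm // ltW.
apply: le_trans (shifted_sqr_ge j%:~R y0 x1') _; rewrite -/K mulrC ler_wpM2r ?(ltW K0) //.
have : 36 <= (2 * pi) ^+ 2 :> R by nra.
have := sqr_ge0 y; have := sqr_ge0 (x + j%:~R); nra.
Qed.

Let d := Num.sqrt c : R.
Let g (j : int) := c^-1 * d ^- t * (1 + j%:~R ^+ 2)^-1 : R.
Let T l := \sum_(i < M l) (V l (i%:Z - l.+1%:Z)) ^- t.+2.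
(** Extension by zero turns the finite sums [T l] into sums over one fixed index type, as [tannery]
    requires. *)
Let F l (j : int) := if (- (l.+1%:Z) <= j) && (j < l.+1%:Z) then (V l j) ^- t.+2 else 0.

Let d0 : 0 < d. Proof. by rewrite sqrtr_gt0. Qed.

Let F_le l j : nc (F l j) <= g j.
Proof.
have p1 : 0 < 1 + j%:~R ^+ 2 :> R by rewrite ltr_pwDl // sqr_ge0.
rewrite /F; case: ifP => [/andP[j1 j2]|_]; last first.
  by rewrite nc0 !mulr_ge0 ?invr_ge0 ?exprn_ge0 ?(ltW c0) ?(ltW d0) ?(ltW p1).
have h := V_ge j1 j2.
rewrite ncV ncX /g mulrAC -invfM; apply: inv_exp_le => //; first exact: mulr_gt0.
rewrite -(@ler_pXn2r _ 2) ?nnegrE ?nc_ge0 ?(ltW d0) // sqr_sqrtr ?(ltW c0) //.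
apply: le_trans h; rewrite ler_peMr ?(ltW c0) // ?lerDl ?sqr_ge0 //.

Qed.

Let g_sums : sums_le g (c^-1 * d ^- t * 6).
Proof.
by apply: sums_leZ sums_le_inv_sqr; rewrite mulr_ge0 ?invr_ge0 ?exprn_ge0 ?(ltW c0) ?(ltW d0).
Qed.

Let F_sum l : has_sum (F l) (T l).
Proof.
pose A := [fset (i%:Z - l.+1%:Z)%R | i in iota 0 (M l)]%fset.
have -> : T l = \sum_(j <- A) F l j.
  rewrite sum_imfset_iota; last by move=> i j; lia.
  apply: eq_bigr => -[i iM] _ /=; rewrite /F ifT //.
  by move: iM; rewrite /M -muln2 => iM; apply/andP; split; lia.
apply: has_sum_finite => j jA; rewrite /F; case: ifP => // /andP[j1 j2].
case/negP: jA; apply/imfsetP; exists (absz (j + l.+1%:Z)); last by lia.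
by change (absz (j + l.+1%:Z) \in iota 0 (M l)); rewrite mem_iota /M; lia.
Qed.

Let q := qpar z.
Let G l n := (M l)%:R ^- t.+1 * (negbin t.+2 (M l * n))%:R * q ^+ n.

Let q1 : 0 <= nc q < 1.
Proof.
rewrite nc_ge0 /q nc_qpar /= -expR0 ltr_expR oppr_lt0 mulr_gt0 //.
by rewrite mulr_gt0 // pi_gt0.
Qed.

Let G_sum l : has_sum (G l) (T l).
Proof.
have h (i : nat) : (i < M l)%N -> has_sum (fun n => (negbin t.+2 n)%:R *
    qpar ((z + i%:R - l.+1%:R) / (M l)%:R) ^+ n)
    ((1 - qpar ((z + (i%:Z - l.+1%:Z)%:~R) / (M l)%:R)) ^- t.+2).
  move=> _; have -> : z + (i%:Z - l.+1%:Z)%:~R = z + i%:R - l.+1%:R.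
    by rewrite rmorphB /= addrA.
  apply: negbin_has_sum; rewrite nc_qpar -expR0 ltr_expR oppr_lt0 mulr_gt0 //.
    by rewrite mulr_gt0 // pi_gt0.
  have -> : ((M l)%:R : R[i])^-1 = ((M l)%:R^-1)%:C by rewrite fmorphV rmorph_nat.
  have -> : (l.+1%:R : R[i]) = (l.+1%:R)%:C by rewrite rmorph_nat.
  have -> : (i%:R : R[i]) = (i%:R)%:C by rewrite rmorph_nat.
  have : 0 < y / (M l)%:R by rewrite divr_gt0 // ltr0n.
  by rewrite /y; case: (z) => u v /=; rewrite mulr0 add0r addr0 subr0.
have := has_sumZ ((M l)%:R ^- t.+2) (has_sum_sum h).
rewrite (_ : _ * _ = T l); last first.
  by rewrite mulr_sumr; apply: eq_bigr => k _; rewrite /V [in RHS]exprMn [in RHS]invfM.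
have inj : injective (muln (M l)) by move=> u v /eqP; rewrite eqn_pmul2l // => /eqP.
move/(has_sum_inj inj) => hs; apply: has_sum_ext (hs _) => [n|n nM] /=.
  rewrite -mulr_sumr qpar_root_sum // dvdn_mulr // mulKn // /G.
  have <- : (M l)%:R ^- t.+2 * (M l)%:R = (M l)%:R ^- t.+1 :> R[i].
    by rewrite [X in X^-1 * _]exprSr invfM divfK.
  by rewrite -!mulrA; congr (_ * _); rewrite mulrCA.
rewrite -mulr_sumr qpar_root_sum // ifF ?mulr0 //.
by apply/negP => /dvdnP[k nk]; have := nM k; rewrite nk mulnC eqxx.
Qed.

Let G_coef l n : (M l)%:R ^- t.+1 * (negbin t.+2 (M l * n))%:R * t.+1`!%:R =
  \prod_(i < t.+1) (n%:R + i.+1%:R / (M l)%:R) :> R[i].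
Proof.
rewrite -mulrA -natrM negbin_fact natr_prod -[t.+1 in X in X * _]card_ord -prodr_const.
rewrite -prodfV -big_split /=; apply: eq_bigr => i _.
by rewrite natrD natrM mulrDr mulrA mulVf // mul1r mulrC.
Qed.

Let fact0 : t.+1`!%:R != 0 :> R[i].
Proof. by rewrite pnatr_eq0 -lt0n fact_gt0. Qed.

Let G_tends n : ctends (fun l => G l n) (n%:R ^+ t.+1 / t.+1`!%:R * q ^+ n).
Proof.
have h : @ctends R (fun l => \prod_(i < t.+1) (n%:R + i.+1%:R / (M l)%:R)) (\prod_(i < t.+1) n%:R).
  have hp := @ctends_prod R t.+1 (fun i l => n%:R + i.+1%:R / (M l)%:R) (fun=> n%:R).

  apply: hp => i; rewrite -[n%:R in X in ctends _ X]addr0.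
  apply: ctendsD; first exact: ctends_cst.
  rewrite -(mulr0 i.+1%:R); apply: ctendsM; first exact: ctends_cst.
  apply: (@ctends_sub _ (fun n => n.+1%:R^-1) 0 (fun l => l.*2.+1)); first by lia.
  exact: ctends_harmonic.
move: h; rewrite prodr_const card_ord => h.
apply: ctends_ext (ctendsM (ctendsM h (ctends_cst _)) (ctends_cst _)) => l /=.
by rewrite -G_coef mulfK.
Qed.

(** Factor by factor, M n + i <= M (n + i); this removes M and leaves a negative binomial series as
    majorant. *)
Let G_le l n : nc (G l n) <= (negbin t.+2 n)%:R * nc q ^+ n.
Proof.
rewrite /G ncM [nc (q ^+ n)]ncX ler_wpM2r ?exprn_ge0 ?nc_ge0 //.
rewrite ncM ncV ncX !nc_nat.
rewrite mulrC ler_pdivrMr ?exprn_gt0 ?ltr0n // -natrX -natrM ler_nat.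
rewrite -(leq_pmul2r (fact_gt0 t.+1)) mulnAC !negbin_fact -[X in (_ <= _ * X)%N]/(M l ^ t.+1)%N.
rewrite -[t.+1 in X in (_ <= _ * X)%N]card_ord -prod_nat_const -big_split /=.
apply: leq_prod => i _; rewrite mulnDl mulnC leq_add2l.
by rewrite leq_pmulr.
Qed.

Lemma lipschitz_reduced : exists S,
  has_sum (fun j : int => (- ((2 * pi)%:C * 'i * (z + j%:~R))) ^- t.+2) S /\ has_sum (fun n : nat => n%:R ^+ t.+1 / t.+1`!%:R * q ^+ n) S.
Proof.
have zj j : - ((2 * pi)%:C * 'i * (z + j%:~R)) != 0.
  have -> : (j%:~R : R[i]) = (j%:~R)%:C by rewrite rmorph_int.
  rewrite oppr_eq0 !mulf_neq0 //.
  - by rewrite -[0]/((0 : R)%:C) (inj_eq (@complexI _)) mulf_neq0 // lt0r_neq0 // pi_gt0.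
  - by rewrite eq_complex /= oner_eq0 andbF.
  - rewrite eq_complex negb_and; apply/orP; right.
    by move: y0; rewrite /y; case: (z) => u v /= v0; rewrite addr0 lt0r_neq0.
have F_tends j : ctends (fun l => F l j) ((- ((2 * pi)%:C * 'i * (z + j%:~R))) ^- t.+2).
  have h := ctendsV (expf_neq0 t.+2 (zj j)) (ctendsX t.+2 (@V_tends j)).
  move=> e /h[n0 hn]; exists (maxn n0 `|j|%N) => n; rewrite geq_max => /andP[/hn + jn].
  by rewrite /F ifT //; apply/andP; split; lia.
(* The limit series converges absolutely because its terms, as limits, inherit the majorant. *)
have [S1 h1] : exists S, has_sum (fun j : int => (- ((2 * pi)%:C * 'i * (z + j%:~R))) ^- t.+2) S.
  apply: has_sum_exists; apply: sums_le_mono g_sums => j.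
  apply/ler_addgt0Pr => e /(F_tends j)[n hn].
  have -> : (- ((2 * pi)%:C * 'i * (z + j%:~R))) ^- t.+2 = F n j - (F n j - (- ((2 * pi)%:C * 'i * (z + j%:~R))) ^- t.+2) by ring.
  by apply: le_trans (ncB _ _) (lerD (F_le _ _) (ltW (hn _ _))).
have [S2 h2] : exists S, has_sum (fun n : nat => n%:R ^+ t.+1 / t.+1`!%:R * q ^+ n) S.
  apply: has_sum_exists; apply: sums_le_mono (negbin_sums_le t.+2 q1) => n.
  apply/ler_addgt0Pr => e /(G_tends n)[l hl].
  have -> : n%:R ^+ t.+1 / t.+1`!%:R * q ^+ n = G l n - (G l n - n%:R ^+ t.+1 / t.+1`!%:R * q ^+ n) by ring.
  by apply: le_trans (ncB _ _) (lerD (G_le _ _) (ltW (hl _ _))).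
exists S1; split => //; suff -> : S1 = S2 by [].
apply: (@ctends_unique _ T).
  exact: tannery F_sum h1 F_le g_sums F_tends.
exact: tannery G_sum h2 G_le (negbin_sums_le t.+2 q1) G_tends.
Qed.

End ReducedRealPart.

(** Both sides are invariant under integer translations of z, which bring the real part into [0, 1).
    The summand at n = 0 vanishes. *)
Lemma lipschitz_formula (z : R[i]) (t : nat) : 0 < complex.Im z -> exists S,
  has_sum (fun j : int => (z + j%:~R) ^- t.+2) S /\ has_sum (fun n : nat => (- ((2 * pi)%:C * 'i)) ^+ t.+2 / t.+1`!%:R * (n%:R ^+ t.+1 * qpar z ^+ n)) S.
Proof.
move=> y0; pose m := Num.floor (complex.Re z); pose z' := z - m%:~R.
have zz : z = z' + m%:~R by rewrite /z' subrK.
have mE : (m%:~R : R[i]) = (m%:~R)%:C by rewrite rmorph_int.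
have y0' : 0 < complex.Im z' by rewrite /z' mE; case: (z) y0 => u v /=; rewrite oppr0 addr0.
have xE : complex.Re z' = complex.Re z - m%:~R by rewrite /z' mE; case: (z).
have x0 : 0 <= complex.Re z' by rewrite xE subr_ge0 floor_le.
have x1 : complex.Re z' < 1.
  by rewrite xE ltrBlDr addrC; have := floorD1_gt (complex.Re z); rewrite intrD.
have [S [h1 h2]] := lipschitz_reduced t x0 x1 y0'.
pose C := (- ((2 * pi)%:C * 'i)) ^+ t.+2 : R[i].
have C0 : C != 0.
  apply: expf_neq0; rewrite oppr_eq0 mulf_neq0 //.
    by rewrite -[0]/((0 : R)%:C) (inj_eq (@complexI _)) mulf_neq0 // lt0r_neq0 // pi_gt0.
  by rewrite eq_complex /= oner_eq0 andbF.
exists (C * S); split; last first.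
  apply: has_sum_ext (has_sumZ C h2) => n; rewrite zz qparD qpar_int mulr1.
  by rewrite !mulrA; congr (_ * _); rewrite mulrAC.
have inj : injective (fun j : int => j + m) by move=> i j /addIr.
have := has_sum_inj inj _ (has_sumZ C h1) => h.
apply: has_sum_ext (h _) => [j|j jn] /=; last by have := jn (j - m); rewrite subrK eqxx.
rewrite -mulNr exprMn invfM mulrA mulfV // mul1r; congr (_ ^- _).
by rewrite zz intrD; ring.
Qed.

End Lipschitz.

(** * Quadratic reciprocity and the genus character of the principal form *)

Lemma generator_exists (F : finFieldType) : exists g : F,
  [/\ g != 0, forall x, x != 0 -> exists i, x = g ^+ i &
      forall i, (0 < i < #|F|.-1)%N -> g ^+ i != 1].
Proof.
have /cyclicP[g hg] := field_unit_group_cyclic [set: {unit F}]%G.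
have og : #[g]%g = #|F|.-1 by rewrite orderE -hg card_finField_unit.
exists (val g); split=> [|x x0|i /andP[i0 ilt]]; first by rewrite -unitfE (valP g).
  have ux : x \is a GRing.unit by rewrite unitfE.
  have : FinRing.Unit ux \in <[g]>%g by rewrite -hg inE.
  by case/cycleP => i /(congr1 val) /= ->; exists i; rewrite FinRing.val_unitX.
apply/negP => /eqP h; have : (g ^+ i = 1)%g by apply: val_inj; rewrite /= FinRing.val_unitX.
move/eqP; rewrite -order_dvdn og => /dvdn_leq -/(_ i0); lia.
Qed.

(** * Legendre symbols and Euler's criterion *)

Section QuadraticCharacter.
Variable q : nat.
Hypotheses (q_pr : prime q) (q_odd : odd q).

(** The Legendre symbol on the residue field, with integer values so that it can be mapped into any
    other field. *)
Definition leg (x : 'F_q) : int :=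
  if x == 0 then 0 else if [exists y, y ^+ 2 == x] then 1 else -1.

Lemma Fp_card_pred : #|'F_q|.-1 = q./2.*2.
Proof. by rewrite card_Fp // -[in LHS](odd_double_half q) q_odd. Qed.

Lemma half_gt0 : (0 < q./2)%N.
Proof. by case: q q_pr q_odd => [|[|[|n]]]. Qed.

Lemma Fp_expf_pred (x : 'F_q) : x != 0 -> x ^+ q./2.*2 = 1.
Proof.
move=> x0; apply: (mulfI x0); rewrite -exprS -Fp_card_pred prednK.
  by rewrite mulr1 expf_card.
by rewrite card_Fp // prime_gt0.
Qed.

Lemma Fp_two_neq0 : 2 != 0 :> 'F_q.
Proof.
rewrite -(dvdn_pcharf (pchar_Fp q_pr)); apply/negP => /dvdn_leq.
by case: q q_pr q_odd => [|[|[|n]]] //= _ _ /(_ isT).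
Qed.

(** For a generator g, g^((q-1)/2) is a square root of 1 different from 1, hence -1; a nonsquare is
    an odd power of g. *)
Lemma leg_euler (x : 'F_q) : (leg x)%:~R = x ^+ q./2.
Proof.
rewrite /leg; have [->|x0] := eqVneq x 0.
  by rewrite expr0n eqn0Ngt half_gt0.
case: ifP => [/existsP[y /eqP yx]|].
  subst x; move: x0; rewrite expf_eq0 /= => y0.
  by rewrite -exprM mul2n Fp_expf_pred.
move/negbT; rewrite negb_exists => /forallP hx.
have [g [g0 hg og]] := generator_exists 'F_q.
have [i xi] := hg _ x0; rewrite Fp_card_pred in og.
have gh : g ^+ q./2 = -1.
  have : (g ^+ q./2 - 1) * (g ^+ q./2 + 1) = 0.
    by rewrite -subr_sqr expr1n -exprM muln2 Fp_expf_pred // subrr.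
  move/eqP; rewrite mulf_eq0 subr_eq0 addr_eq0 => /orP[h|/eqP//].
  by move: (og q./2); rewrite h half_gt0 -addnn -{1}[q./2]addn0 ltn_add2l half_gt0 => /(_ isT).
rewrite xi -exprM mulnC exprM gh.
have [io|ie] := boolP (odd i); first by rewrite -signr_odd io.
case/negP: (hx (g ^+ i./2)); rewrite -exprM muln2 xi.
by rewrite -[in X in _ == X](odd_double_half i) (negPf ie).
Qed.

Lemma leg_values (x : 'F_q) : [\/ leg x = 0, leg x = 1 | leg x = -1].
Proof.
rewrite /leg; case: ifP => _; first by constructor 1.
by case: ifP => _; [constructor 2|constructor 3].
Qed.

End QuadraticCharacter.

(** Identities between symbols are proved in a field of characteristic other than 2, where 0, 1 and
    -1 stay distinct, and are lifted to the integers by this. *)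
Lemma sign_intr_inj (F : fieldType) (a b : int) : 2 != 0 :> F ->
  [\/ a = 0, a = 1 | a = -1] -> [\/ b = 0, b = 1 | b = -1] ->
  a%:~R = b%:~R :> F -> a = b.
Proof.
move=> h2 [->|->|->] [->|->|->] //; rewrite ?rmorphN ?rmorph0 ?rmorph1 //= => /eqP.
- by rewrite eq_sym oner_eq0.
- by rewrite eq_sym oppr_eq0 oner_eq0.
- by rewrite oner_eq0.
- by rewrite -subr_eq0 opprK (negPf h2).
- by rewrite oppr_eq0 oner_eq0.
- by rewrite eq_sym -subr_eq0 opprK (negPf h2).
Qed.

Section LegendreTheory.
Variable q : nat.
Hypotheses (q_pr : prime q) (q_odd : odd q).

Lemma legM (x y : 'F_q) : leg (x * y) = leg x * leg y.
Proof.
apply: (sign_intr_inj (Fp_two_neq0 q_pr q_odd)) => [||].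
- exact: leg_values.
- case: (leg_values x) => ->; case: (leg_values y) => ->; by constructor.
by rewrite rmorphM /= !leg_euler // exprMn.
Qed.

Lemma leg0 : leg (0 : 'F_q) = 0.
Proof. by rewrite /leg eqxx. Qed.

Lemma leg_sqr (x : 'F_q) : x != 0 -> leg (x ^+ 2) = 1.
Proof.
move=> x0; rewrite /leg expf_eq0 (negPf x0) /=.
by case: existsP => // h; case: h; exists x.
Qed.

Lemma leg1 : leg (1 : 'F_q) = 1.
Proof. by rewrite -(expr1n _ 2) leg_sqr ?oner_neq0. Qed.

(** Multiplication by a nonresidue permutes the field and changes the sign of the sum. *)
Lemma sum_leg : \sum_(x : 'F_q) leg x = 0.
Proof.
have [g [g0 hg og]] := generator_exists 'F_q; rewrite Fp_card_pred // in og.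
have [a [a0 ha]] : exists a : 'F_q, a != 0 /\ leg a = -1.
  have := half_gt0 q_pr q_odd => h0.
  have h : g ^+ q./2 != 1 by apply: og; rewrite h0 -addnn -{1}[q./2]addn0 ltn_add2l.
  rewrite -(leg_euler q_pr q_odd) in h; exists g.

  split=> //; move: h; rewrite /leg (negPf g0); case: ifP => // _.

have ub : {on [pred _ | true], bijective (fun x : 'F_q => a * x)}.
  by apply: onW_bij; exists (fun x => a^-1 * x) => x; rewrite mulrA ?mulVf ?mulfV // mul1r.
have e : \sum_(x : 'F_q) leg x = - \sum_(x : 'F_q) leg x.
  rewrite {1}(reindex (fun x : 'F_q => a * x)) //= -sumrN.
  by apply: eq_bigr => x _; rewrite legM ha mulN1r.
by move: e; lia.
Qed.

Lemma legN1 : leg (-1 : 'F_q) = (-1) ^+ q./2.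
Proof.
apply: (sign_intr_inj (Fp_two_neq0 q_pr q_odd)) => [||].
- exact: leg_values.
- by rewrite -signr_odd; case: odd; constructor.
by rewrite leg_euler // rmorphXn /= rmorphN rmorph1.
Qed.

(** * Gauss sums over a field containing a primitive q-th root of unity *)

Section GaussSum.
Variables (K : fieldType) (z : K).
Hypothesis z_prim : q.-primitive_root z.

Let pw (x : 'F_q) : K := z ^+ (val x).

Let Fq : (Zp_trunc (pdiv q)).+2 = q. Proof. exact: Fp_cast. Qed.

Let pwD x y : pw (x + y) = pw x * pw y.
Proof.
have e : val (x + y) = ((val x + val y) %% q)%N by rewrite /=; congr (_ %% _)%N; exact: Fq.
by rewrite /pw e (prim_expr_mod z_prim) exprD.
Qed.

Let pwMn (x : 'F_q) n : pw (n%:R * x) = pw x ^+ n.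
Proof.
elim: n => [|n IH]; first by rewrite mul0r /pw expr0.
by rewrite mulrSr mulrDl mul1r pwD IH exprSr.
Qed.

Let sum_pw (u : 'F_q) : \sum_(x : 'F_q) pw (x * u) = if u == 0 then q%:R else 0.
Proof.
case: eqVneq => [->|u0].
  rewrite (eq_bigr (fun=> 1)) => [|x _]; last by rewrite mulr0 /pw expr0.
  by rewrite sumr_const card_Fp.
pose w := pw u; have w1 : w != 1.
  rewrite /w /pw -(prim_order_dvd z_prim); apply/negP => /dvdn_leq.
  have : (val u < q)%N by rewrite -[X in (_ < X)%N]Fq; exact: ltn_ord.
  have : (0 < val u)%N by rewrite lt0n; apply: contraNneq u0 => h; apply/eqP/val_inj.
  by move=> h1 h2 /(_ h1); rewrite leqNgt h2.
have wb : {on [pred _ | true], bijective (fun x : 'F_q => 1 + x)}.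
  by apply: onW_bij; exists (fun x => x - 1) => x; ring.
have e : \sum_(x : 'F_q) pw (x * u) = w * \sum_(x : 'F_q) pw (x * u).
  rewrite {1}(reindex (fun x : 'F_q => 1 + x)) //= mulr_sumr.
  by apply: eq_bigr => x _; rewrite mulrDl mul1r pwD.
move/eqP: e; rewrite -subr_eq0 -{1}[\sum_(x : 'F_q) _]mul1r -mulrBl mulf_eq0 subr_eq0 eq_sym (negPf w1).
by move/eqP.
Qed.

Let g : K := \sum_(x : 'F_q) (leg x)%:~R * pw x.

Let g_twist (x : 'F_q) : (leg x)%:~R * g = \sum_(t : 'F_q) (leg t)%:~R * pw (x * t).
Proof.
have [->|x0] := eqVneq x 0.
  rewrite leg0 mul0r (eq_bigr (fun t => (leg t)%:~R)) => [|t _].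
    by rewrite -rmorph_sum /= sum_leg.
  by rewrite mul0r /pw expr0 mulr1.
have xb : {on [pred _ | true], bijective (fun t : 'F_q => x * t)}.
  by apply: onW_bij; exists (fun t => x^-1 * t) => t; rewrite mulrA ?mulVf ?mulfV // mul1r.
rewrite /g (reindex (fun t : 'F_q => x * t)) //= mulr_sumr; apply: eq_bigr => t _.
by rewrite mulrA -rmorphM /= legM mulrA -legM -expr2 leg_sqr // mul1r.
Qed.

(** One factor is twisted by [g_twist]; after exchanging sums, the additive character sum over x
    vanishes except for t = -1, where it is q. *)
Lemma gauss_sum_sqr : g ^+ 2 = (leg (-1 : 'F_q) * q%:Z)%:~R.
Proof.
transitivity (\sum_(x : 'F_q) pw x * \sum_(t : 'F_q) (leg t)%:~R * pw (x * t)).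
  rewrite expr2 {1}/g mulr_suml; apply: eq_bigr => x _.
  by rewrite -g_twist mulrCA mulrA.
transitivity (\sum_(t : 'F_q) (leg t)%:~R * \sum_(x : 'F_q) pw (x * (1 + t))).
  rewrite (eq_bigr (fun x => \sum_(t : 'F_q) pw x * ((leg t)%:~R * pw (x * t)))) => [|x _]; last by rewrite mulr_sumr.
  rewrite exchange_big /=; apply: eq_bigr => t _; rewrite mulr_sumr.
  by apply: eq_bigr => x _; rewrite mulrDr mulr1 pwD mulrCA.
rewrite (bigD1 (-1 : 'F_q)) //= [X in _ + X]big1; last first.
  move=> t t1; apply/eqP; rewrite mulf_eq0; apply/orP; right.
  by rewrite (sum_pw (1 + t)) addrC addr_eq0 (negPf t1).
by rewrite (sum_pw (1 + -1)) subrr eqxx addr0 rmorphM.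
Qed.

Lemma gauss_sum_frobenius p : prime p -> odd p -> p \in [pchar K] ->
  g ^+ p = (leg (p%:R : 'F_q))%:~R * g.
Proof.
move=> p_pr p_odd pK; rewrite g_twist -(pFrobenius_autE pK) rmorph_sum /=.
apply: eq_bigr => t _; rewrite pFrobenius_autE exprMn pwMn; congr (_ * _).
case: (leg_values t) => ->; rewrite ?rmorph0 ?rmorph1 ?rmorphN ?rmorph1 /=.
- by rewrite expr0n; case: (p) p_odd.
- by rewrite expr1n.
- by rewrite -signr_odd p_odd.
Qed.

(** g^p is computed twice: by the Frobenius as (p/q) g, and as g (g^2)^((p-1)/2). Since g^2 = q^* up
    to the embedding and p differs from q, g is nonzero and cancels. *)
Lemma gauss_sum_reciprocity p : prime p -> odd p -> p \in [pchar K] -> p != q ->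
  (leg (p%:R : 'F_q))%:~R = (leg (-1 : 'F_q) * q%:Z)%:~R ^+ p./2 :> K.
Proof.
move=> p_pr p_odd pK pq.
have g0 : g != 0.
  apply/negP => /eqP g0; have := gauss_sum_sqr; rewrite g0 expr0n /= legN1 rmorphM /= rmorphXn /= rmorphN rmorph1 => /esym/eqP.
  rewrite mulf_eq0 expf_eq0 oppr_eq0 oner_eq0 andbF /= -(dvdn_pcharf pK).
  by rewrite dvdn_prime2 // (negPf pq).
apply: (mulIf g0); rewrite -gauss_sum_frobenius // -gauss_sum_sqr -exprM -exprSr.
by rewrite mul2n -[in LHS](odd_double_half p) p_odd.
Qed.

End GaussSum.
End LegendreTheory.

Lemma intr_nat (A : pzRingType) (n : nat) : (n%:Z)%:~R = n%:R :> A.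
Proof. by []. Qed.

Lemma intr_pchar_eq0 (K : fieldType) p (n : int) : p \in [pchar K] ->
  (n%:~R == 0 :> K) = (p%:Z %| n)%Z.
Proof.
move=> pK; case: n => n; first by rewrite intr_nat -(dvdn_pcharf pK) dvdzE.
by rewrite NegzE rmorphN /= oppr_eq0 intr_nat -(dvdn_pcharf pK) dvdzE abszN.
Qed.

(** In the field with p^(q-1) elements, q divides the order of the unit group by Fermat, and
    Cauchy's theorem gives an element of order q. *)
Lemma prim_root_exists p q : prime p -> prime q -> p != q ->
  exists (K : finFieldType) (z : K), p \in [pchar K] /\ q.-primitive_root z.
Proof.
move=> p_pr q_pr pq; have q1 := prime_gt1 q_pr.
have k0 : (0 < q.-1)%N by rewrite -subn1 subn_gt0.
have [K pK cK] := PrimePowerField p_pr k0.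
have : (q %| #|[set: {unit K}]|)%N.
  rewrite card_finField_unit cK -subn1 -eqn_mod_dvd ?expn_gt0 ?prime_gt0 //.
  rewrite -(totient_prime q_pr); apply/eqP/Euler_exp_totient.
  by rewrite prime_coprime // dvdn_prime2.
case/(Cauchy q_pr) => x _ ox; pose z := val x; exists K, z; split=> //.
have zq : z ^+ q = 1 by rewrite /z -FinRing.val_unitX -ox expg_order.
have [m zm] := prim_order_exists (prime_gt0 q_pr) zq.
have /primeP[_ h] := q_pr => /h /orP[/eqP m1|/eqP <-//].
move: zm; rewrite m1 => /prim_expr_order; rewrite expr1 => z1.
have x1 : x = 1%g by apply: val_inj.
by move: q1; rewrite -ox x1 order1.
Qed.

(* q^* = (-1)^((q - 1) / 2) q for an odd prime q. *)
Definition star (q : nat) : int := leg (-1 : 'F_q) * q%:Z.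

Lemma leg_reciprocity p q : prime p -> odd p -> prime q -> odd q -> p != q ->
  leg ((star q)%:~R : 'F_p) = leg (p%:R : 'F_q).
Proof.
move=> p_pr p_odd q_pr q_odd pq.
have [K [z [pK zq]]] := prim_root_exists p_pr q_pr pq.
have K2 : 2 != 0 :> K.
  rewrite -(dvdn_pcharf pK); apply/negP => /dvdn_leq.
  by case: p p_pr p_odd {pq pK} => [|[|[|n]]] //= _ _ /(_ isT).
apply: (sign_intr_inj K2); try exact: leg_values.
rewrite (gauss_sum_reciprocity q_pr q_odd zq p_pr p_odd pK pq) -/(star q).
(* For images of integers, equality in K and in 'F_p both mean that p divides the difference, so
   Euler's criterion passes from 'F_p to K. *)
apply/eqP; rewrite -rmorphXn /= -subr_eq0 -rmorphB /= (intr_pchar_eq0 _ pK).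
by rewrite -(intr_pchar_eq0 _ (pchar_Fp p_pr)) rmorphB rmorphXn /= leg_euler // subrr.
Qed.

(** * Characters modulo 4 and 8, and the Kronecker symbol of a discriminant *)

Definition chi4 (n : nat) : int :=
  if (n %% 4 == 1)%N then 1 else if (n %% 4 == 3)%N then -1 else 0.
Definition chi8 (n : nat) : int :=
  if (n %% 8 == 1)%N || (n %% 8 == 7)%N then 1
  else if (n %% 8 == 3)%N || (n %% 8 == 5)%N then -1 else 0.

Lemma chi4M m n : chi4 (m * n) = chi4 m * chi4 n.
Proof.
rewrite /chi4 -modnMm; have := ltn_pmod m (isT : 0 < 4)%N.
have := ltn_pmod n (isT : 0 < 4)%N.
by case: (n %% 4)%N => [|[|[|[|?]]]] // _; case: (m %% 4)%N => [|[|[|[|?]]]].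
Qed.

Lemma chi8M m n : chi8 (m * n) = chi8 m * chi8 n.
Proof.
rewrite /chi8 -modnMm; have := ltn_pmod m (isT : 0 < 8)%N.
have := ltn_pmod n (isT : 0 < 8)%N.
by case: (n %% 8)%N => [|[|[|[|[|[|[|[|?]]]]]]]] // _;
   case: (m %% 8)%N => [|[|[|[|[|[|[|[|?]]]]]]]].
Qed.

Lemma leg_N1_chi4 p : prime p -> odd p -> leg (-1 : 'F_p) = chi4 p.
Proof.
move=> p_pr p_odd; rewrite legN1 // -signr_odd /chi4.
have hp := odd_double_half p; rewrite p_odd /= in hp.
have hh := odd_double_half p./2.
case: (odd p./2) hh => /= hh.
  by have -> : (p %% 4 = 3)%N by lia.
by have -> : (p %% 4 = 1)%N by lia.
Qed.

(* With u a primitive 8th root of unity, (u + u^-1)^2 = 2, and the Frobenius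
   maps u + u^-1 to u^p + u^-p, which depends on p modulo 8. *)
Lemma leg_2_chi8 p : prime p -> odd p -> leg (2 : 'F_p) = chi8 p.
Proof.
move=> p_pr p_odd.
have [K pK cK] := PrimePowerField p_pr (isT : 0 < 2)%N.
have K2 : 2 != 0 :> K.
  rewrite -(dvdn_pcharf pK); apply/negP => /dvdn_leq.
  by case: p p_pr p_odd {pK cK} => [|[|[|n]]] //= _ _ /(_ isT).
have [g [g0 _ og]] := generator_exists K.
have p3 : (2 < p)%N by case: p p_pr p_odd {pK cK og} => [|[|[|n]]].
(* K has p^2 elements, and p^2 - 1 = 4 h (h + 1) with h = (p - 1)/2 is a multiple of 8, so K
   contains a primitive 8th root of unity. *)
have [n hn] : exists n, (#|K|.-1 = 8 * n)%N.
  exists (p./2 * p./2.+1 %/ 2)%N; rewrite cK.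
  have hp := odd_double_half p; rewrite p_odd /= in hp.
  have h2 : (2 %| p./2 * p./2.+1)%N by rewrite dvdn2 oddM /= andbN.
  have := divnK h2; rewrite -mulnn; nia.
have n0 : (0 < n)%N.
  rewrite lt0n; apply: contraTneq p3 => n0; move: hn; rewrite n0 muln0 cK -mulnn; nia.
pose u := g ^+ n.
have u8 : u ^+ 8 = 1.
  rewrite -exprM mulnC -hn; apply: (mulfI g0); rewrite -exprS prednK ?mulr1 ?expf_card //.
  by rewrite cK expn_gt0 prime_gt0.
have u4 : u ^+ 4 = -1.
  have : (u ^+ 4 - 1) * (u ^+ 4 + 1) = 0 by rewrite -subr_sqr expr1n -exprM u8 subrr.
  move/eqP; rewrite mulf_eq0 subr_eq0 addr_eq0 => /orP[h|/eqP//].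
  by move: (og (n * 4)%N); rewrite exprM h hn => /(_ _) h'; have := h' ltac:(lia).
have u0 : u != 0 by rewrite expf_neq0.
pose t := u + u^-1.
have t2 : t ^+ 2 = 2.
  have : u ^+ 2 * (t ^+ 2 - 2) = 0.
    rewrite /t; have -> : u ^+ 2 * ((u + u^-1) ^+ 2 - 2) = u ^+ 4 + 1 by field.
    by rewrite u4 addNr.
  by move/eqP; rewrite mulf_eq0 expf_eq0 (negPf u0) /= subr_eq0 => /eqP.
have t0 : t != 0 by apply: contraNneq K2 => h; rewrite -t2 h expr0n.
have tp : t ^+ p = t * 2 ^+ p./2.
  by rewrite -t2 -exprM -exprS mul2n -[in LHS](odd_double_half p) p_odd.
have tp' : t ^+ p = u ^+ p + u ^- p.
  by rewrite -!(pFrobenius_autE pK) /t rmorphD fmorphV /=.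
have chit : t ^+ p = (chi8 p)%:~R * t.
  have um : u ^+ p = u ^+ (p %% 8) by rewrite expr_mod.
  rewrite tp' um /chi8.
  have : odd (p %% 8) by rewrite odd_mod.
  have := ltn_pmod p (isT : 0 < 8)%N.
  have e3 : u ^+ 3 = - u^-1 by apply: (mulfI u0); rewrite -exprS u4 mulrN mulfV.
  have e5 : u ^+ 5 = - u by rewrite exprS u4 mulrN1.
  have e7 : u ^+ 7 = u^-1 by apply: (mulfI u0); rewrite -exprS u8 mulfV.
  case: (p %% 8)%N => [|[|[|[|[|[|[|[|?]]]]]]]] // _ _ /=.
  - by rewrite mulr1z mul1r.
  - by rewrite e3 invrN invrK mulrN1z mulN1r /t opprD addrC.
  - by rewrite e5 invrN mulrN1z mulN1r /t opprD.
  - by rewrite e7 invrK mulr1z mul1r addrC.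
apply: (sign_intr_inj K2); first exact: leg_values.
  rewrite /chi8; case: ifP => _; first by constructor.
  by case: ifP => _; constructor.
have -> : (chi8 p)%:~R = 2 ^+ p./2 :> K by apply: (mulIf t0); rewrite -chit tp mulrC.
have : (leg (2 : 'F_p) - (2 : int) ^+ p./2)%:~R == 0 :> K.
  rewrite (intr_pchar_eq0 _ pK) -(intr_pchar_eq0 _ (pchar_Fp p_pr)).
  by rewrite rmorphB rmorphXn /= leg_euler // subrr.
by rewrite rmorphB rmorphXn /= subr_eq0 => /eqP.
Qed.

Lemma kronecker_prime_leg (a : int) p : prime p -> odd p ->
  kronecker_prime a p = leg (a%:~R : 'F_p).
Proof.
move=> p_pr p_odd; rewrite /kronecker_prime /leg (intr_pchar_eq0 _ (pchar_Fp p_pr)).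
case: ifP => // _; rewrite ifF; last by apply: contraTF p_odd => /eqP ->.
congr (if _ then _ else _); apply/existsP/existsP => -[x hx].
  exists (x%:R); move: hx; rewrite -(intr_pchar_eq0 _ (pchar_Fp p_pr)).
  by rewrite rmorphB rmorphXn /= intr_nat subr_eq0.
have xp : (val x < p)%N by rewrite -[X in (_ < X)%N](Fp_cast p_pr); exact: ltn_ord.
exists (Ordinal xp); rewrite -(intr_pchar_eq0 _ (pchar_Fp p_pr)).
by rewrite rmorphB rmorphXn /= intr_nat subr_eq0 natr_Zp.
Qed.

Lemma dvdz2 (a : int) : (2 %| a)%Z = ~~ odd `|a|%N.
Proof. by rewrite dvdzE; exact: dvdn2. Qed.

Definition kronecker_two (a : int) : int :=
  if ((a %% 8)%Z == 1) || ((a %% 8)%Z == 7) then 1 else -1.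

Lemma modz_cases8 (a : int) : exists2 r : nat, (r < 8)%N & exists k, a = 8 * k + r%:Z.
Proof.
exists (absz (a %% 8)%Z); first by have := ltz_pmod a (isT : 0 < 8 :> int); have := modz_ge0 a (isT : 8 != 0 :> int); lia.
by exists (a %/ 8)%Z; have := divz_eq a 8; have := modz_ge0 a (isT : 8 != 0 :> int); lia.
Qed.

Lemma kronecker_twoM (a b : int) : ~~ (2 %| a)%Z -> ~~ (2 %| b)%Z ->
  kronecker_two (a * b) = kronecker_two a * kronecker_two b.
Proof.
move=> a2 b2; rewrite /kronecker_two -modzMml -modzMmr.
have : exists2 r : nat, (r < 8)%N & (a %% 8)%Z = r%:Z.
  by exists (absz (a %% 8)%Z); lia.
have : exists2 r : nat, (r < 8)%N & (b %% 8)%Z = r%:Z.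
  by exists (absz (b %% 8)%Z); lia.
move=> [s s8 bs] [r r8 ar].
have ro : odd r by lia.
have so : odd s by lia.
rewrite ar bs.
by case: r r8 ro {ar} => [|[|[|[|[|[|[|[|?]]]]]]]] // _ _;
   case: s s8 so {bs} => [|[|[|[|[|[|[|[|?]]]]]]]].
Qed.

Lemma star_cases q : prime q -> odd q ->
  star q = if (q %% 4 == 1)%N then q%:Z else - q%:Z.
Proof.
move=> q_pr q_odd; rewrite /star leg_N1_chi4 // /chi4.
case: ifP => h; first by rewrite mul1r.
by rewrite ifT ?mulN1r //; lia.
Qed.

Lemma kronecker_two_star q : prime q -> odd q -> kronecker_two (star q) = chi8 q.
Proof.
move=> q_pr q_odd; rewrite star_cases // /kronecker_two /chi8.
have r8 := ltn_pmod q (isT : 0 < 8)%N; have hq := divn_eq q 8.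
have -> : (q %% 4 = (q %% 8) %% 4)%N by rewrite modn_dvdm.
have : odd (q %% 8) by rewrite odd_mod.
rewrite (fun_if (fun a => (a %% 8)%Z)).
have -> : ((- q%:Z) %% 8)%Z = ((8 - q %% 8) %% 8)%N%:Z.
  by move: (q %% 8)%N (q %/ 8)%N r8 hq => r k r8 ->; lia.
by rewrite modz_nat; case: (q %% 8)%N r8 => [|[|[|[|[|[|[|[|?]]]]]]]].
Qed.

Section OddPart.
Variable S : seq nat.
Hypothesis S_pr : forall q, q \in S -> prime q && odd q.

Definition star_prod (S : seq nat) : int := \prod_(q <- S) star q.
Definition leg_prod (S : seq nat) (n : nat) : int := \prod_(q <- S) leg (n%:R : 'F_q).

Lemma star_prod_mod4 : exists k : int, star_prod S = 4 * k + 1.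
Proof.
rewrite /star_prod; elim: S S_pr => [|q T IH] h; first by exists 0; rewrite big_nil.
have /andP[q_pr q_odd] := h q (mem_head _ _).
have [|k hk] := IH; first by move=> r rT; apply: h; rewrite inE rT orbT.
have [j hj] : exists j : int, star q = 4 * j + 1.
  rewrite star_cases //; case: ifP => h4.
    by exists (q %/ 4)%N%:Z; lia.
  by exists (- (q %/ 4)%N%:Z - 1); lia.
by exists (4 * j * k + j + k); rewrite big_cons hk hj; ring.
Qed.

(** Odd p is quadratic reciprocity for each factor q^*; p = 2 is the supplementary law, since both
    (q^*/2) and (2/q) are [chi8 q]. *)
Lemma kronecker_prime_star_prod p : prime p -> p \notin S ->
  kronecker_prime (star_prod S) p = leg_prod S p.
Proof.
move=> p_pr; have [p_odd|p2] := boolP (odd p).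
  rewrite kronecker_prime_leg // /star_prod /leg_prod.
  elim: S S_pr => [|q T IH] h; first by rewrite !big_nil rmorph1 leg1.
  have /andP[q_pr q_odd] := h q (mem_head _ _).
  rewrite inE negb_or => /andP[pq pT].
  rewrite !big_cons rmorphM /= legM // leg_reciprocity // IH // => r rT.
  by apply: h; rewrite inE rT orbT.
have {p2}-> : p = 2%N by case: (even_prime p_pr) => // h; rewrite h in p2.
move=> S2; rewrite /kronecker_prime.
have [k hk] := star_prod_mod4.
case: ifP => [h2|_]; first by exfalso; move: h2; rewrite hk; lia.
change (kronecker_two (star_prod S) = leg_prod S 2); rewrite /star_prod /leg_prod.
elim: S S_pr {S2 hk} => [|q T IH] h; first by rewrite !big_nil.
have /andP[q_pr q_odd] := h q (mem_head _ _).
have hT : forall r, r \in T -> prime r && odd r by move=> r rT; apply: h; rewrite inE rT orbT.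
rewrite !big_cons kronecker_twoM.
- by rewrite IH // kronecker_two_star // -leg_2_chi8.
- by rewrite star_cases //; case: ifP => _; lia.
- have : forall U, (forall r, r \in U -> prime r && odd r) -> ~~ (2 %| \prod_(j <- U) star j)%Z.
    elim=> [|r U IHU] hU; first by rewrite big_nil.
    have /andP[r_pr r_odd] := hU r (mem_head _ _).
    have := IHU (fun x xU => hU x (mem_behead (s := r :: U) xU)).
    rewrite big_cons star_cases //; move: (\prod_(j <- U) _) => X.
    by case: ifP => _; rewrite !dvdz2 abszM ?abszN oddM r_odd.
  exact.
Qed.

Lemma leg_prodM m n : leg_prod S (m * n) = leg_prod S m * leg_prod S n.
Proof.
rewrite /leg_prod -big_split /=; apply: eq_big_seq => q /S_pr /andP[q_pr q_odd].
by rewrite natrM legM.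
Qed.

Lemma leg_prod1 : leg_prod S 1 = 1.
Proof. by apply: big1_seq => q /andP[_ /S_pr /andP[q_pr q_odd]]; rewrite leg1. Qed.

End OddPart.

Lemma prod_primes_multiplicative (F : nat -> int) n : (0 < n)%N -> F 1%N = 1 ->
  (forall i j, F (i * j)%N = F i * F j) ->
  \prod_(p <- primes n) F p ^+ logn p n = F n.
Proof.
move=> n0 F1 FM; rewrite [in RHS](prod_prime_decomp n0) prime_decompE big_map /=.
have FX i j : F (i ^ j)%N = F i ^+ j.
  by elim: j => [|j IH]; rewrite ?expn0 ?expr0 // expnS FM IH exprS.
elim: (primes n) => [|p s IH]; first by rewrite !big_nil F1.
by rewrite !big_cons FM FX IH.
Qed.

(* A fundamental discriminant is e * prod q^* with distinct odd primes q and e in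
   {1, -4, 8, -8}; then psi is 1, chi4, chi8 or chi4 chi8. *)
Lemma kronecker_factor (S : seq nat) (e : int) (psi : nat -> int) (n : nat) :
  (forall q, q \in S -> prime q && odd q) -> psi 1%N = 1 ->
  (forall i j, psi (i * j)%N = psi i * psi j) -> (0 < n)%N ->
  (forall p, prime p -> (p %| n)%N -> kronecker_prime (e * star_prod S) p = psi p * leg_prod S p) ->
  kronecker (e * star_prod S) n%:Z = psi n * leg_prod S n.
Proof.
move=> hS psi1 psiM n0 h; rewrite /kronecker ifF; last by lia.
rewrite ltNge lez_nat /= mul1r.
rewrite -(@prod_primes_multiplicative (fun m => psi m * leg_prod S m)) //.
- apply: eq_big_seq => p; rewrite mem_primes => /and3P[p_pr _ pn].
  by rewrite h.
- by rewrite psi1 leg_prod1 // mul1r.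
- by move=> i j; rewrite psiM leg_prodM // mulrACA.
Qed.

Lemma even_half_mod4 (r : int) : (r = 2 %[mod 4])%Z ->
  exists s, r = 2 * s /\
  (((s = 1 %[mod 4])%Z /\ (r = 2 %[mod 8])%Z) \/ ((s = 3 %[mod 4])%Z /\ (r = 6 %[mod 8])%Z)).
Proof. by move=> h; exists (r %/ 2)%Z; lia. Qed.

Lemma oppz_mod4 (s : int) : (s = 3 %[mod 4])%Z -> (- s = 1 %[mod 4])%Z.
Proof. lia. Qed.

(** The absolute values agree by prime factorization; the sign is settled because both sides are 1
    modulo 4. *)
Lemma squarefree_star_prod (m : int) : (m = 1 %[mod 4])%Z -> squarefree m ->
  m = star_prod (primes `|m|%N) /\
  (forall q, q \in primes `|m|%N -> prime q && odd q).
Proof.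
move=> m1 sf; have m0 : m != 0 by apply/eqP => m0; move: m1; rewrite m0.
have hS q : q \in primes `|m|%N -> prime q && odd q.
  rewrite mem_primes => /and3P[q_pr _ qm]; rewrite q_pr /=.
  case: (even_prime q_pr) qm => // -> /dvdnP[k hk].
  by exfalso; move: m1; lia.
split=> //; have [k hk] := star_prod_mod4 hS.
have mabs : absz (star_prod (primes `|m|%N)) = absz m.
  have mg : (0 < `|m|)%N by rewrite absz_gt0.
  rewrite [in RHS](prod_prime_decomp mg) prime_decompE big_map /= /star_prod.
  have : forall s, {subset s <= primes `|m|%N} ->
      absz (\prod_(q <- s) star q) = (\prod_(q <- s) q ^ logn q `|m|)%N.
    elim=> [|q s IH] hs; first by rewrite !big_nil.
    rewrite !big_cons abszM IH; last by move=> r rs; apply: hs; rewrite inE rs orbT.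
    congr (_ * _)%N; have qS := hs q (mem_head _ _); have /andP[q_pr q_odd] := hS q qS.
    have -> : logn q `|m| = 1%N.
      apply/eqP; rewrite eqn_leq logn_gt0 qS andbT leqNgt.
      rewrite -pfactor_dvdn //; have := sf q q_pr; rewrite dvdzE abszX.
      by [].
    by rewrite expn1 star_cases //; case: ifP => _; rewrite ?abszN.
  by apply.
have : star_prod (primes `|m|%N) = m \/ star_prod (primes `|m|%N) = - m by lia.
case=> // h; exfalso; move: m1; lia.
Qed.

(** The value v^2 - d r y^2 modulo 8, with 7 in place of -1 to stay within the natural numbers. *)
Definition mod8_form (v y d r : nat) : nat := ((v * v + 7 * d * r * y * y) %% 8)%N.

Lemma mod8_form_check :
  all (fun v => all (fun y => all (fun d => all (fun r =>
    let n := mod8_form v y d r in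
    (d %% 4 <= 1)%N ==> odd n ==>
    [&& (r %% 4 == 3)%N ==> (chi4 n == 1), (r == 2)%N ==> (chi8 n == 1) &
        (r == 6)%N ==> (chi4 n * chi8 n == 1)])
    (iota 0 8)) (iota 0 8)) (iota 0 8)) (iota 0 8).
Proof. by vm_compute. Qed.

(** All the conditions depend only on residues modulo 8, so the claim reduces to the enumeration in
    [mod8_form_check]. *)
Lemma even_symbol_value (v y d r : int) (n : nat) : n%:Z = v ^+ 2 - d * r * y ^+ 2 ->
  discriminant d -> odd n ->
  [/\ (r = 3 %[mod 4])%Z -> chi4 n = 1, (r = 2 %[mod 8])%Z -> chi8 n = 1 &
      (r = 6 %[mod 8])%Z -> chi4 n * chi8 n = 1].
Proof.
move=> hn hd no.
have [v0 v8 [v1 hv]] := modz_cases8 v; have [y0 y8 [y1 hy]] := modz_cases8 y.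
have [d0 d8 [d1 hd1]] := modz_cases8 d; have [r0 r8 [r1 hr]] := modz_cases8 r.
have n8 : (n %% 8 = mod8_form v0 y0 d0 r0)%N.
  rewrite /mod8_form; apply/eqP; rewrite -eqz_nat -!modz_nat eqz_mod_dvd hn.
  apply/dvdzP; exists (8 * v1 ^+ 2 + 2 * v1 * v0%:Z
     - ((8 * d1 + d0%:Z) * (8 * r1 + r0%:Z) * (8 * y1 ^+ 2 + 2 * y1 * y0%:Z)
       + (8 * d1 * r1 + d1 * r0%:Z + r1 * d0%:Z) * y0%:Z ^+ 2) - d0%:Z * r0%:Z * y0%:Z ^+ 2).
  by rewrite hv hy hd1 hr !PoszD !PoszM; ring.
have c4 m : chi4 (m %% 8) = chi4 m by rewrite /chi4 modn_dvdm.
have c8 m : chi8 (m %% 8) = chi8 m by rewrite /chi8 modn_mod.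
have := mod8_form_check.
move=> /allP/(_ v0); rewrite mem_iota => /(_ v8) /allP/(_ y0).
rewrite mem_iota => /(_ y8) /allP/(_ d0); rewrite mem_iota => /(_ d8) /allP/(_ r0).
rewrite mem_iota => /(_ r8) /=; rewrite -n8 c4 c8 odd_mod // no.
have -> : (d0 %% 4 <= 1)%N by case: hd; lia.
case/and3P=> /implyP h3 /implyP h2 /implyP h6; split=> h.
- by apply/eqP/h3; lia.
- by apply/eqP/h2; lia.
- by apply/eqP/h6; lia.
Qed.

(** * Bounds, invariance and principal value of the genus character *)

Lemma kronecker_values_le1 (a n : int) : `|kronecker a n| <= 1.
Proof.
rewrite /kronecker; case: ifP => _; first by case: ifP.
rewrite normrM -[1]mul1r ler_pM //; first by case: ifP.
elim: (primes _) => [|p s IH]; first by rewrite big_nil.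
rewrite big_cons normrM -[1]mul1r ler_pM // normrX exprn_ile1 //.
by rewrite /kronecker_prime; do ![case: ifP => _].
Qed.

Lemma genus_char_le1 (D : int) (Q : Defs.form) : `|genus_char D Q| <= 1.
Proof.
case: Q => [[a b] c]; rewrite /genus_char; case: ifP => _ //.
exact: kronecker_values_le1.
Qed.

(** Forms representing the same integers give [xget] the same set, hence the same chosen integer. *)
Lemma genus_char_eq (D : int) (a b c a' b' c' : int) :
  (forall n, represents (a, b, c) n <-> represents (a', b', c') n) ->
  (forall t, [&& (t %| a)%Z, (t %| b)%Z & (t %| c)%Z] = [&& (t %| a')%Z, (t %| b')%Z & (t %| c')%Z]) ->
  genus_char D (a, b, c) = genus_char D (a', b', c').
Proof.
move=> hr ht; rewrite /genus_char.
have -> : gcdz a (gcdz b (gcdz c D)) = gcdz a' (gcdz b' (gcdz c' D)).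
  have hd t : (t %| gcdz a (gcdz b (gcdz c D)))%Z = (t %| gcdz a' (gcdz b' (gcdz c' D)))%Z.
    rewrite !dvdz_gcd; have := ht t.
    by case: (_ %| D)%Z; rewrite ?andbT ?andbF.
  apply/eqP; rewrite /gcdz eqz_nat eqn_dvd.
  have := hd (gcdz a (gcdz b (gcdz c D))); have := hd (gcdz a' (gcdz b' (gcdz c' D))).
  by rewrite !dvdzz !dvdzE /gcdz /= => -> <-.
case: ifP => // _; congr (kronecker D (xget 0 _)).
by apply/funext => n; apply/propext; split=> -[/hr h h']; split.
Qed.

Lemma genus_char_translate (D a b c m : int) :
  genus_char D (a, b + 2 * a * m, a * m ^+ 2 + b * m + c) = genus_char D (a, b, c).
Proof.
apply: genus_char_eq => [n|t].
  split=> -[x [y ->]].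
    by exists (x + m * y), y; rewrite /form_eval /= !intz; ring.
  by exists (x - m * y), y; rewrite /form_eval /= !intz; ring.
case ta : (t %| a)%Z => //=.
have tb : (t %| b + 2 * a * m)%Z = (t %| b)%Z.
  by rewrite rpredDr // dvdz_mulr // dvdz_mull.
rewrite tb; case hb : (t %| b)%Z => //=.
by rewrite rpredDl // rpredD // dvdz_mulr.
Qed.

Lemma genus_char_opp (D a b c : int) : genus_char D (a, - b, c) = genus_char D (a, b, c).
Proof.
apply: genus_char_eq => [n|t]; last by rewrite rpredN.
by split=> -[x [y ->]]; exists x, (- y); rewrite /form_eval /= !intz; ring.
Qed.


Lemma xget_represents_principal (D b c : int) :
  let n := xget 0 [set n : int | represents (1, b, c) n /\ coprimez n D]%classic in
  represents (1, b, c) n /\ coprimez n D.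
Proof.
move=> n; have : [set n : int | represents (1, b, c) n /\ coprimez n D]%classic n.
  apply: (@xgetPex _ 0); exists 1; split; last by rewrite /coprimez /gcdz gcd1n.
  by exists 1, 0; rewrite /form_eval /= !intz; ring.
by [].
Qed.

(** Modulo each q dividing N, 4n is the square of u, and it is nonzero because n is prime to q. *)
Lemma leg_prod_principal (S : seq nat) (u N n : int) (m : nat) :
  (forall q, q \in S -> prime q && odd q) -> n = m%:Z ->
  (forall q, q \in S -> (q%:Z %| N)%Z) -> (forall q, q \in S -> coprime m q) ->
  (exists y, 4 * n = u ^+ 2 - N * y) -> leg_prod S m = 1.
Proof.
move=> hS -> hN hc [y hy]; apply: big1_seq => q /andP[_ qS].
have /andP[q_pr q_odd] := hS q qS.
have pF := pchar_Fp q_pr.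
have m0 : (m%:R : 'F_q) != 0.
  rewrite -(dvdn_pcharf pF) -prime_coprime // coprime_sym; exact: hc.
have N0 : (N%:~R : 'F_q) = 0 by apply/eqP; rewrite (intr_pchar_eq0 _ pF) hN.
have e : (2 : 'F_q) ^+ 2 * m%:R = (u%:~R) ^+ 2.
  have := congr1 (fun a : int => a%:~R : 'F_q) hy.
  rewrite rmorphB rmorphXn /= (rmorphM _ N y) (rmorphM _ 4 m%:Z) /= N0 mul0r subr0 => <-.
  by rewrite -natrX.
have h2 := Fp_two_neq0 q_pr q_odd.
have u0 : (u%:~R : 'F_q) != 0.
  apply/negP => /eqP u0; move/eqP: e; rewrite u0 expr0n mulf_eq0 expf_eq0 (negPf h2) /=.
  by rewrite (negPf m0).
have := leg_sqr u0; rewrite -e legM // leg_sqr // mul1r.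
by [].
Qed.

(** The chosen integer n need not be 1. It satisfies 4n = (2x + by)^2 - d D y^2, so it is a square
    modulo every odd prime dividing D; what remains is the contribution of the prime 2. *)
Lemma genus_char_principal (d D b c : int) : discriminant d ->
  fundamental_discriminant D -> d * D < 0 -> b ^+ 2 - 4 * c = d * D ->
  posdef (1, b, c) -> genus_char D (1, b, c) = 1.
Proof.
move=> hd hD hdD disc pd; rewrite /genus_char.
have -> : gcdz 1 (gcdz b (gcdz c D)) == 1 by rewrite /gcdz gcd1n.
have := xget_represents_principal D b c; set n := xget _ _.
move=> /= [[x [y hn]] cop].
have n_ge0 : 0 <= n.
  have [[x0 y0]|xy] := eqVneq (x, y) (0, 0); last by rewrite hn ltW // pd.
  by rewrite hn x0 y0 /form_eval /= !intz !mulr0 ?mul0r ?expr0n.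
move: hn; rewrite /form_eval /= !intz mul1r => hn.
have D0 : D != 0 by apply: contraTneq hdD => ->; rewrite mulr0.
move: n_ge0 cop hn; case: n => // m _; rewrite /coprimez => cop hn.
(* n = 0 is coprime to D only if D = 1 or D = -1, where the symbol (D/0) is 1. *)
case: (posnP m) => [m0|m0].
  move: cop; rewrite m0 gcd0z => /eqP D1.
  by rewrite /kronecker eqxx -abszE D1.
have h4 : exists y', 4 * m%:Z = (2 * x + b * y) ^+ 2 - D * y'.
  exists (d * y ^+ 2).
  have -> : D * (d * y ^+ 2) = (b ^+ 2 - 4 * c) * y ^+ 2 by rewrite disc; ring.
  by rewrite hn; ring.
have copq (q : nat) : (q%:Z %| D)%Z -> coprime m q.
  move=> qD; have : coprime m `|D| by move: cop; rewrite /gcdz eqz_nat.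
  by apply: coprime_dvdr; move: qD; rewrite dvdzE.
(* [psi] is the character attached to the factor e, the part of D at 2; only [psi m = 1] depends on
   the type of D. *)
have key (S : seq nat) (e : int) (psi : nat -> int) :
    (forall q, q \in S -> prime q && odd q) -> D = e * star_prod S ->
    psi 1%N = 1 -> (forall i j, psi (i * j)%N = psi i * psi j) ->
    (forall p, prime p -> (p %| m)%N -> p \notin S -> kronecker_prime (e * star_prod S) p = psi p * leg_prod S p) ->
    psi m = 1 -> kronecker D m%:Z = 1.
  move=> hS De psi1 psiM hpsi psim.
  have qD q : q \in S -> (q%:Z %| D)%Z.
    move=> qS; have /andP[q_pr q_odd] := hS q qS.
    rewrite De /star_prod (big_rem q) //= dvdz_mull // dvdz_mulr // star_cases //.
    by case: ifP => _; rewrite ?dvdzz // dvdzE abszN.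
  rewrite De (kronecker_factor hS psi1 psiM) //.
    rewrite psim mul1r; apply: (leg_prod_principal hS erefl qD _ h4).
    by move=> q /qD; exact: copq.
  move=> p p_pr pm; apply: hpsi => //; apply: contraL pm => /qD/copq.
  by rewrite coprime_sym prime_coprime.
case: hD => [[D1 sf]|[r [Dr sf r23]]].
  have [Ds hS] := squarefree_star_prod D1 sf.
  apply: (key _ 1 (fun=> 1) hS); rewrite ?mul1r //.
  by move=> p p_pr _ pS; rewrite !mul1r kronecker_prime_star_prod.
have m_odd : odd m.
  have := copq 2%N; rewrite coprimen2; apply.
  by rewrite Dr; apply: (dvdz_mulr r (isT : (2 %| 4)%Z)).
have p_odd p : (p %| m)%N -> odd p by move/dvdn_odd; apply.
(* For D = 4r the middle coefficient b is even, so m = (x + (b/2) y)^2 - d r y^2, the shape of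
   [even_symbol_value]. *)
have [bb hb] : exists bb, b = 2 * bb.
  exists (b %/ 2)%Z; have : ~~ odd `|b|%N.
    have : (2 %| b ^+ 2)%Z by apply/dvdzP; exists (d * (2 * r) + 2 * c); move: disc; rewrite Dr; lia.
    by rewrite dvdz2 abszX oddX.
  lia.
have hm : m%:Z = (x + bb * y) ^+ 2 - d * r * y ^+ 2.
  have -> : d * r = bb ^+ 2 - c by move: disc; rewrite hb Dr; lia.
  by rewrite hn hb; ring.
have [v3 v2 v6] := even_symbol_value hm hd m_odd.
have legs (e : int) (psi : nat -> int) S : (forall p, prime p -> odd p -> leg (e%:~R : 'F_p) = psi p) ->
    (forall q, q \in S -> prime q && odd q) -> forall p, prime p -> (p %| m)%N -> p \notin S ->
    kronecker_prime (e * star_prod S) p = psi p * leg_prod S p.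
  move=> he hS p p_pr pm pS; have po := p_odd _ pm.
  rewrite -(kronecker_prime_star_prod hS p_pr pS) !kronecker_prime_leg //.
  by rewrite rmorphM /= legM // he.
have sq4 p : prime p -> odd p -> [/\ (4%:~R : 'F_p) = 2 ^+ 2,
    (8%:~R : 'F_p) = 2 ^+ 2 * 2 & leg ((2 : 'F_p) ^+ 2) = 1].
  move=> p_pr po; split; last by rewrite leg_sqr // Fp_two_neq0.
    by rewrite -natrX.
  by rewrite -exprSr -natrX.
case: r23 => r23; last first.
  have sfr : squarefree (- r) by move=> p p_pr; rewrite dvdzE abszN -dvdzE; exact: sf.
  have [] := squarefree_star_prod (oppz_mod4 r23) sfr.
  move: (primes _) => S rs hS; apply: (key S (-4) chi4 hS) => //.
  - by rewrite -rs Dr; ring.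
  - exact: chi4M.
  - apply: legs hS => p p_pr po; have [e4 e8 l4] := sq4 p p_pr po.
    by rewrite rmorphN /= e4 -mulN1r legM // l4 mulr1 leg_N1_chi4.
  - exact: v3.
have [s [hs s13]] := even_half_mod4 r23.
have sfs : squarefree s.
  by move=> p p_pr; apply: contra (sf p p_pr) => h; rewrite hs dvdz_mull.
case: s13 => -[s1 r8].
  have [] := squarefree_star_prod s1 sfs.
  move: (primes _) => S ss hS; apply: (key S 8 chi8 hS) => //.
  - by rewrite -ss Dr hs; ring.
  - exact: chi8M.
  - apply: legs hS => p p_pr po; have [e4 e8 l4] := sq4 p p_pr po.
    by rewrite e8 legM // l4 mul1r leg_2_chi8.
  - exact: v2.
have sfn : squarefree (- s) by move=> p p_pr; rewrite dvdzE abszN -dvdzE; exact: sfs.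
have [] := squarefree_star_prod (oppz_mod4 s1) sfn.
move: (primes _) => S ss hS; apply: (key S (-8) (fun n => chi4 n * chi8 n) hS) => //.
- by rewrite -ss Dr hs; ring.
- by move=> i j; rewrite chi4M chi8M mulrACA.
- apply: legs hS => p p_pr po; have [e4 e8 l4] := sq4 p p_pr po.
  by rewrite rmorphN /= e8 -mulN1r legM // legM // l4 mul1r leg_2_chi8 // leg_N1_chi4.
- exact: v6.
Qed.

(** Existence must be shown to exclude the default 0 of [xget]: the largest l such that l^2 divides
    d with a discriminant as quotient makes that quotient fundamental. *)
Lemma conductor_gt0 (d : int) : discriminant d -> d != 0 -> (0 < conductor d)%N.
Proof.
move=> hd d0.
pose disc (m : int) := ((m %% 4)%Z == 0) || ((m %% 4)%Z == 1).
pose P l := [&& (0 < l)%N, (l%:Z ^+ 2 %| d)%Z & disc (d %/ l%:Z ^+ 2)%Z].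
have P1 : exists l, P l by exists 1%N; rewrite /P /disc expr1n dvd1z divz1; case: hd => -> //.
have Pb l : P l -> (l <= `|d|)%N.
  case/and3P=> l0 ld _; apply: leq_trans (dvdn_leq _ _ : `|l%:Z ^+ 2|%N <= _)%N.
  - by rewrite abszX /= -mulnn leq_pmull.
  - by rewrite absz_gt0.
  - by move: ld; rewrite dvdzE.
case: (ex_maxnP P1 Pb) => l /and3P[l0 ld hdisc] lmax.
have l2 : l%:Z ^+ 2 != 0 by rewrite expf_neq0; lia.
pose d1 := (d %/ l%:Z ^+ 2)%Z.
have dE : d = l%:Z ^+ 2 * d1 by rewrite mulrC divzK.
have maxd (p : nat) : (1 < p)%N -> forall d2, d1 = p%:Z ^+ 2 * d2 -> disc d2 -> False.
  move=> p1 d2 hd2 h2; have : P (l * p)%N.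
    have e : d = (l * p)%N%:Z ^+ 2 * d2 by rewrite dE hd2 PoszM exprMn mulrA.
    apply/and3P; split; first by rewrite muln_gt0 l0; lia.
      by rewrite e dvdz_mulr.
    by rewrite e mulKz // expf_neq0 //; lia.
  by move/lmax; rewrite leqNgt ltn_Pmulr.
have fund : fundamental_discriminant d1.
  have sqodd (p : nat) : odd p -> exists k, p%:Z ^+ 2 = 8 * k + 1.
    move=> po; exists (p./2 * p./2.+1 %/ 2)%N%:Z.
    have h2 : (2 %| p./2 * p./2.+1)%N by rewrite dvdn2 oddM /= andbN.
    have := divnK h2; have := odd_double_half p; rewrite po expr2; nia.
  have [/eqP m0|/eqP m1] := orP hdisc; last first.
    left; split=> // p p_pr; apply/negP => /dvdzP[d2]; rewrite mulrC => hd2.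
    apply: (maxd p (prime_gt1 p_pr) d2 hd2); rewrite /disc.
    have [po|] := boolP (odd p).
      by have [k hk] := sqodd p po; move: m1; rewrite -/d1 hd2 hk mulrDl mul1r; lia.
    by case: (even_prime p_pr) hd2 => [->|->] // hd2 _; move: m1; rewrite -/d1 hd2; lia.
  right; exists (d1 %/ 4)%Z; have d14 : d1 = 4 * (d1 %/ 4)%Z by rewrite /d1 in m0 *; lia.
  have r23 : ((d1 %/ 4)%Z = 2 %[mod 4])%Z \/ ((d1 %/ 4)%Z = 3 %[mod 4])%Z.
    have h : ~~ disc (d1 %/ 4)%Z by apply/negP => h; apply: (maxd 2%N isT _ d14 h).
    by move: h; rewrite /disc; lia.
  split=> // p p_pr; apply/negP => /dvdzP[d2]; rewrite mulrC => hd2.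
  have [po|] := boolP (odd p).
    apply: (maxd p (prime_gt1 p_pr) (4 * d2)); last by rewrite /disc; lia.
    by rewrite d14 hd2; ring.
  by case: (even_prime p_pr) hd2 => [->|->] // hd2 _; move: r23; rewrite hd2; lia.
rewrite /conductor.
pose L := [set l : nat | (0 < l)%N /\
  exists d0 : int, fundamental_discriminant d0 /\ d = l%:Z ^+ 2 * d0]%classic.
have : L (xget 0%N L).
  by apply: (@xgetPex _ 0%N); exists l; split=> //; exists d1.
by case.
Qed.

(** * Square roots of -N modulo 4a *)

Section RootCount.
Local Open Scope nat_scope.

(** The number r(a) of the overview. *)
Definition sqrt_count (N a : nat) : nat :=
  count (fun b => 4 * a %| b ^ 2 + N) (iota 0 (2 * a)).

Lemma nat_sqrt_exists m : exists k, k ^ 2 <= m < k.+1 ^ 2.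
Proof.
elim: m => [|m [k /andP[h1 h2]]]; first by exists 0.
have [h|h] := leqP (k.+1 ^ 2) m.+1.
  by exists k.+1; rewrite h /=; move: h2; rewrite -!mulnn; nia.
by exists k; rewrite h andbT leqW.
Qed.

(** With k the integer part of sqrt m, there are at most k divisors up to k, and d -> m / d maps the
    others injectively into the same range. *)
Lemma size_divisors_sqr m : 0 < m -> size (divisors m) ^ 2 <= 4 * m.
Proof.
move=> m0; have [k /andP[k1 k2]] := nat_sqrt_exists m.
suff h : size (divisors m) <= k.*2.
  apply: leq_trans (_ : k.*2 ^ 2 <= _); first by rewrite leq_sqr.
  by move: k1; rewrite -muln2 expnMn; lia.
rewrite -(count_predC (fun d => d <= k)) -addnn leq_add //.
- rewrite -size_filter -[X in _ <= X](size_iota 1); apply: uniq_leq_size.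
    exact/filter_uniq/divisors_uniq.
  move=> d; rewrite mem_filter mem_iota -dvdn_divisors // => /andP[dk dm].
  by rewrite (dvdn_gt0 m0 dm) add1n ltnS.
- rewrite -size_filter -(size_map (fun d => m %/ d)) -[X in _ <= X](size_iota 1).
  apply: uniq_leq_size.
    rewrite map_inj_in_uniq; first exact/filter_uniq/divisors_uniq.
    move=> d e; rewrite !mem_filter -!dvdn_divisors // => /andP[_ dm] /andP[_ em] h.
    have := divnK dm; have := divnK em; rewrite -h.
    have : 0 < m %/ d by rewrite divn_gt0 ?(dvdn_gt0 m0 dm) // dvdn_leq.
    nia.
  move=> e /mapP[d]; rewrite mem_filter -dvdn_divisors //= -ltnNge => /andP[dk dm] ->.
  have d0 := dvdn_gt0 m0 dm.
  rewrite mem_iota divn_gt0 // dvdn_leq //= add1n.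
  rewrite ltn_divLR //; apply: leq_trans k2 _; rewrite -mulnn leq_mul2l dk orbT //.
Qed.

Lemma size_le_fibers (T U : eqType) (f : T -> U) (s : seq T) (G : seq U) E :
  (forall x, x \in s -> f x \in G) ->
  (forall g, size [seq x <- s | f x == g] <= E) -> size s <= size G * E.
Proof.
move=> sG sE; apply: leq_trans (_ : \sum_(g <- G) size [seq x <- s | f x == g] <= _).
  elim: s sG {sE} => [//|x s IH] sG.
  have -> : \sum_(g <- G) size [seq y <- x :: s | f y == g] =
      \sum_(g <- G) (f x == g) + \sum_(g <- G) size [seq y <- s | f y == g].
    by rewrite -big_split; apply: eq_bigr => g _ /=; case: eqP.
  rewrite /= -add1n leq_add ?IH // => [|y ys]; last by rewrite sG // inE ys orbT.
  rewrite (big_rem (f x)) ?sG ?mem_head //= eqxx; lia.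
by rewrite -sum1_size big_distrl /= leq_sum // => g _; rewrite mul1n.
Qed.

(* If x and x0 are square roots of -N modulo m, then with g = gcd(x - x0, m)
   the cofactor m / g divides x + x0; so x is determined modulo lcm(g, m / g),
   and gcd(g, m / g)^2 divides 4 N. *)
Lemma sqrt_fiber_size (N m x0 g E : nat) : 0 < m -> 0 < N ->
  m %| x0 ^ 2 + N -> 4 * N < E.+1 ^ 2 ->
  size [seq x : nat <- [seq x <- iota 0 m | m %| x ^ 2 + N] | gcdn `|x - x0|%N m == g] <= E.
Proof.
move=> m0 N0 hx0 hE; set s := [seq x <- _ | _ == g].
have us : uniq s by rewrite !filter_uniq // iota_uniq.
case es : s => [//|x1 s']; rewrite -es.
have facts x : x \in s -> [/\ x < m, g %| `|x - x0|%N, m %/ g %| x + x0 & g %| m].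
  rewrite !mem_filter mem_iota => /andP[/eqP hg /andP[hx /= xm]].
  have gm : g %| m by rewrite -hg dvdn_gcdr.
  split=> //; first by rewrite -hg dvdn_gcdl.
  have g0 : 0 < g by apply: dvdn_gt0 gm.
  have : m %| `|x - x0|%N * (x + x0).
    have -> : `|x - x0|%N * (x + x0) = absz ((x ^ 2 + N)%N%:Z - (x0 ^ 2 + N)%N%:Z)%R.
      rewrite -[x + x0]/(absz (x%:Z + x0%:Z)%R) -abszM; congr absz.
      by rewrite -!mulnn; lia.
    have : (m%:Z %| ((x ^ 2 + N)%N%:Z - (x0 ^ 2 + N)%N%:Z)%R)%Z by rewrite rpredB ?dvdzE.
    by rewrite dvdzE.
  have dg : g %| `|x - x0|%N by rewrite -hg dvdn_gcdl.
  rewrite -{1}(divnK gm) -(divnK dg) mulnAC dvdn_pmul2r // Gauss_dvdr //.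
  rewrite /coprime -(eqn_pmul2r g0) mul1n muln_gcdl !divnK // gcdnC.
  by rewrite hg.
pose h := m %/ g; pose e := gcdn g h.
have [x1m gx1 hx1 gm] : [/\ x1 < m, g %| `|x1 - x0|%N, h %| x1 + x0 & g %| m].
  by apply: facts; rewrite es mem_head.
have mE : g * h = m by rewrite /h mulnC divnK.
have g0 : 0 < g by apply: dvdn_gt0 gm.
have h0 : 0 < h by rewrite divn_gt0 // dvdn_leq.
have e0 : 0 < e by rewrite gcdn_gt0 g0.
have L0 : 0 < lcmn g h by rewrite lcmn_gt0 g0.
have ee : e ^ 2 %| 4 * N.
  have e2m : e ^ 2 %| m by rewrite -mE -mulnn dvdn_mul ?dvdn_gcdl ?dvdn_gcdr.
  have ex : e %| 2 * x0.
    have h1 : (e%:Z %| (x1%:Z + x0%:Z)%R)%Z by rewrite dvdzE; apply: dvdn_trans hx1; rewrite dvdn_gcdr.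
    have h2 : (e%:Z %| (x1%:Z - x0%:Z)%R)%Z by rewrite dvdzE; apply: dvdn_trans gx1; rewrite dvdn_gcdl.
    have := rpredB h1 h2; have -> : (x1%:Z + x0%:Z - (x1%:Z - x0%:Z) = (2 * x0)%N%:Z)%R by lia.
    by rewrite dvdzE.
  have : e ^ 2 %| 4 * (x0 ^ 2 + N) by apply: dvdn_mull; apply: dvdn_trans hx0.
  rewrite mulnDr dvdn_addr // -[4]/(2 ^ 2) -expnMn.
  by rewrite dvdn_exp2r.
have eE : e <= E.
  have := dvdn_leq _ ee; rewrite muln_gt0 N0 => /(_ isT) h4.
  by rewrite -ltnS -(ltn_exp2r _ _ (isT : 0 < 2)) (leq_ltn_trans h4).
apply: leq_trans eE; rewrite -(size_map (fun x => x %/ lcmn g h)) -[X in _ <= X](size_iota 0).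
have LE : lcmn g h * e = m by rewrite muln_lcm_gcd.
have sameres x : x \in s -> x = x1 %[mod lcmn g h].
  move=> /facts[xm gx hx _]; apply/eqP.
  have gg : (g%:Z %| (x%:Z - x1%:Z)%R)%Z.
    have -> : (x%:Z - x1%:Z = (x%:Z - x0%:Z) - (x1%:Z - x0%:Z))%R by lia.
    by rewrite rpredB // dvdzE.
  have hh : (h%:Z %| (x%:Z - x1%:Z)%R)%Z.
    have -> : (x%:Z - x1%:Z = (x%:Z + x0%:Z) - (x1%:Z + x0%:Z))%R by lia.
    by rewrite rpredB // dvdzE.
  have : ((lcmn g h)%:Z %| (x%:Z - x1%:Z)%R)%Z by rewrite dvdzE /= dvdn_lcm -!(dvdzE _%:Z) gg hh.
  by rewrite -eqz_mod_dvd !modz_nat eqz_nat.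
apply: uniq_leq_size.
  rewrite map_inj_in_uniq // => x y xs ys hxy.
  rewrite [LHS](divn_eq x (lcmn g h)) [RHS](divn_eq y (lcmn g h)) hxy.
  by rewrite (sameres _ xs) (sameres _ ys).
move=> y /mapP[x /facts[xm _ _ _] ->].
by rewrite mem_iota add0n /= ltn_divLR // mulnC LE.
Qed.

(** The condition is invariant under b -> b + 2a, which leads from 0 <= b < 2a to all residues
    modulo 4a. *)
Lemma sqrt_count_double N a :
  count (fun b => 4 * a %| b ^ 2 + N) (iota 0 (4 * a)) = (sqrt_count N a).*2.
Proof.
have -> : 4 * a = 2 * a + 2 * a by lia.
rewrite iotaD count_cat -addnn /sqrt_count; congr addn.
  by apply: eq_count => b; congr (_ %| _); lia.
rewrite add0n -[X in iota X]addn0 iotaDl count_map; apply: eq_count => b /=.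
have -> : (2 * a + b) ^ 2 + N = (a + b) * (4 * a) + (b ^ 2 + N) by rewrite -!mulnn; nia.
have -> : 2 * a + 2 * a = 4 * a by lia.
by rewrite dvdn_addr // dvdn_mull.
Qed.

(** The 2 r(a) roots modulo 4a are sorted by their gcd class relative to one root: there are at most
    2 sqrt(4a) classes, one per divisor of 4a, of size at most 2 sqrt N each. *)
Lemma sqrt_count_sqr_le N a : 0 < a -> 0 < N -> sqrt_count N a ^ 2 <= 16 * N * a.
Proof.
move=> a0 N0; pose m := 4 * a; have m0 : 0 < m by rewrite muln_gt0.
pose s := [seq x <- iota 0 m | m %| x ^ 2 + N].
have [E /andP[E1 E2]] := nat_sqrt_exists (4 * N).
have hs : size s <= size (divisors m) * E.
  case es : s => [//|x0 s']; rewrite -es.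
  have hx0 : m %| x0 ^ 2 + N.
    have : x0 \in s by rewrite es mem_head.
    by rewrite mem_filter => /andP[].
  apply: (@size_le_fibers _ _ (fun x : nat => gcdn `|x - x0|%N m)).
    by move=> x _; rewrite -dvdn_divisors // dvdn_gcdr.
  by move=> g; apply: sqrt_fiber_size.
move: hs; rewrite /s size_filter sqrt_count_double => hs.
have := size_divisors_sqr m0; move: hs E1.
set r := sqrt_count N a; set t := size _; rewrite /m -!mulnn -muln2 => h1 h2 h3.
have : (r * 2) * (r * 2) <= (t * t) * (E * E) by rewrite (mulnACA t t E E) leq_mul.
have : (t * t) * (E * E) <= (4 * (4 * a)) * (4 * N) by rewrite leq_mul.
lia.
Qed.

(** All b share the parity of N, so halving maps them injectively into 0 <= c < a. *)
Lemma sqrt_count_le N a : sqrt_count N a <= a.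
Proof.
rewrite /sqrt_count -size_filter -(size_map half) -[X in _ <= X](size_iota 0).
have par b : b \in [seq b <- iota 0 (2 * a) | 4 * a %| b ^ 2 + N] -> odd b = odd N /\ b < 2 * a.
  rewrite mem_filter mem_iota add0n /= => /andP[h ->]; split=> //.
  have : 2 %| b ^ 2 + N by apply: dvdn_trans h; apply: dvdn_mulr.
  by rewrite dvdn2 oddD oddX /= negb_add => /eqP.
apply: uniq_leq_size.
  rewrite map_inj_in_uniq ?filter_uniq ?iota_uniq // => b c /par[b1 _] /par[c1 _] h.
  by rewrite -(odd_double_half b) -(odd_double_half c) h b1 c1.
move=> y /mapP[b /par[_ hb] ->]; rewrite mem_iota add0n /=.
by rewrite ltn_half_double -mul2n.
Qed.

End RootCount.

(** * Elementary series bounds *)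

Section SumBounds.
Variable R : realType.
Local Open Scope fset_scope.
Local Open Scope ring_scope.

Lemma sums_le_support (g : nat -> R) M : (forall n, 0 <= g n) ->
  (forall n, (M <= n)%N -> g n = 0) -> sums_le g (\sum_(n < M) g n).
Proof.
move=> g0 gM A; rewrite -sum_fset_iota; set B := [fset i in iota 0 M].
rewrite (big_fset_incl _ (fsubsetUr A B)).
  by rewrite (big_fset_split _ (fsubsetUl A B)) lerDl sumr_ge0.
move=> n _; rewrite !inE mem_iota add0n /= -leqNgt; exact: gM.
Qed.

Lemma expR_partial_sum (x : R) n : 0 <= x -> \sum_(i < n) x ^+ i / i`!%:R <= expR x.
Proof.
move=> x0; have := nondecreasing_cvgn_le (u_ := series (exp_coeff x)).
rewrite /= => h; have : series (exp_coeff x) n <= limn (series (exp_coeff x)).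
  apply: h; last exact: is_cvg_series_exp_coeff.
  apply: nondecreasing_series => i _ _.
  by rewrite /exp_coeff /= divr_ge0 ?exprn_ge0.
by rewrite /series /= big_mkord.
Qed.

Lemma sums_le_even_exp (x : R) : 0 <= x ->
  sums_le (fun j => x ^+ (2 * j) / (2 * j)`!%:R) (expR x).
Proof.
move=> x0; apply: sums_le_nat => [j|n]; first by rewrite divr_ge0 ?exprn_ge0.
apply: le_trans (expR_partial_sum n.*2 x0).
elim: n => [|n IH]; first by rewrite !big_ord0.
rewrite doubleS [leRHS]big_ord_recr [X in _ <= X + _]big_ord_recr [leLHS]big_ord_recr /=.
rewrite -addrA; apply: lerD IH _; rewrite mul2n lerDl.
by rewrite divr_ge0 ?exprn_ge0.
Qed.

Lemma fact_prod n t : (n`! * \prod_(i < t) (n + i.+1) = (n + t)`!)%N.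
Proof.
elim: t => [|t IH]; first by rewrite addn0 big_ord0 muln1.
by rewrite big_ord_recr /= mulnA IH addnS factS mulnC.
Qed.

Lemma negbin_fact_le t j : (negbin t.+1 j * (2 * j)`! <= (2 * t.+1 + 2 * j).-1`!)%N.
Proof.
apply: leq_trans (_ : (2 * j + t)`! <= _)%N; last by apply: leq_fact; lia.
rewrite -fact_prod mulnC leq_mul2l; apply/orP; right.
apply: leq_trans (leq_pmulr _ (fact_gt0 t)) _; rewrite negbin_fact.
by apply: leq_prod => i _; rewrite leq_add2r; lia.
Qed.

Lemma exp_le_negbin n t : (n ^ t <= negbin t.+1 n * t`!)%N.
Proof.
rewrite negbin_fact -[t in X in (X <= _)%N]card_ord -prod_nat_const.
by apply: leq_prod => i _; lia.
Qed.

(* Telescoping: a^(-3/2) <= 2 / sqrt (a - 1) - 2 / sqrt a. *)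
Lemma inv_three_halves_le (m : R) : 0 < m ->
  ((m + 1) * Num.sqrt (m + 1))^-1 <= 2 / Num.sqrt m - 2 / Num.sqrt (m + 1).
Proof.
move=> m0; have m10 : 0 < m + 1 by lra.
have su : Num.sqrt m ^+ 2 = m by rewrite sqr_sqrtr // ltW.
have sv : Num.sqrt (m + 1) ^+ 2 = m + 1 by rewrite sqr_sqrtr // ltW.
have u0 : 0 < Num.sqrt m by rewrite sqrtr_gt0.
have v0 : 0 < Num.sqrt (m + 1) by rewrite sqrtr_gt0.
move: su sv u0 v0; set u := Num.sqrt m; set v := Num.sqrt (m + 1) => su sv u0 v0.
have uv : u < v by rewrite -(ltr_pXn2r (isT : (0 < 2)%N)) ?nnegrE ?ltW // su sv; lra.
have -> : 2 / u - 2 / v = 2 * (v - u) / (u * v) by field; rewrite !lt0r_neq0.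
rewrite -sv -[leLHS]mul1r ler_pdivrMr; last by rewrite mulr_gt0 // exprn_gt0.
rewrite mulrAC ler_pdivlMr ?mulr_gt0 // mul1r.
have e : (v - u) * (v + u) = 1 by rewrite -subr_sqr sv su; ring.
have h : 1 <= 2 * (v - u) * v.
  have : (v - u) * (v + u) <= (v - u) * (2 * v) by rewrite ler_pM2l ?subr_gt0 //; lra.
  lra.
have v2 : 0 < v ^+ 2 by rewrite exprn_gt0.
have uvv : u * v <= v ^+ 2 by rewrite expr2 ler_pM2r // ltW.
have := ler_wpM2r (ltW v2) h; rewrite mul1r => h2.
by apply: le_trans uvv _; apply: le_trans h2 _; rewrite -!mulrA.
Qed.

End SumBounds.

(** * Expansion of the sum over all forms *)

Section Weights.
Variables (R : realType) (k N : nat).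
Hypotheses (hk : (2 <= k)%N) (N0 : (0 < N)%N).

Definition good (a b : nat) : bool := (b < 2 * a)%N && (4 * a %| b ^ 2 + N)%N.

(* Here and below, the index a stands for the leading coefficient a + 1. *)
Definition weight (k : nat) (p : nat * nat) : R :=
  if good p.1.+1 p.2 then p.1.+1%:R ^- k else 0.

Lemma weight_ge0 l p : 0 <= weight l p.
Proof. by rewrite /weight; case: ifP => // _; rewrite invr_ge0 exprn_ge0. Qed.

Lemma weight_fiber l a : sums_le (fun b => weight l (a, b))
  ((sqrt_count N a.+1)%:R * a.+1%:R ^- l).
Proof.
have := @sums_le_support R (fun b => weight l (a, b)) (2 * a.+1) (fun b => weight_ge0 l (a, b)).
move=> h; have {h} : sums_le (fun b => weight l (a, b)) (\sum_(b < 2 * a.+1) weight l (a, nat_of_ord b)).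
  by apply: h => b hb; rewrite /weight /good /= ltnNge hb.
suff -> : \sum_(b < 2 * a.+1) weight l (a, nat_of_ord b) = (sqrt_count N a.+1)%:R * a.+1%:R ^- l by [].
rewrite /weight /good /=.
transitivity (\sum_(b < 2 * a.+1 | (4 * a.+1 %| b ^ 2 + N)%N) (a.+1%:R ^- l : R)).
  by rewrite [RHS]big_mkcond; apply: eq_bigr => -[b hb] _ /=; rewrite hb.
rewrite -(big_mkord (fun b => (4 * a.+1 %| b ^ 2 + N)%N) (fun=> a.+1%:R ^- l : R)).
by rewrite big_const_seq iter_addr_0 /index_iota subn0 mulr_natl.
Qed.

Lemma sqrt_count_real_le a : (0 < a)%N ->
  (sqrt_count N a)%:R <= 4 * Num.sqrt N%:R * Num.sqrt a%:R :> R.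
Proof.
move=> a0; rewrite -(ler_pXn2r (isT : (0 < 2)%N)) ?nnegrE ?mulr_ge0 ?sqrtr_ge0 //.
rewrite !exprMn !sqr_sqrtr // -natrX.
rewrite (_ : 4 ^+ 2 = 16%:R); last by rewrite -natrX.
by rewrite -!natrM ler_nat sqrt_count_sqr_le.
Qed.

(** Even for k = 2, r(a) <= 4 sqrt(N a) leaves a convergent a^(-3/2); the constant 3 is the first
    term plus a telescoping 2. *)
Lemma weight_sums : exists C, sums_le (weight k) C.
Proof.
pose s : R := 4 * Num.sqrt N%:R.
have s0 : 0 <= s by rewrite mulr_ge0 ?sqrtr_ge0.
pose h (a : nat) : R := s * (a.+1%:R * Num.sqrt a.+1%:R)^-1.
exists (s * 3); apply: (@sums_le_sigma _ _ _ _ h); first exact: weight_ge0.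
  move=> a A; apply: le_trans (weight_fiber k a A) _.
  have a0 : 0 < a.+1%:R :> R by rewrite ltr0n.
  apply: le_trans (_ : s * Num.sqrt a.+1%:R * a.+1%:R ^- 2 <= _).
    apply: ler_pM; rewrite ?invr_ge0 ?exprn_ge0 //; first exact: sqrt_count_real_le.
    by rewrite lef_pV2 ?posrE ?exprn_gt0 // ler_weXn2l // ler1n.
  rewrite /h -mulrA ler_wpM2l //.
  have : 0 < Num.sqrt a.+1%:R :> R by rewrite sqrtr_gt0.
  have : Num.sqrt a.+1%:R ^+ 2 = a.+1%:R :> R by rewrite sqr_sqrtr // ltW.
  move: (Num.sqrt _) => v <- v0.
  by rewrite le_eqVlt; apply/orP; left; apply/eqP; field; exact: lt0r_neq0.
apply: sums_leZ => //; apply: sums_le_nat => [a|n].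
  by rewrite invr_ge0 mulr_ge0 ?sqrtr_ge0.
case: n => [|n]; first by rewrite big_ord0.
suff : \sum_(i < n.+1) (i.+1%:R * Num.sqrt i.+1%:R)^-1 <= 3 - 2 / Num.sqrt n.+1%:R :> R.
  by move/le_trans; apply; rewrite lerBlDr lerDl divr_ge0 ?sqrtr_ge0.
elim: n => [|n IH]; first by rewrite big_ord_recl big_ord0 /= sqrtr1 mulr1 invr1; lra.
rewrite big_ord_recr /=; apply: le_trans (lerD IH (_ : _ <= 2 / Num.sqrt n.+1%:R - 2 / Num.sqrt n.+2%:R)) _.
  by have := @inv_three_halves_le R n.+1%:R (ltr0Sn _ _); rewrite natr1.
by rewrite addrA subrK.
Qed.

End Weights.

Section Expansion.
Variables (R : realType) (k N : nat) (chi : nat -> nat -> int).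
Hypotheses (hk : (2 <= k)%N) (N0 : (0 < N)%N).
Hypothesis chi_le1 : forall a b, `|chi a b| <= 1.

Definition cweight (p : nat * nat) : R[i] :=
  if good N p.1.+1 p.2 then (chi p.1 p.2)%:~R * p.1.+1%:R ^- k else 0.

Definition disc_ratio (a : nat) : R := N%:R / (4 * a.+1%:R ^+ 2).

Definition root_shift (p : nat * nat) : R := p.2%:R / (2 * p.1.+1%:R).

(* The term of the Bessel type series coming from the j-th power of N/4a^2. *)
Definition bessel_term (a j n : nat) : R :=
  (negbin k j)%:R * disc_ratio a ^+ j * (2 * pi) ^+ (2 * k + 2 * j) /
  ((2 * k + 2 * j).-1)`!%:R * n%:R ^+ (2 * k + 2 * j).-1.

Definition coef_term (n : nat) (p : nat * nat * nat) : R[i] :=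
  (-1) ^+ k * cweight p.1 * (bessel_term p.1.1 p.2 n)%:C *
  qpar (root_shift p.1)%:C ^+ n.

Lemma nc_cweight p : nc (cweight p) <= weight R N k p.
Proof.
rewrite /cweight /weight; case: ifP => _; last by rewrite nc0.
rewrite ncM ncV ncX nc_nat ler_piMl ?invr_ge0 ?exprn_ge0 //.
have -> : ((chi p.1 p.2)%:~R : R[i]) = ((chi p.1 p.2)%:~R)%:C by rewrite rmorph_int.
by rewrite nc_real -intr_norm -[1]/(1%:~R) ler_int.
Qed.

Lemma disc_ratio_ge0 a : 0 <= disc_ratio a.
Proof. by rewrite divr_ge0 ?mulr_ge0 ?exprn_ge0. Qed.

Lemma disc_ratio_le a : disc_ratio a <= disc_ratio 0.
Proof.
rewrite /disc_ratio expr1n mulr1 ler_wpM2l // lef_pV2 ?posrE ?mulr_gt0 ?exprn_gt0 //.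
by rewrite ler_peMr // exprn_ege1 // ler1n.
Qed.

Lemma bessel_term_ge0 a j n : 0 <= bessel_term a j n.
Proof.
by rewrite !mulr_ge0 ?invr_ge0 ?exprn_ge0 ?disc_ratio_ge0 ?mulr_ge0 // ltW // pi_gt0.
Qed.

Lemma bessel_term_le a j n : bessel_term a j n <= bessel_term 0 j n.
Proof.
rewrite /bessel_term; do 3 (apply: ler_wpM2r;
  first by rewrite ?invr_ge0 ?exprn_ge0 ?mulr_ge0 // ltW // pi_gt0).
by apply: ler_wpM2l => //; apply: lerXn2r; rewrite ?nnegrE ?disc_ratio_ge0 ?disc_ratio_le.
Qed.

Let Y : R := Num.sqrt N%:R / 2.

Lemma disc_ratio0 : disc_ratio 0 = Y ^+ 2.
Proof. by rewrite /disc_ratio /Y expr1n mulr1 expr_div_n sqr_sqrtr // -natrX. Qed.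

Let Y0 : 0 <= Y. Proof. by rewrite divr_ge0 ?sqrtr_ge0. Qed.

(** Comparison with the even part of the exponential series. The growth exp(2 pi n Y) with Y = sqrt
    N / 2 is what the condition Im z > Y compensates. *)
Lemma bessel_term_sums n :
  sums_le (fun j => bessel_term 0 j n) ((2 * pi * n%:R) ^+ (2 * k) * expR (2 * pi * n%:R * Y)).
Proof.
have p0 : 0 <= 2 * pi * n%:R :> R by rewrite !mulr_ge0 // ltW // pi_gt0.
have x0 : 0 <= 2 * pi * n%:R * Y by rewrite mulr_ge0.
apply: sums_le_mono (sums_leZ _ (sums_le_even_exp x0)); last by rewrite exprn_ge0.
move=> j; rewrite /bessel_term disc_ratio0.
have f0 : 0 < (2 * j)`!%:R :> R by rewrite ltr0n fact_gt0.
have g0 : 0 < ((2 * k + 2 * j).-1)`!%:R :> R by rewrite ltr0n fact_gt0.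
have nn : n%:R ^+ (2 * k + 2 * j).-1 <= n%:R ^+ (2 * k + 2 * j) :> R.
  rewrite -!natrX ler_nat; case: n {p0 x0} => [|n]; last by apply: leq_pexp2l => //; lia.
  by rewrite exp0n //; lia.
have hb : (negbin k j)%:R / ((2 * k + 2 * j).-1)`!%:R <= ((2 * j)`!%:R)^-1 :> R.
  rewrite ler_pdivrMr // mulrC ler_pdivlMr // -natrM ler_nat.
  by case: k hk => // t _; exact: negbin_fact_le.
apply: le_trans (_ : ((2 * j)`!%:R)^-1 * (Y ^+ 2) ^+ j * (2 * pi) ^+ (2 * k + 2 * j) * n%:R ^+ (2 * k + 2 * j) <= _).
  rewrite [leLHS](_ : _ = (negbin k j)%:R / ((2 * k + 2 * j).-1)`!%:R * (Y ^+ 2) ^+ j * (2 * pi) ^+ (2 * k + 2 * j) * n%:R ^+ (2 * k + 2 * j).-1); last by ring.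
  have pp : 0 <= (2 * pi) ^+ (2 * k + 2 * j) :> R by rewrite exprn_ge0 // mulr_ge0 // pi_ge0.
  have yy : 0 <= (Y ^+ 2) ^+ j by rewrite !exprn_ge0.
  apply: ler_pM => //; rewrite ?exprn_ge0 ?mulr_ge0 ?divr_ge0 //.
  by rewrite !ler_wpM2r.
by rewrite -exprM !exprMn !exprD; rewrite le_eqVlt; apply/orP; left; apply/eqP; ring.
Qed.

Lemma coef_term_le n p : nc (coef_term n p) <= weight R N k p.1 * bessel_term 0 p.2 n.
Proof.
rewrite /coef_term !ncM !ncX ncN nc1 expr1n mul1r nc_real.
rewrite (ger0_norm (bessel_term_ge0 _ _ _)) nc_qpar /= mulr0 oppr0 expR0 expr1n mulr1.
apply: ler_pM; rewrite ?nc_ge0 ?bessel_term_ge0 ?nc_cweight //.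
exact: bessel_term_le.
Qed.

Lemma coef_exists n : exists c, has_sum (coef_term n) c.
Proof.
have [C hC] := weight_sums R hk N0.
apply: has_sum_exists; apply: sums_le_mono (coef_term_le n) _.
apply: (sums_le_prod _ _ hC (bessel_term_sums n)) => [p|j].
  exact: weight_ge0.
exact: bessel_term_ge0.
Qed.

Section Point.
Variable z : R[i].
Hypothesis hz : Y < complex.Im z.
Let y := complex.Im z.
Let y0 : 0 < y. Proof. exact: le_lt_trans hz. Qed.
Let zeta (p : nat * nat) (m : int) : R[i] := z + (root_shift p)%:C + m%:~R.

Let ImZ p m : complex.Im (zeta p m) = y.
Proof.
rewrite /zeta; have -> : (m%:~R : R[i]) = (m%:~R)%:C by rewrite rmorph_int.
by rewrite /y; case: (z) => u v /=; rewrite !addr0.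
Qed.

Let ReZ p m : complex.Re (zeta p m) = (complex.Re z + root_shift p) + m%:~R.
Proof.
rewrite /zeta; have -> : (m%:~R : R[i]) = (m%:~R)%:C by rewrite rmorph_int.
by case: (z) => u v /=.
Qed.

Let zeta_ge p m : y <= nc (zeta p m).
Proof. by have := nc_geIm (zeta p m); rewrite ImZ ger0_norm // ltW. Qed.

Let zeta0 p m : zeta p m != 0.
Proof. by rewrite -nc_eq0 lt0r_neq0 // (lt_le_trans y0 (zeta_ge p m)). Qed.

Let rho : R := disc_ratio 0 / y ^+ 2.

Let rho01 : 0 <= rho < 1.
Proof.
rewrite divr_ge0 ?disc_ratio_ge0 ?exprn_ge0 ?(ltW y0) //=.
by rewrite ltr_pdivrMr ?exprn_gt0 // mul1r disc_ratio0 ltr_pXn2r ?nnegrE ?(ltW y0).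
Qed.

Let X : R := `|complex.Re z| + 1.
Let K : R := 2 + (2 * X ^+ 2 + 1) / y ^+ 2.

Let K0 : 0 < K.
Proof. by rewrite ltr_pwDl // divr_ge0 // ?sqr_ge0 // addr_ge0 // mulr_ge0 // sqr_ge0. Qed.

Definition lattice_term (p : nat * nat * nat * int) : R[i] :=
  cweight p.1.1 * (negbin k p.1.2)%:R * (- (disc_ratio p.1.1.1)%:C) ^+ p.1.2 *
  zeta p.1.1 p.2 ^- (2 * k + 2 * p.1.2).

Definition fourier_term (p : nat * nat * nat * nat) : R[i] :=
  coef_term p.2 p.1 * qpar z ^+ p.2.

Let shift_le p : good N p.1.+1 p.2 -> `|complex.Re z + root_shift p| <= X.
Proof.
move=> /andP[hp _]; apply: le_trans (ler_normD _ _) _; rewrite lerD2l /root_shift.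
rewrite ger0_norm ?divr_ge0 ?mulr_ge0 // ler_pdivrMr ?mulr_gt0 ?ltr0n // mul1r.
by rewrite -natrM ler_nat ltnW.
Qed.

Let zeta_inv_le p m : good N p.1.+1 p.2 ->
  nc (zeta p m) ^- (2 * k) <= K * (1 + m%:~R ^+ 2)^-1 * y ^- (2 * k - 2).
Proof.
move=> hp; have m0 : 0 < 1 + m%:~R ^+ 2 :> R by rewrite ltr_pwDl // sqr_ge0.
have -> : K * (1 + m%:~R ^+ 2)^-1 = ((1 + m%:~R ^+ 2) / K)^-1 by rewrite invf_div.
have -> : (2 * k = (2 * k - 2).+2)%N by lia.
rewrite !subSS subn0; apply: inv_exp_le => //; first exact: divr_gt0.
rewrite ler_pdivrMr // mulrC; apply: le_trans (shifted_sqr_ge m%:~R y0 (shift_le hp)) _.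
by rewrite -/K nc_sqr ReZ ImZ addrC.
Qed.

(** The power zeta^(-2j) is absorbed into [rho ^+ j], where rho < 1 expresses Im z > Y, and
    zeta^(-2k) supplies the decay in m; the majorant becomes a product over (a, b), j and m. *)
Let lattice_term_le p : nc (lattice_term p) <=
  weight R N k p.1.1 * ((negbin k p.1.2)%:R * rho ^+ p.1.2) *
  (K * y ^- (2 * k - 2) * (1 + p.2%:~R ^+ 2)^-1).
Proof.
case: p => [[[a b] j] m]; rewrite /lattice_term /=.
have [hg|hg] := boolP (good N a.+1 b); last first.
  rewrite /cweight /= (negPf hg) !mul0r nc0 !mulr_ge0 ?weight_ge0 ?invr_ge0 ?exprn_ge0 ?(ltW K0) ?(ltW y0) //.
    by case/andP: rho01.
  by rewrite addr_ge0 // sqr_ge0.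
rewrite !ncM nc_nat ncX ncN nc_real (ger0_norm (disc_ratio_ge0 _)) ncV ncX.
have cw := nc_cweight (a, b).
have zi := zeta_inv_le m (p := (a, b)) hg.
have v0 : 0 < nc (zeta (a, b) m) by apply: lt_le_trans (zeta_ge _ _).
rewrite exprD invfM.
have rj : disc_ratio a ^+ j * nc (zeta (a, b) m) ^- (2 * j) <= rho ^+ j.
  rewrite exprM -exprVn -exprMn; apply: lerXn2r; rewrite ?nnegrE.
  - by rewrite mulr_ge0 ?disc_ratio_ge0 ?invr_ge0 ?exprn_ge0 // ltW.
  - by case/andP: rho01.
  rewrite /rho; apply: ler_pM; rewrite ?disc_ratio_ge0 ?disc_ratio_le ?invr_ge0 ?exprn_ge0 ?(ltW v0) //.
  by rewrite lef_pV2 ?posrE ?exprn_gt0 //; apply: lerXn2r; rewrite ?nnegrE ?(ltW y0) ?(ltW v0) ?zeta_ge.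
rewrite [leLHS](_ : _ = nc (cweight (a, b)) * ((negbin k j)%:R * (disc_ratio a ^+ j * nc (zeta (a, b) m) ^- (2 * j))) * nc (zeta (a, b) m) ^- (2 * k)); last by ring.
have nv l : 0 <= nc (zeta (a, b) m) ^- l by rewrite invr_ge0 exprn_ge0 // ltW.
apply: ler_pM => //.
- by rewrite !mulr_ge0 ?nc_ge0 ?exprn_ge0 ?disc_ratio_ge0.
- apply: ler_pM => //; first by rewrite nc_ge0.
    by rewrite !mulr_ge0 ?exprn_ge0 ?disc_ratio_ge0.
  exact: ler_wpM2l.
by rewrite mulrAC.
Qed.

Let lattice_exists : exists S, has_sum lattice_term S.
Proof.
have [C hC] := weight_sums R hk N0.
apply: has_sum_exists; apply: sums_le_mono lattice_term_le _.
have M0 : 0 <= K * y ^- (2 * k - 2) by rewrite mulr_ge0 ?invr_ge0 ?exprn_ge0 ?ltW.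
have nb0 j : 0 <= (negbin k j)%:R * rho ^+ j by rewrite mulr_ge0 // exprn_ge0; case/andP: rho01.
have wn := sums_le_prod (@weight_ge0 R N k) nb0 hC (negbin_sums_le k rho01).
apply: (sums_le_prod _ _ wn (sums_leZ M0 (@sums_le_inv_sqr R))) => [p|m].
  by rewrite mulr_ge0 ?weight_ge0.
by rewrite mulr_ge0 // invr_ge0 addr_ge0 // sqr_ge0.
Qed.

Let fourier_exists : exists S, has_sum fourier_term S.
Proof.
have [C hC] := weight_sums R hk N0.
(* r is the quotient of |q| by the growth rate exp(-2 pi Y); the remaining power n^(2k) is dominated
   by a negative binomial coefficient. *)
pose r : R := expR (- (2 * pi * (y - Y))).
have r01 : 0 <= r < 1.
  by rewrite expR_ge0 /= -expR0 ltr_expR oppr_lt0 !mulr_gt0 ?pi_gt0 // subr_gt0.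
pose h (q : nat * nat) := bessel_term 0 q.2 q.1 * nc (qpar z) ^+ q.1.
have h0 q : 0 <= h q by rewrite mulr_ge0 ?bessel_term_ge0 ?exprn_ge0 ?nc_ge0.
have hs : sums_le h ((2 * pi) ^+ (2 * k) * (2 * k)`!%:R * (1 - r) ^- (2 * k).+1).
  have c0 : 0 <= (2 * pi) ^+ (2 * k) * (2 * k)`!%:R :> R by rewrite mulr_ge0 ?exprn_ge0 // mulr_ge0 // pi_ge0.
  apply: (sums_le_sigma h0 _ (sums_leZ c0 (negbin_sums_le (2 * k).+1 r01))) => n A.
  rewrite /h /= -mulr_suml.
  have := ler_wpM2r (exprn_ge0 n (nc_ge0 (qpar z))) (bessel_term_sums n A).
  have e : expR (2 * pi * n%:R * Y) * expR (- (2 * pi * complex.Im z)) ^+ n = r ^+ n.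
    by rewrite /r -!expRM_natl -expRD; congr expR; rewrite /y; ring.
  move/le_trans; apply; rewrite nc_qpar -(mulrA ((2 * pi * n%:R) ^+ (2 * k))) e exprMn -!mulrA ler_wpM2l ?exprn_ge0 ?mulr_ge0 ?pi_ge0 //.
  rewrite mulrA ler_wpM2r ?exprn_ge0 ?expR_ge0 // mulrC -natrM -natrX ler_nat.
  exact: exp_le_negbin.
have wh := sums_le_prod (@weight_ge0 R N k) h0 hC hs.
pose re (p : nat * nat * nat * nat) := (p.1.1, (p.2, p.1.2)).
have rei : injective re by move=> [[[? ?] ?] ?] [[[? ?] ?] ?] [-> -> -> ->].
apply: has_sum_exists; apply: sums_le_mono (sums_le_inj rei wh) => p.
rewrite /fourier_term ncM ncX /re /h /= mulrA ler_wpM2r ?exprn_ge0 ?nc_ge0 //.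
exact: coef_term_le.
Qed.

Definition theta_term (p : nat * nat * int) : R[i] :=
  if good N p.1.1.+1 p.1.2 then (chi p.1.1 p.1.2)%:~R *
    (p.1.1.+1%:R * (zeta p.1 p.2 ^+ 2 + (disc_ratio p.1.1)%:C)) ^- k
  else 0.

(** The negative binomial series at u = -(N/4a^2) / zeta^2, of modulus below 1 since |zeta| >= Im z
    > Y. *)
Let sum_over_j p m : has_sum (fun j => lattice_term ((p, j), m)) (theta_term (p, m)).
Proof.
rewrite /lattice_term /theta_term /cweight /=; case: ifP => hg; last first.
  by have := has_sumZ 0 (@negbin_has_sum R 0 k ltac:(rewrite nc0; exact: ltr01));
     rewrite mul0r; apply: has_sum_ext => j; rewrite !mul0r.
set u := - (disc_ratio p.1)%:C / zeta p m ^+ 2.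
have v0 : 0 < nc (zeta p m) by apply: lt_le_trans (zeta_ge _ _).
have u1 : nc u < 1.
  rewrite /u ncM ncN nc_real (ger0_norm (disc_ratio_ge0 _)) ncV ncX.
  rewrite ltr_pdivrMr ?exprn_gt0 // mul1r; apply: le_lt_trans (disc_ratio_le _) _.
  rewrite disc_ratio0 ltr_pXn2r ?nnegrE ?(ltW v0) //.
  exact: lt_le_trans hz (zeta_ge _ _).
have := has_sumZ ((chi p.1 p.2)%:~R * p.1.+1%:R ^- k * zeta p m ^- (2 * k)) (negbin_has_sum k u1).
have z2 : zeta p m ^+ 2 != 0 by rewrite expf_neq0 // zeta0.
rewrite (_ : _ * _ * _ * _ = (chi p.1 p.2)%:~R * (p.1.+1%:R * (zeta p m ^+ 2 + (disc_ratio p.1)%:C)) ^- k).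
  apply: has_sum_ext => j; rewrite /u exprMn exprVn -exprM exprD invfM; ring.
rewrite -!mulrA; congr (_ * _); rewrite exprMn invfM; congr (_ * _).
rewrite exprM -invfM -exprMn; congr (_ ^- _).
by rewrite mulrBr mulr1 mulrC divfK // opprK.
Qed.

(** The Lipschitz formula with exponent 2k + 2j. Its constant has sign (-1)^(k+j), and the binomial
    series contributes (-1)^j, leaving the (-1)^k of [coef_term]. *)
Let sum_over_m q : exists F, has_sum (fun m => lattice_term (q, m)) F /\
  has_sum (fun n => fourier_term (q, n)) F.
Proof.
case: q => [p j]; rewrite /lattice_term /fourier_term /coef_term /=.
have y0' : 0 < complex.Im (z + (root_shift p)%:C).
  by move: y0; rewrite /y; case: (z) => u v /=; rewrite addr0.
pose t := (2 * k + 2 * j - 2)%N.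
have te : (2 * k + 2 * j = t.+2)%N by rewrite /t; lia.
have [S [h1 h2]] := lipschitz_formula t y0'.
pose c := cweight p * (negbin k j)%:R * (- (disc_ratio p.1)%:C) ^+ j.
exists (c * S); split.
  by apply: has_sum_ext (has_sumZ c h1) => m; rewrite te.
apply: has_sum_ext (has_sumZ c h2) => n; rewrite qparD exprMn /bessel_term te /=.
have -> : ((-1) ^+ k : R[i]) = (-1) ^+ (k + j) * (-1) ^+ j.
  by rewrite exprD -mulrA -exprMn mulrNN mulr1 expr1n mulr1.
have -> : (- ((2 * pi)%:C * 'i)) ^+ t.+2 = (-1) ^+ (k + j) * (2 * pi)%:C ^+ t.+2 :> R[i].
  have e2 : (- ((2 * pi)%:C * 'i)) ^+ 2 = - ((2 * pi)%:C ^+ 2) :> R[i].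
    by rewrite sqrrN exprMn sqr_i mulrN1.
  by rewrite -te -mulnDr [LHS]exprM e2 [LHS]exprNn -exprM.
have bE (A P F G : R) (b : nat) : (b%:R * A * P / F * G)%:C = b%:R * A%:C * P%:C / F%:C * G%:C :> R[i].
  by rewrite !rmorphM fmorphV rmorph_nat.
rewrite bE /c (exprNn (disc_ratio p.1)%:C) [(disc_ratio p.1 ^+ j)%:C]rmorphXn /= [((2 * pi) ^+ t.+2)%:C]rmorphXn /=.
by rewrite [(n%:R ^+ t.+1)%:C]rmorphXn /= !rmorph_nat; ring.
Qed.

(** The lattice and Fourier families have the same partial sums F over m and over n, hence the same
    total. Regrouped over j, the first gives the terms of the forms; regrouped over (a, b, j), the
    second gives c(n) q^n. *)
Lemma theta_expansion (c : nat -> R[i]) : (forall n, has_sum (coef_term n) (c n)) ->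
  exists S, has_sum theta_term S /\ has_sum (fun n => c n * qpar z ^+ n) S.
Proof.
move=> hc; have [S1 h1] := lattice_exists; have [S2 h2] := fourier_exists.
have [F /all_and2[F1 F2]] := choice sum_over_m.
have e : S1 = S2.
  exact: has_sum_unique (has_sum_fubini h1 F1) (has_sum_fubini h2 F2).
exists S1; split.
  pose re (x : nat * nat * int * nat) : nat * nat * nat * int := ((x.1.1, x.2), x.1.2).
  have rei : injective re by move=> [[? ?] ?] [[? ?] ?] [-> -> ->].
  have h1' : has_sum (lattice_term \o re) S1.
    apply: has_sum_inj rei _ h1 => -[[p j] m] h.
    by have := h ((p, m), j); rewrite eqxx.
  by apply: (has_sum_fubini h1') => -[p m]; exact: sum_over_j.
rewrite e; pose re (x : nat * (nat * nat * nat)) : nat * nat * nat * nat := (x.2, x.1).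
have rei : injective re by move=> [? ?] [? ?] [-> ->].
have h2' : has_sum (fourier_term \o re) S2.
  apply: has_sum_inj rei _ h2 => -[p n] h.
  by have := h (n, p); rewrite eqxx.
apply: (has_sum_fubini h2') => n; rewrite mulrC.
by apply: has_sum_ext (has_sumZ (qpar z ^+ n) (hc n)) => p; rewrite mulrC.
Qed.

End Point.
End Expansion.

(* Library limits and uniqueness of q-expansions *)
#[local] Existing Instance summability.totally_filter.

Section LibraryTopology.
Variable R : realType.

Lemma complex_pos (e : R[i]) : 0 < e -> exists2 r : R, 0 < r & e = r%:C.
Proof.
by case: e => a b; rewrite ltcE /= => /andP[/eqP b0 a0]; exists a; rewrite // b0.
Qed.

Lemma sum_has_sum (I : choiceType) (f : I -> R[i]) (S : R[i]) :
  has_sum f S -> summability.sum f = S :> R[i].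
Proof.
move=> h; apply: (@cvg_lim _ _ _ _ (summability.totally_filter)); first exact: norm_hausdorff.
apply/cvgrPdist_lt => _ /complex_pos[e e0 ->]; have [A hA] := h e e0.
exists A => //= B AB; rewrite -normrN opprB ncE ltcR.
have := hA B AB; congr (nc (_ - _) < _).
by rewrite /summability.partial_sum -(big_seq_fsetE _ _ predT).
Qed.

Lemma ctends_cvg (u : nat -> R[i]) (l : R[i]) : ctends u l -> (u @ \oo --> l)%classic.
Proof.
move=> h; apply/cvgrPdist_lt => _ /complex_pos[e e0 ->]; have [n hn] := h e e0.
by exists n => //= m nm; rewrite -normrN opprB ncE ltcR hn.
Qed.

Lemma cvg_ctends (u : nat -> R[i]) (l : R[i]) : (u @ \oo --> l)%classic -> ctends u l.
Proof.
move=> /cvgrPdist_lt h e e0; have : 0 < e%:C by rewrite ltcR.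
move=> /h [n _ hn]; exists n => m nm; have := hn m nm.
by rewrite /= -normrN opprB ncE ltcR.
Qed.

Lemma has_sum_qexpansion (c : nat -> R[i]) (q S : R[i]) : c 0%N = 0 ->
  has_sum (fun n => c n * q ^+ n) S ->
  ((fun N : nat => \sum_(1 <= n < N) c n * q ^+ n) @ \oo --> S)%classic.
Proof.
move=> c0 h; apply: ctends_cvg => e e0; have [n hn] := has_sum_nat h e0.
exists n.+1 => -[//|m]; rewrite ltnS => nm; have := hn m.+1 (leqW nm).
by rewrite -(big_mkord predT (fun n => c n * q ^+ n)) big_ltn // c0 mul0r add0r.
Qed.

Lemma qpar_imag_exists (y r : R) : 0 < r < 1 -> exists2 t : R, 0 < t &
  forall z : R[i], qpar (z + 'i * t%:C) = qpar z * r%:C.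
Proof.
move=> /andP[r0 r1]; have p2 : 0 < 2 * pi :> R by rewrite mulr_gt0 // pi_gt0.
exists (- ln r / (2 * pi)).
  by rewrite divr_gt0 // oppr_gt0 ln_lt0 // r0.
move=> z; rewrite qparD; congr (_ * _).
rewrite /qpar /cexp /=.
rewrite !(mulr0, mul0r, mulr1, mul1r, addr0, subr0, oppr0, add0r, sub0r) cos0 sin0.
have -> : - (2 * pi * (- ln r / (2 * pi))) = ln r.
  by rewrite mulrC divfK ?opprK // lt0r_neq0.
rewrite lnK ?posrE //; apply/eqP; rewrite eq_complex /=.
by apply/andP; split; apply/eqP; ring.
Qed.

(** Identity theorem by the lowest coefficient: the terms at one point q0 are bounded by M, and at r
    q0 the n-th term must cancel a tail of size 2 M r^(n+1), so |e_n q0^n| <= 2 M r with r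
    arbitrarily small. *)
Lemma power_series_zero (e : nat -> R[i]) (y0 : R) :
  (forall z : R[i], y0 < complex.Im z ->
     ctends (fun N => \sum_(1 <= n < N) e n * qpar z ^+ n) 0) ->
  forall n, (1 <= n)%N -> e n = 0.
Proof.
move=> h; pose z0 : R[i] := 0 +i* (`|y0| + 1).
have hz0 : y0 < complex.Im z0 by rewrite /= ltr_pwDr // ler_norm.
pose q0 := qpar z0; have q00 : q0 != 0 by exact: qpar_neq0.
pose s z N := \sum_(1 <= n < N) e n * qpar z ^+ n.
have [M M0 hM] : exists2 M : R, 0 < M & forall m, (1 <= m)%N -> nc (e m * q0 ^+ m) <= M.
  have [N0 hN] := h z0 hz0 1 ltr01.
  have sum0 : 0 <= \sum_(m < N0) nc (e m * q0 ^+ m) by apply: sumr_ge0 => m _; exact: nc_ge0.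
  exists (2 + \sum_(m < N0) nc (e m * q0 ^+ m)) => [|m m1]; first by lra.
  have [mN|mN] := ltnP m N0.
    rewrite (bigD1 (Ordinal mN)) //= addrCA lerDl addr_ge0 //.
    by apply: sumr_ge0 => i _; exact: nc_ge0.
  have := hN m mN; have := hN m.+1 (leqW mN); rewrite !subr0 big_nat_recr //=.
  set a := \sum_(1 <= _ < _) _; set b := e m * _ => h1 h2.
  have -> : b = (a + b) - a by ring.
  by apply: le_trans (ncB _ _) _; lra.
elim/ltn_ind => n IH n1; apply/eqP.
suff : e n * q0 ^+ n == 0 by rewrite mulf_eq0 expf_eq0 (negPf q00) andbF orbF.
apply/eqP/nc_small => eps eps0.
(* r <= 1/2 bounds the geometric tail by twice its first term; the second entry gives 2 M r <=
   eps. *)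
pose r : R := Num.min (1 / 2) (eps / (2 * M)).
have r0 : 0 < r by rewrite lt_min !divr_gt0 // mulr_gt0.
have r2 : r <= 1 / 2 by rewrite ge_min lexx.
have rM : r * (2 * M) <= eps by rewrite -ler_pdivlMr ?mulr_gt0 // ge_min lexx orbT.
have [|t t0 ht] := @qpar_imag_exists y0 r; first by apply/andP; split => //; lra.
pose w := z0 + 'i * t%:C.
have hw : y0 < complex.Im w.
  by rewrite /w /=; apply: lt_trans hz0 _; rewrite /= !(mul0r, mulr0, mul1r, addr0, add0r) ltrDl.
have tail N : nc (\sum_(n.+1 <= m < N) e m * qpar w ^+ m) <= 2 * M * r ^+ n.+1.
  apply: le_trans (nc_sum _ _ _) _.
  apply: le_trans (_ : \sum_(n.+1 <= m < N) M * r ^+ m <= _).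
    rewrite big_nat_cond [leRHS]big_nat_cond; apply: ler_sum => m /andP[/andP[nm _] _].
    rewrite /w ht exprMn mulrA ncM ncX nc_real (ger0_norm (ltW r0)).
    by rewrite ler_wpM2r ?exprn_ge0 ?(ltW r0) // hM // (leq_trans _ nm).
  rewrite -mulr_sumr [2 * M]mulrC -mulrA ler_wpM2l ?(ltW M0) //.
  have [Nn|nN] := leqP N n.+1.
    by rewrite big_geq // mulr_ge0 // exprn_ge0 // ltW.
  suff : \sum_(n.+1 <= m < N) r ^+ m <= 2 * r ^+ n.+1 - 2 * r ^+ N.
    by move/le_trans; apply; rewrite gerBl mulr_ge0 // exprn_ge0 // ltW.
  elim: N {nN} (ltnW nN) => // N IHN; rewrite leq_eqVlt => /orP[/eqP<-|].
    by rewrite big_geq // subrr.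
  rewrite ltnS => nN; rewrite big_nat_recr //=.
  apply: le_trans (lerD (IHN nN) (lexx _)) _.
  have : r ^+ N.+1 <= r ^+ N / 2.
    by rewrite exprSr ler_wpM2l ?exprn_ge0 ?(ltW r0) // -[_^-1]mul1r.
  lra.
have main : nc (e n * qpar w ^+ n) <= 2 * M * r ^+ n.+1.
  apply/ler_addgt0Pr => d /(h w hw)[N0 hN].
  have := hN (maxn N0 n.+1) (leq_maxl _ _); rewrite subr0.
  have nl : (n < maxn N0 n.+1)%N by rewrite leq_maxr.
  rewrite (big_cat_nat (n := n)) ?(ltnW nl) //= big_nat_cond big1 ?add0r; last first.
    by move=> m /andP[/andP[m1 mn] _]; rewrite IH // mul0r.
  rewrite big_ltn //; set a := e n * _; set b := \sum_(_ <= _ < _) _ => hab.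
  have -> : a = (a + b) - b by ring.
  apply: le_trans (ncB _ _) _; rewrite addrC; apply: lerD; [exact: tail|exact: ltW].
apply: le_trans rM; rewrite -(ler_pM2r (exprn_gt0 n r0)).
have : nc (e n * qpar w ^+ n) = nc (e n * q0 ^+ n) * r ^+ n.
  by rewrite /w ht exprMn mulrA ncM [nc (r%:C ^+ n)]ncX nc_real (ger0_norm (ltW r0)).
by move=> <-; apply: le_trans main _; rewrite exprS mulrCA mulrA.
Qed.

Lemma qexpansion_unique (y0 : R) (f : R[i] -> R[i]) (c c' : nat -> R[i]) :
  is_qexpansion y0 f c -> is_qexpansion y0 f c' ->
  forall n, (1 <= n)%N -> c n = c' n.
Proof.
move=> h h' n n1; apply/eqP; rewrite -subr_eq0; apply/eqP.
apply: (@power_series_zero (fun n => c n - c' n) y0) n1 => z hz.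
have := ctendsD (cvg_ctends (h z hz)) (ctendsM (ctends_cst (-1)) (cvg_ctends (h' z hz))).
rewrite mulN1r subrr; apply: ctends_ext => N.
by rewrite mulN1r -sumrB; apply: eq_bigr => m _; rewrite mulrBl.
Qed.

Lemma qcoef_eq (y0 : R) (f : R[i] -> R[i]) (c : nat -> R[i]) :
  is_qexpansion y0 f c -> forall n, (1 <= n)%N -> qcoef y0 f n = c n.
Proof.
move=> h; apply: (@qexpansion_unique y0 f) => //; rewrite /qcoef.
by have := @xgetPex _ (fun=> 0) [set c | is_qexpansion y0 f c]%classic (ex_intro _ c h).
Qed.

End LibraryTopology.

(** * Parametrization of the forms of discriminant -N *)

Section FormsAndLattice.
Variables (R : realType) (k : nat) (D : int) (N : nat).
Hypotheses (hk : (2 <= k)%N) (N0 : (0 < N)%N).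

(** The division is exact for the pairs accepted by [good]. *)
Definition lattice_char (a b : nat) : int :=
  genus_char D (a.+1%:Z, b%:Z, ((b ^ 2 + N) %/ (4 * a.+1))%N%:Z).

Lemma lattice_char_le1 a b : `|lattice_char a b| <= 1.
Proof. exact: genus_char_le1. Qed.

Definition form_index (Q : Defs.form) : nat * nat * int :=
  let: (a, b, c) := Q in
  ((`|a|%N.-1, absz (b %% (2 * a))%Z), (b %/ (2 * a))%Z).

Lemma posdef_leading (a b c : int) : posdef (a, b, c) -> 0 < a.
Proof. by move=> /(_ 1 0 isT); rewrite /form_eval /= !intz; congr (_ < _); ring. Qed.

Lemma posdefP (a b c : int) : 0 < a -> form_disc (a, b, c) = - N%:Z -> posdef (a, b, c).
Proof.
rewrite /form_disc => a0 hd x y xy; rewrite /form_eval !intz.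
have e : 4 * a * (a * x ^+ 2 + b * x * y + c * y ^+ 2) = (2 * a * x + b * y) ^+ 2 + N%:Z * y ^+ 2.
  have -> : N%:Z = 4 * a * c - b ^+ 2 by rewrite -[N%:Z]opprK -hd; ring.
  by ring.
have a4 : 0 < 4 * a by rewrite mulr_gt0.
rewrite -(pmulr_rgt0 _ a4) e; have [y0|y0] := eqVneq y 0.
  move: xy; rewrite y0 expr0n /= !mulr0 !addr0 => xy.
  rewrite exprn_even_gt0 //= !mulf_neq0 //; first exact: lt0r_neq0.
  by apply: contra xy => /eqP ->.
by rewrite ltr_wpDl ?sqr_ge0 // mulr_gt0 // exprn_even_gt0.
Qed.

(* [form_index] sends [a, b, c] to ((a', b'), m) with a = a' + 1, b = b' + 2 a m
   and 0 <= b' < 2 a. *)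
Lemma form_indexP (a b c : int) : posdef (a, b, c) -> form_disc (a, b, c) = - N%:Z ->
  exists a' b' m, [/\ form_index (a, b, c) = ((a', b'), m), a = a'.+1%:Z,
    b = b'%:Z + 2 * a'.+1%:Z * m, good N a'.+1 b' &
    c = a'.+1%:Z * m ^+ 2 + b'%:Z * m + ((b' ^ 2 + N) %/ (4 * a'.+1))%N%:Z].
Proof.
move=> pd hd; have a0 := posdef_leading pd.
exists `|a|%N.-1, (absz (b %% (2 * a))%Z), (b %/ (2 * a))%Z.
have aE : a = (`|a|%N.-1).+1%:Z by lia.
have a2 : 2 * a != 0 by lia.
have m0 := modz_ge0 b a2; have ml := ltz_pmod b (_ : 0 < 2 * a).
have {}ml : (b %% (2 * a))%Z < 2 * a by apply: ml; lia.
have bE := divz_eq b (2 * a).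
have rE : (b %% (2 * a))%Z = (absz (b %% (2 * a))%Z)%:Z by lia.
move: ml bE rE m0; set r := absz _; set m := (b %/ _)%Z; set a' := `|a|%N.-1 in aE *.
move=> ml bE rE m0.
have bE' : b = r%:Z + 2 * a'.+1%:Z * m by rewrite bE rE -aE; ring.
pose c0 := c - a'.+1%:Z * m ^+ 2 - r%:Z * m.
have hc0 : ((r ^ 2 + N)%N%:Z = 4 * a'.+1%:Z * c0)%R.
  rewrite PoszD -mulnn PoszM (_ : N%:Z = 4 * a * c - b ^+ 2); last first.
    by rewrite -[N%:Z]opprK -hd /form_disc; ring.
  by rewrite /c0 aE bE'; ring.
have c0_ge0 : 0 <= c0.
  have a4 : 0 < 4 * a'.+1%:Z by [].
  by rewrite -(pmulr_rge0 _ a4) -hc0.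
have c0E : c0 = (`|c0|%N)%:Z by lia.
have hn : (r ^ 2 + N = `|c0| * (4 * a'.+1))%N by move: hc0; rewrite c0E; lia.
have q : ((r ^ 2 + N) %/ (4 * a'.+1) = `|c0|)%N by rewrite hn mulnK.
split=> //.
- rewrite /good hn dvdn_mull // andbT.
  by move: ml; rewrite rE aE; lia.
- by rewrite q -c0E /c0; ring.
Qed.

Lemma form_mem (Q : posdef_forms (- N%:Z)) : posdef_forms (- N%:Z) (set_val Q).
Proof. by rewrite set_valE; exact: set_mem (valP Q). Qed.

Lemma theta_form (z : R[i]) (Q : posdef_forms (- N%:Z)) :
  theta_term k N lattice_char z (form_index (set_val Q)) =
  (genus_char D (set_val Q))%:~R * form_eval (set_val Q) z 1 ^- k.
Proof.
move: (form_mem Q); move: (set_val Q) => [[a b] c] [pd hd].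
have [a' [b' [m [-> aE bE hg cE]]]] := form_indexP pd hd.
rewrite /theta_term /= hg; congr (_%:~R * _ ^- k).
  rewrite /lattice_char -(genus_char_translate D _ _ _ m) aE bE cE.
  by congr (genus_char D (_, _, _)).
have hN : (N%:R : R[i]) = 4 * a%:~R * c%:~R - b%:~R ^+ 2.
  rewrite -[N%:R]/((N%:Z)%:~R) -[N%:Z]opprK -hd /form_disc.
  by rewrite !(rmorphN, rmorphB, rmorphM, rmorphXn) /=; ring.
rewrite /root_shift /disc_ratio /= !(rmorphM, rmorphXn, fmorphV, rmorph_nat) /= hN.
have a0 : (a%:~R : R[i]) != 0 by rewrite aE pnatr_eq0.
have -> : (a'.+1%:R : R[i]) = a%:~R by rewrite aE.
have -> : (b'%:R : R[i]) = b%:~R - 2 * a%:~R * m%:~R.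
  by rewrite -[b'%:R]/((b'%:Z)%:~R) -[b'%:Z](addrK (2 * a'.+1%:Z * m)) -bE aE !(rmorphB, rmorphM).
by field.
Qed.

Lemma form_index_inj : injective (fun Q : posdef_forms (- N%:Z) => form_index (set_val Q)).
Proof.
move=> Q Q2 h; apply: val_inj; rewrite -set_valE; move: h (form_mem Q) (form_mem Q2).
move: (set_val Q) (set_val Q2) => [[a b] c] [[a2 b2] c2] h [pd hd] [pd2 hd2].
have [a' [b' [m [e1 aE bE _ cE]]]] := form_indexP pd hd.
have [a'2 [b'2 [m2 [e2 aE2 bE2 _ cE2]]]] := form_indexP pd2 hd2.
move: h; rewrite e1 e2 => -[ha hb hm].
by rewrite aE bE cE aE2 bE2 cE2 ha hb hm.
Qed.

(** A good triple is the index of an explicit form, so the indices outside the image have a zero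
    term by definition. *)
Lemma theta_outside (z : R[i]) p :
  (forall Q : posdef_forms (- N%:Z), form_index (set_val Q) != p) ->
  theta_term k N lattice_char z p = 0.
Proof.
case: p => [[a' b'] m] h; rewrite /theta_term /=; case: ifP => // hg; exfalso.
have /andP[hb /dvdnP[c0 hc0]] := hg.
pose Q : Defs.form := (a'.+1%:Z, b'%:Z + 2 * a'.+1%:Z * m, a'.+1%:Z * m ^+ 2 + b'%:Z * m + c0%:Z).
have hd : form_disc Q = - N%:Z.
  rewrite /Q /form_disc; have : ((b' ^ 2 + N)%N%:Z = (c0 * (4 * a'.+1))%N%:Z)%R by rewrite hc0.
  rewrite -mulnn PoszD !PoszM => e.
  have -> : N%:Z = c0%:Z * (4 * a'.+1%:Z) - b'%:Z * b'%:Z by rewrite -e; ring.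
  by ring.
have hQ : posdef_forms (- N%:Z) Q by split=> //; apply: posdefP hd.
have := h (exist _ Q (mem_set hQ)); rewrite set_valE /=.
case/negP; apply/eqP.
have a0 : 2 * a'.+1%:Z != 0 by lia.
congr ((_, _), _).
- rewrite addrC mulrC modzMDl modz_small; first by [].
  by apply/andP; split; lia.
- rewrite addrC mulrC divzMDl // divz_small ?addr0 //.
Qed.

Lemma theta_sum (z S : R[i]) : has_sum (theta_term k N lattice_char z) S ->
  summability.sum (fun Q : posdef_forms (- N%:Z) =>
    (genus_char D (set_val Q))%:~R * form_eval (set_val Q) z 1 ^- k) = S.
Proof.
move=> h; apply: sum_has_sum.
have := has_sum_inj form_index_inj (@theta_outside z) h.
by apply: has_sum_ext => Q; exact: theta_form.
Qed.

End FormsAndLattice.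

(** * Dominance of the forms with leading coefficient 1 *)

Section TailWeights.
Variables (R : realType) (N : nat).
Hypothesis N3 : (3 <= N)%N.

Let N0 : (0 < N)%N. Proof. exact: leq_trans N3. Qed.

(** Index 0 is leading coefficient 1, the part to be dominated against. *)
Definition tail_weight (l : nat) (p : nat * nat) : R :=
  if p.1 == 0%N then 0 else weight R N l p.

Lemma tail_weight_ge0 l p : 0 <= tail_weight l p.
Proof. by rewrite /tail_weight; case: ifP => // _; exact: weight_ge0. Qed.

Lemma tail_weight_sums l (u : nat -> R) C : (forall a, 0 <= u a) ->
  (forall a, (0 < a)%N -> (sqrt_count N a.+1)%:R * a.+1%:R ^- l <= u a) ->
  (forall n, \sum_(a < n) (if a == 0%N :> nat then 0 else u a) <= C) ->
  sums_le (tail_weight l) C.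
Proof.
move=> u0 hu hC; pose h a : R := if a == 0%N then 0 else u a.
have h0 a : 0 <= h a by rewrite /h; case: ifP.
apply: (@sums_le_sigma _ _ _ _ h); first exact: tail_weight_ge0.
  move=> a A; rewrite /tail_weight /h /=; case: eqP => [_|/eqP a0].
    by rewrite big1.
  by apply: le_trans (weight_fiber R N l a A) _; apply: hu; rewrite lt0n.
exact: sums_le_nat.
Qed.

Lemma sum_inv_sqr_le n :
  \sum_(a < n) (if a == 0%N :> nat then 0 else a.+1%:R ^- 2) <= 3 / 4 :> R.
Proof.
case: n => [|[|n]]; first by rewrite big_ord0; lra.
  by rewrite big_ord_recl big_ord0 /=; lra.
(* The term 1/4 of a = 2 is kept, and from a = 3 on 1/a^2 <= 1/(a - 1) - 1/a telescopes to 1/2. *)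
suff : \sum_(a < n.+2) (if a == 0%N :> nat then 0 else a.+1%:R ^- 2) <= 3 / 4 - n.+2%:R^-1 :> R.
  by move/le_trans; apply; rewrite lerBlDr lerDl invr_ge0.
elim: n => [|n IH].
  rewrite !big_ord_recl big_ord0 /= /bump /=.
  by rewrite (_ : 2 ^- 2 = 1 / 4 :> R); [lra|field].
rewrite big_ord_recr /=; apply: le_trans (lerD IH (lexx _)) _.
have x0 : 2 <= n.+2%:R :> R by rewrite ler_nat.
rewrite -[n.+3]addn1 natrD; move: x0; set x : R := n.+2%:R => x0.
have x1 : 0 < x by lra. have x2 : 0 < x + 1 by lra.
have : (x + 1) ^- 2 <= x^-1 - (x + 1)^-1.
  have -> : x^-1 - (x + 1)^-1 = (x * (x + 1))^-1 by field; rewrite !lt0r_neq0.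
  rewrite lef_pV2 ?posrE ?exprn_gt0 ?mulr_gt0 // expr2 ler_pM2r //; lra.
by move: ((x + 1) ^- 2) (x^-1) ((x + 1)^-1) => ? ? ?; lra.
Qed.

Lemma sum_inv_cube_le n :
  \sum_(a < n) (if a == 0%N :> nat then 0 else a.+1%:R ^- 3) <= 1 / 4 :> R.
Proof.
case: n => [|n]; first by rewrite big_ord0; lra.
(* Telescoping of 1/a^3 <= 1/((a - 1) a (a + 1)), whose sum over a >= 2 is 1/4. *)
suff : \sum_(a < n.+1) (if a == 0%N :> nat then 0 else a.+1%:R ^- 3) <= 1 / 4 - (2 * n.+1%:R * n.+2%:R)^-1 :> R.
  by move/le_trans; apply; rewrite lerBlDr lerDl invr_ge0 !mulr_ge0.
elim: n => [|n IH]; first by rewrite big_ord_recl big_ord0 /=; lra.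
rewrite big_ord_recr /=; apply: le_trans (lerD IH (lexx _)) _.
have x0 : 1 <= n.+1%:R :> R by rewrite ler1n.
have -> : n.+3%:R = n.+1%:R + 2 :> R by rewrite -addn2 natrD.
have -> : n.+2%:R = n.+1%:R + 1 :> R by rewrite -addn1 natrD.
move: x0; set x : R := n.+1%:R => x0.
have x1 : 0 < x by lra. have x2 : 0 < x + 1 by lra. have x3 : 0 < x + 2 by lra.
have : (x + 1) ^- 3 <= (2 * x * (x + 1))^-1 - (2 * (x + 1) * (x + 2))^-1.
  have -> : (2 * x * (x + 1))^-1 - (2 * (x + 1) * (x + 2))^-1 = (x * (x + 1) * (x + 2))^-1 :> R.
    by field; rewrite !lt0r_neq0.
  rewrite lef_pV2 ?posrE ?exprn_gt0 ?mulr_gt0 //.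
  have -> : (x + 1) ^+ 3 = (x + 1) * (x * (x + 2)) + (x + 1) by ring.
  have -> : x * (x + 1) * (x + 2) = (x + 1) * (x * (x + 2)) by ring.
  lra.
by move: ((x + 1) ^- 3) ((2 * x * (x + 1))^-1) ((2 * (x + 1) * (x + 2))^-1) => ? ? ?; lra.
Qed.

Lemma sqrt_count_weight_le a l m : (0 < a)%N -> (m.+1 <= l)%N ->
  (sqrt_count N a)%:R * a%:R ^- l <= a%:R ^- m :> R.
Proof.
move=> a0 ml; have a1 : 1 <= a%:R :> R by rewrite ler1n.
have a2 : 0 < a%:R :> R by rewrite ltr0n.
apply: le_trans (_ : a%:R * a%:R ^- m.+1 <= _); last first.
  by rewrite exprS invfM mulrA mulfV ?mul1r // lt0r_neq0.
apply: ler_pM; rewrite ?invr_ge0 ?exprn_ge0 ?(ltW a2) //.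
  by rewrite ler_nat sqrt_count_le.
by rewrite lef_pV2 ?posrE ?exprn_gt0 // ler_weXn2l.
Qed.

Lemma tail_weight_sums_ge3 l : (3 <= l)%N -> sums_le (tail_weight l) (3 / 4).
Proof.
move=> l3; apply: (@tail_weight_sums l (fun a => a.+1%:R ^- 2)).
- by move=> a; rewrite invr_ge0 exprn_ge0.
- by move=> a _; exact: sqrt_count_weight_le.
- exact: sum_inv_sqr_le.
Qed.

Lemma tail_weight_sums_ge4 l : (4 <= l)%N -> sums_le (tail_weight l) (1 / 4).
Proof.
move=> l3; apply: (@tail_weight_sums l (fun a => a.+1%:R ^- 3)).
- by move=> a; rewrite invr_ge0 exprn_ge0.
- by move=> a _; exact: sqrt_count_weight_le.
- exact: sum_inv_cube_le.
Qed.

Lemma harmonic_le :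
  \sum_(a < 16 * N) (if a == 0%N :> nat then 0 else a.+1%:R^-1) <= 346 / 100 + (N%:R - 3) / 3 :> R.
Proof.
pose f a : R := if a == 0%N then 0 else a.+1%:R^-1.
rewrite -/(f _) (eq_bigr (fun a : 'I__ => f a)) // -(subnK N3); move: (N - 3)%N => t.
(* For N = 3 the 47 reciprocals are added up; raising N by one adds 16 terms, each at most 1/48. *)
elim: t => [|t IH].
  rewrite -(big_mkord predT f) /index_iota /= !big_cons big_nil /f /=; lra.
have e : (16 * (t.+1 + 3) = 16 * (t + 3) + 16)%N by lia.
rewrite e big_split_ord /=.
have IH' : \sum_(i < 16 * (t + 3)) f (lshift 16 i) <= 346 / 100 + ((t + 3)%:R - 3) / 3 by exact: IH.
apply: le_trans (lerD IH' (_ : _ <= 1 / 3)) _; last by rewrite addSn -natr1; lra.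
apply: le_trans (_ : \sum_(i < 16) (48 : R)^-1 <= _); last by rewrite sumr_const card_ord -mulr_natr; lra.
apply: ler_sum => i _; rewrite /f /= ifF; last by apply/negbTE; lia.
by rewrite lef_pV2 ?posrE ?ltr0n // ler_nat; lia.
Qed.

Let s : R := 4 * Num.sqrt N%:R.
Let u (a : nat) : R := if (a.+1 <= 16 * N)%N then a.+1%:R^-1 else s * (a.+1%:R * Num.sqrt a.+1%:R)^-1.
(* Using r(a) <= a for a <= 16 N and r(a) <= 4 sqrt (N a) beyond, the sum of the
   r(a) / a^2 over a >= 2 is at most the harmonic sum over 2 <= a <= 16 N plus 2;
   346 / 100 bounds the harmonic sum over 2 <= a <= 48. *)
Definition tail_const : R := 346 / 100 + (N%:R - 3) / 3 + 2.

Let s0 : 0 <= s. Proof. by rewrite mulr_ge0 ?sqrtr_ge0. Qed.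

Let u0 a : 0 <= u a.
Proof. by rewrite /u; case: ifP => _; rewrite ?mulr_ge0 ?invr_ge0 ?mulr_ge0 ?sqrtr_ge0. Qed.

Lemma tail_weight_sums_2 : sums_le (tail_weight 2) tail_const.
Proof.
apply: (@tail_weight_sums 2 u) => // [a a0|n].
  rewrite /u; case: ifP => _; first by rewrite -[a.+1%:R^-1]/(a.+1%:R ^- 1) sqrt_count_weight_le.
  have a1 : 0 < a.+1%:R :> R by rewrite ltr0n.
  apply: le_trans (_ : s * Num.sqrt a.+1%:R * a.+1%:R ^- 2 <= _).
    by rewrite ler_wpM2r ?invr_ge0 ?exprn_ge0 // sqrt_count_real_le.
  rewrite -mulrA ler_wpM2l //.
  have : 0 < Num.sqrt a.+1%:R :> R by rewrite sqrtr_gt0.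
  have : Num.sqrt a.+1%:R ^+ 2 = a.+1%:R :> R by rewrite sqr_sqrtr // ltW.
  move: (Num.sqrt _) => v <- v0.
  by rewrite le_eqVlt; apply/orP; left; apply/eqP; field; exact: lt0r_neq0.
pose h a : R := if a == 0%N then 0 else u a.
have h0 a : 0 <= h a by rewrite /h; case: ifP.
have base : \sum_(a < 16 * N) h a <= 346 / 100 + (N%:R - 3) / 3.
  apply: le_trans harmonic_le; apply: ler_sum => -[a ha] _ /=.
  by rewrite /h /u ha.
rewrite (eq_bigr (fun a : 'I__ => h a)) //.
have N16 : 0 < (16 * N)%:R :> R by rewrite ltr0n muln_gt0.
(* The bounds a and 4 sqrt(N a) coincide at a = 16 N. There s = sqrt(16 N), so the telescoped
   remainder 2 s / sqrt(16 N) is 2. *)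
have big m : \sum_(a < 16 * N + m) h a <= 346 / 100 + (N%:R - 3) / 3 + 2 - 2 * s / Num.sqrt (16 * N + m)%:R.
  elim: m => [|m IH].
    rewrite addn0; have -> : Num.sqrt (16 * N)%:R = s.
      by rewrite natrM sqrtrM // (_ : 16%:R = 4 ^+ 2) ?sqrtr_sqr ?ger0_norm // -natrX.
    have sp : 0 < s by rewrite mulr_gt0 ?sqrtr_gt0 ?ltr0n.
    rewrite mulfK ?lt0r_neq0 //; apply: le_trans base _; lra.
  rewrite addnS big_ord_recr /=; apply: le_trans (lerD IH (lexx _)) _.
  have x0 : 0 < (16 * N + m)%:R :> R by rewrite ltr0n; lia.
  have := ler_wpM2l s0 (inv_three_halves_le x0); rewrite natr1.
  rewrite {1}/h ifF; last by apply/negbTE; lia.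
  rewrite /u ifF; last by apply/negbTE; lia.
  have e (w : R) : s * (2 / w) = 2 * s / w by ring.
  rewrite mulrBr !e; move: (2 * s / _) (2 * s / _) (s * _).
  by move=> p1 p2 p3; lra.
have [nN|nN] := leqP n (16 * N).
  have h1 : \sum_(a < n) h a <= \sum_(a < 16 * N) h a.
    rewrite -(subnKC nN) big_split_ord /= lerDl; exact: sumr_ge0.
  by rewrite /tail_const; move: h1 base; set X := \sum_(_ < n) _; set Z := \sum_(_ < _) _; lra.
have := big (n - 16 * N)%N; rewrite subnKC ?(ltnW nN) // => /le_trans; apply.
by rewrite /tail_const gerBl divr_ge0 ?sqrtr_ge0 // mulr_ge0.
Qed.

End TailWeights.

Lemma has_sum_ge_partial (R : realType) (I : choiceType) (g : I -> R) (S : R) :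
  (forall i, 0 <= g i) -> has_sum (fun i => (g i)%:C) S%:C -> sums_le g S.
Proof.
move=> g0 h A; apply/ler_addgt0Pr => e /h[B hB].
have := hB _ (fsubsetUr A B); rewrite -rmorph_sum -rmorphB nc_real.
rewrite (big_fset_split _ (fsubsetUl A B)) => h1.
have : 0 <= \sum_(i <- ((A `|` B) `\` A)%fset) g i by exact: sumr_ge0.
have := ler_norm (\sum_(i <- A) g i + \sum_(i <- ((A `|` B) `\` A)%fset) g i - S); lra.
Qed.

(** * Sign of the coefficients *)

Section CoefficientSign.
Variables (R : realType) (k N n : nat) (chi : nat -> nat -> int).
Hypotheses (hk : (2 <= k)%N) (N3 : (3 <= N)%N) (hn : (1 <= n)%N).
Hypothesis N4 : (N %% 4 = 0)%N \/ (N %% 4 = 3)%N.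
Hypothesis chi_le1 : forall a b, `|chi a b| <= 1.
Hypothesis chi_principal : chi 0 (N %% 2) = 1.
Hypothesis chi_reflect : forall a b, good N a.+1 b -> (0 < b)%N -> chi a (2 * a.+1 - b) = chi a b.

Let N0 : (0 < N)%N. Proof. exact: leq_trans N3. Qed.
Let b (j : nat) : R := bessel_term R k N 0 j n.
Let f : nat * nat * nat -> R[i] := coef_term R k N chi n.
Let b_ge0 j : 0 <= b j. Proof. exact: bessel_term_ge0. Qed.

Let bessel_scale a j : bessel_term R k N a j n = b j * a.+1%:R ^- (2 * j).
Proof.
have a0 : a.+1%:R != 0 :> R by rewrite pnatr_eq0.
have e : disc_ratio R N a ^+ j = disc_ratio R N 0 ^+ j * a.+1%:R ^- (2 * j).
  rewrite exprM -exprVn -exprMn; congr (_ ^+ _); rewrite /disc_ratio expr1n.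
  by rewrite mulr1 invfM mulrA.
by rewrite /b /bessel_term e; ring.
Qed.

Let b0_gt0 : 0 < b 0.
Proof.
rewrite /b /bessel_term expr0 !mulr_gt0 ?invr_gt0 ?exprn_gt0 ?mulr_gt0 ?pi_gt0 ?ltr0n ?fact_gt0 //.
by rewrite /negbin bin0.
Qed.

Let B_exists : exists2 B : R, has_sum (fun j => (b j)%:C) B%:C & sums_le b B.
Proof.
have [B hB] := has_sum_ge0 b_ge0 (bessel_term_sums R hk N0 n).
by exists B => //; exact: has_sum_ge_partial hB.
Qed.

Let f_tail (p : nat * nat * nat) : R[i] := if p.1.1 == 0%N then 0 else f p.
Let f_main (p : nat * nat * nat) : R[i] := if p.1.1 == 0%N then f p else 0.

Let f_tail_le p : nc (f_tail p) <= tail_weight R N (k + 2 * p.2) p.1 * b p.2.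
Proof.
rewrite /f_tail /tail_weight; case: ifP => [_|_]; first by rewrite nc0 mul0r.
rewrite /f /coef_term !ncM !ncX ncN nc1 expr1n mul1r nc_real.
rewrite ger0_norm ?bessel_term_ge0 // nc_qpar /= mulr0 oppr0 expR0 expr1n mulr1.
rewrite bessel_scale mulrCA mulrC; apply: ler_wpM2r => //.
apply: le_trans (_ : weight R N k p.1 * p.1.1.+1%:R ^- (2 * p.2) <= _).
  by rewrite ler_wpM2r ?invr_ge0 ?exprn_ge0 // nc_cweight.
by rewrite /weight; case: ifP => _; rewrite ?mul0r // exprD invfM.
Qed.

Let tail_bound (B : R) : sums_le b B -> exists2 C : R, C < B & sums_le (fun p => nc (f_tail p)) C.
Proof.
move=> hB; have bB (A : nat) : \sum_(j < A) b j <= B.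
  by rewrite -sum_fset_iota; exact: hB.
(* [kap j] bounds the total weight of a >= 2 in the j-th term, so the sum of kap_j b_j is to be
   compared with the sum of b_j. *)
suff [C CB [kap hkap hC]] : exists2 C : R, C < B & exists2 kap : nat -> R,
    (forall j, sums_le (tail_weight R N (k + 2 * j)) (kap j)) &
    sums_le (fun j => kap j * b j) C.
  exists C => //; apply: sums_le_mono f_tail_le _.
  pose g (q : nat * (nat * nat)) := tail_weight R N (k + 2 * q.1) q.2 * b q.1.
  have hg : sums_le g C.
    apply: (sums_le_sigma _ _ hC) => [q|j A]; first by rewrite mulr_ge0 ?tail_weight_ge0.
    by rewrite /g /= -mulr_suml ler_wpM2r //; exact: hkap.
  pose sw (p : nat * nat * nat) := (p.2, p.1).
  have swi : injective sw by move=> [? ?] [? ?] [-> ->].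
  exact: (sums_le_inj swi hg).
have b0B := bB 1%N; rewrite big_ord_recl big_ord0 addr0 /= in b0B.
have [k3|k2] := leqP 3 k.
  exists (3 / 4 * B); first by have := b0_gt0; lra.
  exists (fun=> 3 / 4); last by apply: sums_leZ => //; lra.
  by move=> j; apply: tail_weight_sums_ge3 => //; lia.
have kE : k = 2%N by lia.
pose K := tail_const R N.
have N3R : 3 <= N%:R :> R by rewrite ler_nat.
have K4 : 1 / 4 <= K by rewrite /K /tail_const; lra.
(* The excess over the ratio 1/4, which occurs for j = 0 only. *)
pose d (j : nat) : R := if j == 0%N then (K - 1 / 4) * b 0 else 0.
have d0 j : 0 <= d j by rewrite /d; case: ifP => // _; rewrite mulr_ge0 // subr_ge0.
have hd : sums_le d ((K - 1 / 4) * b 0).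
  have := @sums_le_support R d 1 d0; rewrite big_ord_recl big_ord0 addr0 /=; apply.
  by case.
exists (1 / 4 * B + (K - 1 / 4) * b 0); last first.
  exists (fun j => if j == 0%N then K else 1 / 4).
    move=> j; rewrite kE; case: eqP => [->|j0]; first exact: tail_weight_sums_2.
    by apply: tail_weight_sums_ge4 => //; lia.
  apply: sums_le_mono (sums_leD (sums_leZ _ hB) hd) => [j|]; last by lra.
  by rewrite /d; case: eqP => [->|_]; rewrite ?addr0 //; lra.
(* t = pi^2 n^2 N is the natural variable of the Bessel series at a = 1. *)
pose t : R := (2 * pi * n%:R) ^+ 2 * disc_ratio R N 0.
have p3 := pi_ge3 R.
have t9 : 9 * N%:R <= t.
  rewrite /t /disc_ratio expr1n mulr1.
  have n1 : 1 <= n%:R :> R by rewrite ler1n.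
  have : 6 * 1 <= 2 * pi * n%:R :> R by apply: ler_pM => //; lra.
  rewrite mulr1 => h6; have : 6 ^+ 2 <= (2 * pi * n%:R) ^+ 2 :> R.
    by apply: lerXn2r; rewrite ?nnegrE //; lra.
  move: ((2 * pi * n%:R) ^+ 2) => W hW.
  rewrite mulrCA mulrC ler_pM2l; last by lra.
  lra.
have bj j : b j = b 0 * (t ^+ j * (6 * j.+1%:R / (2 * j + 3)`!%:R)).
  have nb i : negbin 2 i = i.+1 by rewrite /negbin addn2 /= binSn.
  have e1 : ((2 * 2 + 2 * j).-1 = 2 * j + 3)%N by lia.
  have F0 : (2 * j + 3)`!%:R != 0 :> R by rewrite pnatr_eq0 -lt0n fact_gt0.
  have f3 : 3`!%:R = 6 :> R by [].
  rewrite /b /bessel_term kE /t !nb e1 -[((2 * 2 + 2 * 0).-1)%N]/3%N -[(2 * 2 + 2 * 0)%N]/4%N f3 expr0.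
  have e2 : ((2 * pi * n%:R) ^+ 2 * disc_ratio R N 0) ^+ j =
      (2 * pi) ^+ (2 * j) * n%:R ^+ (2 * j) * disc_ratio R N 0 ^+ j.
    by rewrite exprMn -exprM exprMn.
  rewrite e2 (exprD (2 * pi) (2 * 2)) (exprD n%:R (2 * j)) -[(2 * 2)%N]/4%N.
  move: (_`!%:R) F0 ((2 * pi) ^+ (2 * j)) (n%:R ^+ (2 * j)) (disc_ratio R N 0 ^+ j) => F F0 x y w.
  by field.
(* Four terms suffice; the coefficients 6 (j + 1) / (2j + 3)! are 1, 1/10, 1/280 and 1/15120. *)
have := bB 4%N; rewrite !big_ord_recr big_ord0 /= add0r.
rewrite (bj 1%N) (bj 2%N) (bj 3%N) !factS fact0 !natrM /= => h4.
have b00 := b0_gt0.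
suff : K - 1 / 4 < 3 / 4 * (1 + t / 10 + t ^+ 2 / 280 + t ^+ 3 / 15120).
  move=> hK; have := ltr_pM2l b00 (K - 1 / 4) (3 / 4 * (1 + t / 10 + t ^+ 2 / 280 + t ^+ 3 / 15120)).
  rewrite hK => hK2.
  lra.
(* From t >= 9 N and N >= 3. The powers of t are linearized at 27, and the slope in N then exceeds
   the slope 1/3 of [tail_const]. *)
have t27 : 27 <= t by lra.
have t2 : 27 * t <= t ^+ 2 by rewrite expr2; apply: ler_wpM2r; lra.
have t3 : 27 * t ^+ 2 <= t ^+ 3 by rewrite exprS; apply: ler_wpM2r; lra.
rewrite /K /tail_const; lra.
Qed.

Let conj_qpar (t : R) : (qpar t%:C)^*%C = qpar (- t)%:C.
Proof. by rewrite !qpar_real mulrN cosN sinN. Qed.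

(** 2a - b is the representative of -b modulo 2a; b = 0 and b >= 2a are fixed, so that this is an
    involution of all indices. *)
Let refl (p : nat * nat * nat) : nat * nat * nat :=
  let: (a, b, j) := p in
  (a, (if (0 < b < 2 * a.+1)%N then (2 * a.+1 - b)%N else b), j).

Let refl_inj : injective refl.
Proof.
move=> [[a b1] j] [[a' b2] j'] /= [-> + ->] => h; congr ((_, _), _).
by move: h; case: ifP; case: ifP; lia.
Qed.

Let refl_refl p : refl (refl p) = p.
Proof.
case: p => [[a b1] j] /=; congr ((_, _), _).
case h: (0 < b1 < 2 * a.+1)%N; last by rewrite h.
by rewrite ifT; lia.
Qed.

Let good_refl a b1 : (0 < b1 < 2 * a.+1)%N -> good N a.+1 (2 * a.+1 - b1) = good N a.+1 b1.
Proof.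
move=> /andP[h0 h1]; rewrite /good h1; congr andb; first by lia.
have e : ((2 * a.+1 - b1) ^ 2 + N + b1 * (4 * a.+1) = a.+1 * (4 * a.+1) + (b1 ^ 2 + N))%N.
  have [c hc] : exists c, (2 * a.+1 = b1 + c)%N by exists (2 * a.+1 - b1)%N; lia.
  rewrite hc addKn -!mulnn; nia.
have := congr1 (fun m => (4 * a.+1 %| m)%N) e; rewrite /=.
by rewrite (dvdn_addl _ (dvdn_mull b1 (dvdnn (4 * a.+1)))) (dvdn_addr _ (dvdn_mull a.+1 (dvdnn (4 * a.+1)))).
Qed.

Let conjM (x y : R[i]) : (x * y)^*%C = x^*%C * y^*%C.
Proof. exact: rmorphM. Qed.

Let conj_sign m : ((-1) ^+ m : R[i])^*%C = (-1) ^+ m.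
Proof. by rewrite rmorphXn rmorphN rmorph1. Qed.

Let conj_f p : (f p)^*%C = f (refl p).
Proof.
case: p => [[a b1] j].
have -> : f (a, b1, j) = (-1) ^+ k * cweight R k N chi (a, b1) *
    (bessel_term R k N a j n)%:C * qpar (root_shift R (a, b1))%:C ^+ n by [].
rewrite 3!conjM conj_sign.
have -> (t : R) : (qpar t%:C ^+ n)^*%C = qpar (- t)%:C ^+ n.
  by rewrite -conj_qpar rmorphXn.
have real_conj (x : R) : (x%:C)^*%C = x%:C by rewrite /= oppr0.
have cw : (cweight R k N chi (a, b1))^*%C = cweight R k N chi (a, b1).
  rewrite /cweight /=; case: ifP => _; last by rewrite rmorph0.
  by rewrite rmorphM fmorphV rmorphXn rmorph_int rmorph_nat.
rewrite cw real_conj /f /coef_term /=.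
case: ifP => hb; last first.
  rewrite /cweight /good /=; have [->|b0] := posnP b1.
    by rewrite /root_shift /= mul0r oppr0.
  by rewrite ifF ?mulr0 ?mul0r //; move: hb; rewrite b0 /= => ->.
have [h0 h1] := andP hb.
have -> : cweight R k N chi (a, (2 * a.+1 - b1)%N) = cweight R k N chi (a, b1).
  rewrite /cweight /= good_refl //; case: ifP => // hg; rewrite chi_reflect //.
congr (_ * _ ^+ _).
have -> : (root_shift R (a, (2 * a.+1 - b1)%N))%:C = 1 + (- root_shift R (a, b1))%:C.
  rewrite -[1]/((1 : R)%:C) -rmorphD; congr (_%:C); rewrite /root_shift /= natrB ?(ltnW h1) // natrM.
  have : a.+1%:R != 0 :> R by rewrite pnatr_eq0.
  by move: (a.+1%:R) => x x0; field.
by rewrite qparD qpar1 mul1r.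
Qed.

Let qpar_half : qpar ((N %% 2)%:R / 2 : R)%:C ^+ n = (-1) ^+ (n * N).
Proof.
rewrite -(signr_odd _ (n * N)) oddM modn2 qpar_real.
have -> : 2 * pi * ((odd N)%:R / 2) = pi * (odd N)%:R :> R by field.
case: (odd N); last by rewrite mulr0 cos0 sin0 andbF expr0 -[_ +i* _]/(1 : R[i]) expr1n.
rewrite mulr1 cospi sinpi andbT signr_odd; congr (_ ^+ _).
by apply/eqP; rewrite eq_complex /= oppr0 !eqxx.
Qed.

Lemma coef_sign (S : R[i]) : has_sum f S -> 0 < (-1) ^+ (k + n * N) * S.
Proof.
move=> hS; have [B hB bB] := B_exists; have [C CB hC] := tail_bound bB.
have [S2 h2] := has_sum_exists hC.
have S2C := has_sum_norm_le h2 hC.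
have h1 : has_sum f_main (S - S2).
  have := has_sumD hS (has_sumZ (-1) h2); rewrite mulN1r; apply: has_sum_ext => p.
  by rewrite mulN1r /f_tail /f_main; case: ifP; rewrite ?subr0 ?subrr.
pose h (j : nat) : nat * nat * nat := ((0, N %% 2), j)%N.
have hI : injective h by move=> i j [].
have sgn2 m : (-1) ^+ m * (-1) ^+ m = 1 :> R[i] by rewrite -exprMn mulrNN mulr1 expr1n.
have hmain : S - S2 = (-1) ^+ (k + n * N) * B%:C.
  apply: has_sum_unique (_ : has_sum (f_main \o h) _) _.
    apply: has_sum_inj hI _ h1 => -[[a b1] j] hp; rewrite /f_main /=; case: eqP => // a0.
    have gN : good N 1 b1 = false.
      apply/negP => /andP[g1 g2]; have := hp j; rewrite /h a0.
      have -> : b1 = (N %% 2)%N.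
        move: g1 g2; rewrite -mulnn; case: b1 {hp} => [|[|?]] //= _ g2; case: N4 => ?; lia.
      by rewrite eqxx.
    by rewrite /f /coef_term /cweight /= a0 gN mulr0 !mul0r.
  apply: has_sum_ext (has_sumZ ((-1) ^+ (k + n * N)) hB) => j.
  rewrite /f_main /h /= /f /coef_term /cweight /=.
  have -> : good N 1 (N %% 2).
    by rewrite /good; case: N4 => h4; rewrite modn2; case: (odd N) (odd_double_half N) => ? /=; lia.
  rewrite chi_principal mulr1z mul1r expr1n invr1 mulr1 -/(b j).
  have -> : root_shift R (0%N, (N %% 2)%N) = (N %% 2)%:R / 2 by rewrite /root_shift /= mulr1.
  by rewrite qpar_half exprD; ring.
have SE : (-1) ^+ (k + n * N) * S = B%:C + (-1) ^+ (k + n * N) * S2.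
  have -> : S = (S - S2) + S2 by rewrite subrK.
  by rewrite hmain mulrDr mulrA sgn2 mul1r.
have Sreal : S^*%C = S.
  have hr : has_sum (f \o refl) S.
    by apply: has_sum_inj refl_inj _ hS => p /(_ (refl p)); rewrite refl_refl eqxx.
  by apply: has_sum_unique (has_sum_conj hS) _; apply: has_sum_ext hr => p; rewrite conj_f.
have Im0 : complex.Im ((-1) ^+ (k + n * N) * S) = 0.
  have : ((-1) ^+ (k + n * N) * S)^*%C = (-1) ^+ (k + n * N) * S.
    by rewrite conjM conj_sign Sreal.
  by case: (_ * S) => x y [] /eqP; rewrite eq_sym -addr_eq0 -mulr2n mulrn_eq0 /= => /eqP.
have Re0 : 0 < complex.Re ((-1) ^+ (k + n * N) * S).
  rewrite SE; have : nc ((-1) ^+ (k + n * N) * S2) <= C.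
    by rewrite ncM ncX ncN nc1 expr1n mul1r.
  set w := _ * S2 => hw; have := nc_geRe w; rewrite ler_norml => /andP[+ _].
  by case: (w) hw => x y /=; move=> *; lra.
by move: Im0 Re0; case: (_ * S) => x y /= -> x0; rewrite ltcE /= eqxx.
Qed.

End CoefficientSign.

(** * Application to discriminants and genus characters *)

Lemma disc_product (d D : int) : discriminant d -> discriminant D -> d * D < 0 ->
  exists N : nat, [/\ d * D = - N%:Z, (3 <= N)%N & (N %% 4 = 0)%N \/ (N %% 4 = 3)%N].
Proof.
move=> hd hD; have : ((d * D) %% 4)%Z = 0 \/ ((d * D) %% 4)%Z = 1.
  rewrite -modzMml -modzMmr; case: hd => ->; case: hD => ->; [left|left|left|right]; by [].
by move: (d * D) => x hx x0; exists `|x|%N; split; lia.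
Qed.

Lemma fkdD_const_gt0 (R : realType) (k : nat) (d D : int) : discriminant d ->
  d * D < 0 -> 0 < fkdD_const R k d D.
Proof.
move=> hd hdD; have d0 : d != 0 by apply: contraTneq hdD => ->; rewrite mul0r.
have D0 : D != 0 by apply: contraTneq hdD => ->; rewrite mulr0.
rewrite /fkdD_const mulr_gt0 //.
  by rewrite divr_gt0 ?exprn_gt0 ?mulr_gt0 ?pi_gt0 ?ltr0n ?fact_gt0.
case: ifP => _; last rewrite mulr_gt0 ?exprn_gt0 ?ltr0n ?conductor_gt0 //.
  by rewrite powR_gt0 // ltr0z normr_gt0.
by rewrite powR_gt0 // ltr0z normr_gt0.
Qed.

Lemma coef_zero (R : realType) (k N : nat) (chi : nat -> nat -> int) (c : R[i]) :
  (2 <= k)%N -> has_sum (coef_term R k N chi 0) c -> c = 0.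
Proof.
move=> hk hc; have f0 p : coef_term R k N chi 0 p = 0.
  rewrite /coef_term /bessel_term expr0n (_ : _ == _ = false); last by apply/negbTE; lia.
  by rewrite mulr0 mulr0 mul0r.
have := @has_sum_finite R _ (coef_term R k N chi 0) fset0%fset (fun p _ => f0 p).
by rewrite big_seq_fset0 => h; exact: has_sum_unique hc h.
Qed.

Lemma lattice_char_principal (d D : int) (N : nat) : discriminant d ->
  fundamental_discriminant D -> d * D < 0 -> d * D = - N%:Z -> (0 < N)%N ->
  (N %% 4 = 0)%N \/ (N %% 4 = 3)%N -> lattice_char D N 0 (N %% 2) = 1.
Proof.
move=> hd hD hdD dDE N0 N4; rewrite /lattice_char.
have h4 : ((N %% 2) ^ 2 + N = (((N %% 2) ^ 2 + N) %/ (4 * 1)) * 4)%N.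
  by rewrite divnK //; case: N4 => h; rewrite -mulnn modn2; case: (odd N) (odd_double_half N) => ? /=; lia.
move: h4; set c := (_ %/ _)%N => h4.
have disc : (N %% 2)%N%:Z ^+ 2 - 4 * c%:Z = d * D.
  rewrite dDE; move: h4; rewrite -mulnn expr2; move: (N %% 2)%N => b1 h4.
  have : ((b1 * b1 + N)%N%:Z = (c * 4)%N%:Z)%R by rewrite h4.
  by rewrite PoszD !PoszM; lia.
apply: (genus_char_principal hd hD hdD disc).
apply: (@posdefP N) => //; rewrite /form_disc mulr1 disc.
exact: dDE.
Qed.

(** With leading coefficient a, the form attached to 2a - b is the translate by 1 of [a, -b, c]. *)
Lemma lattice_char_reflect (D : int) (N a b : nat) : good N a.+1 b -> (0 < b)%N ->
  lattice_char D N a (2 * a.+1 - b) = lattice_char D N a b.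
Proof.
move=> /andP[hb /dvdnP[c hc]] b0; rewrite /lattice_char hc mulnK //.
have e : ((2 * a.+1 - b) ^ 2 + N + b * (4 * a.+1) = (a.+1 + c) * (4 * a.+1))%N.
  rewrite mulnDl -hc; have [u hu] : exists u, (2 * a.+1 = b + u)%N by exists (2 * a.+1 - b)%N; lia.
  by rewrite hu addKn -!mulnn; nia.
have bc : (b <= a.+1 + c)%N.
  by rewrite -(leq_pmul2r (isT : (0 < 4 * a.+1)%N)) -e leq_addl.
have -> : ((2 * a.+1 - b) ^ 2 + N = (a.+1 + c - b) * (4 * a.+1))%N.
  by rewrite mulnBl -e addnK.
rewrite mulnK // -(genus_char_opp D _ b%:Z) -(genus_char_translate D _ (- b%:Z) _ 1).
congr (genus_char D (_, _, _)).
  by rewrite -subzn ?(ltnW hb) // PoszM; ring.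
by rewrite -subzn // PoszD; ring.
Qed.

(* In R[i], 0 < w means that w is real and positive. *)
Theorem proposition1p5 (R : realType) (k : nat) (d D : int)
    (hk : (2 <= k)%N)
    (hd : discriminant d) (hD : discriminant D)
    (hdD : d * D < 0)
    (hDf : fundamental_discriminant D) :
  (forall n : nat, (1 <= n)%N ->
     0 < (-1) ^ (k%:Z + n%:Z * d * D) * fkdD_coef R k d D n) /\
  (forall n : nat, (1 <= n)%N -> fkdD_coef R k d D n != 0).
Proof.
suff pos : forall n : nat, (1 <= n)%N ->
     0 < (-1) ^ (k%:Z + n%:Z * d * D) * fkdD_coef R k d D n.
  split=> // n hn; apply/negP => /eqP c0.
  by have := pos n hn; rewrite c0 mulr0 ltxx.
have [N [dDE N3 N4]] := disc_product hd hD hdD.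
have N0 : (0 < N)%N by exact: leq_trans N3.
pose chi := lattice_char D N.
have chi_le1 a b : `|chi a b| <= 1 by exact: lattice_char_le1.
have [c hc] := choice (coef_exists R hk N0 chi_le1).
have C0 := fkdD_const_gt0 R k hd hdD.
(* Since [fkdD_coef] is a chosen expansion, exhibiting one identifies it through [qcoef_eq]. *)
have qexp : is_qexpansion (Num.sqrt `|d * D|%:~R / 2) (fkdD k d D)
    (fun n => (fkdD_const R k d D)%:C * c n).
  move=> z hz; have hz' : Num.sqrt N%:R / 2 < complex.Im z.
    by move: hz; rewrite dDE normrN.
  have [S [h1 h2]] := theta_expansion hk N0 chi_le1 hz' hc.
  rewrite /fkdD dDE (theta_sum hk N0 h1).
  apply: has_sum_qexpansion.
    by rewrite (coef_zero hk (hc 0%N)) mulr0.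
  by apply: has_sum_ext (has_sumZ _ h2) => n; rewrite mulrA.
move=> n hn; rewrite /fkdD_coef (qcoef_eq qexp hn).
(* The integer exponent k - n N may be negative; only its parity, that of k + n N, matters. *)
have -> : (-1) ^ (k%:Z + n%:Z * d * D) = (-1) ^+ (k + n * N) :> R[i].
  have -> : k%:Z + n%:Z * d * D = k%:Z - (n * N)%N%:Z by rewrite -mulrA dDE PoszM; ring.
  rewrite expfzDr ?oppr_eq0 ?oner_eq0 // -invr_expz -!exprnP invr_sign.
  by rewrite exprD.
rewrite mulrCA mulr_gt0 ?ltcR //.
apply: (coef_sign hk N3 hn N4 chi_le1 _ _ (hc n)).
  exact: lattice_char_principal hd hDf hdD dDE N0 N4.
exact: lattice_char_reflect.
Qed.
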